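(* Let $\mathbb{F}$ be a field and let $\Gamma$ be a finite ranked poset (with unique minimal element $*$). Then $\Gamma$ is uniform and the $\mathbb{F}$-algebra $R_\Gamma$ is Koszul if and only if $\Gamma$ is Cohen-Macaulay relative to $\mathbb{F}$, i.e. if and only if $\tilde H^n(X(a,b))=0$ for all $a<b$ in $\Gamma$ and all $n\ne\dim X(a,b)$.
   Context: Fix a field $\mathbb{F}$; all topological (reduced) cohomology is with coefficients in $\mathbb{F}$. A poset $\Gamma$ with unique minimal element $*$ and strict order $<$ is ranked if for all $b\in\Gamma$ any two maximal chains in $[*,b]$ have the same length; this length is the rank $rk_\Gamma(b)$ (so $rk_\Gamma( * )=0$). For $x\in\Gamma$, $S_x(k)=\{y\le x : rk_\Gamma(y)=rk_\Gamma(x)-k\}$. Uniform: for $a,b\in S_x(1)$ write $a\sim_x b$ if there is $c\in S_a(1)\cap S_b(1)$, and extend $\sim_x$ to an equivalence relation on $S_x(1)$; $\Gamma$ is uniform if for every $x\ne *$ the relation $\sim_x$ has a unique equivalence class. The algebra $R_\Gamma$: generators $r_x$ for $*\neq x\in\Gamma$, and relations $r_xr_y=0$ whenever $y\notin S_x(1)$, and $r_x\sum_{y\in S_x(1)}r_y=0$ for all $x$ (terms with $y=*$ are omitted). It is graded with each $r_x$ of degree 1. A graded connected $\mathbb{F}$-algebra $R$ is Koszul if the bigraded Yoneda algebra $\mathrm{Ext}_R^{*,*}(\mathbb{F},\mathbb{F})$ is generated as an $\mathbb{F}$-algebra by $\mathrm{Ext}_R^{1,1}(\mathbb{F},\mathbb{F})$.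 The order complex $\Delta(P)$ of a finite poset $P$ is the simplicial complex whose $n$-simplices are the chains $b_0<\dots<b_n$ in $P$. For $a<b$ in $\Gamma$, $X(a,b)$ is the total space (geometric realization) of $\Delta((a,b))$, where $(a,b)=\{c: a<c<b\}$; its dimension is $rk_\Gamma(b)-rk_\Gamma(a)-2$. Conventions: $\dim\Delta(\emptyset)=-1$, $\tilde H^{-1}(\Delta(\emptyset))=\mathbb{F}$ and $\tilde H^n(\Delta(\emptyset))=0$ for $n\ne-1$. *)

(* Defs.v *)
From HB Require Import structures.
From mathcomp Require Import all_boot all_order all_algebra.
From mathcomp Require Import boolp finmap monalg.

Set Implicit Arguments.
Unset Strict Implicit.
Unset Printing Implicit Defensive.

Import GRing.Theory.

Local Open Scope ring_scope.
Local Open Scope quotient_scope.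

(* A finite poset has a unique minimal element iff it has a least one: such a
   poset is a finBPOrderType, and the element called * is \bot. *)
Section RankedPoset.
Context {disp : Order.disp_t} (G : finBPOrderType disp).
Implicit Types (x y a b c : G) (C : {set G}).

Definition chain C : bool := [forall x in C, forall y in C, (x >=< y)%O].

Definition max_chain b C : bool :=
  maxset [pred D : {set G} | chain D && (D \subset [set z | (\bot <= z <= b)%O])]
         C.

Definition ranked : Prop :=
  forall b C D, max_chain b C -> max_chain b D -> #|C| = #|D|.

(* When G is ranked, all the numbers in this maximum are equal. *)
Definition rk b : nat := (\max_(C : {set G} | max_chain b C) #|C|.-1)%N.

Definition S_ x (k : nat) : {set G} := [set y | (y <= x)%O && (rk y + k == rk x)%N].

Definition meets_below x : rel G :=
  [rel a b | [&& a \in S_ x 1, b \in S_ x 1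
             & [exists c, c \in S_ a 1 :&: S_ b 1]]].

(* connect is the reflexive-transitive closure; meets_below x is symmetric. *)
Definition sim x : rel G := connect (meets_below x).

Definition uniform : Prop :=
  forall x, x != \bot%O -> #|equivalence_partition (sim x) (S_ x 1)| = 1%N.

End RankedPoset.

Section OrderComplex.
Context (F : fieldType) {disp : Order.disp_t} {G : finBPOrderType disp}.
Implicit Types (P : {set G}) (n : int) (s : seq G) (f g : seq G -> F).

(* The n-simplex b_0 < ... < b_n is the sequence [:: b_0; ...; b_n]. The empty
   sequence is a simplex of dimension -1, so that these are the simplices of
   the augmented complex, which computes reduced cohomology. *)
Definition simplex P n s : bool :=
  [&& sorted <%O s, all [in P] s & (size s)%:Z == n + 1].

Definition face (i : nat) s : seq G := take i s ++ drop i.+1 s.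

(* The n-cochains are the functions on the n-simplices; f : seq G -> F stands
   for its restriction to them. *)
Definition coboundary f s : F := \sum_(i < size s) (-1) ^+ i * f (face i s).

Definition reduced_cohomology_vanishes P n : Prop :=
  forall f, (forall s, simplex P (n + 1) s -> coboundary f s = 0) ->
  exists g, forall s, simplex P n s -> f s = coboundary g s.

Definition open_interval (a b : G) : {set G} := [set c | (a < c < b)%O].

Definition dimX (a b : G) : int := (rk b)%:Z - (rk a)%:Z - 2.

End OrderComplex.

Definition cohen_macaulay (F : fieldType) {disp : Order.disp_t}
    (G : finBPOrderType disp) : Prop :=
  forall a b : G, (a < b)%O -> forall n : int, n != dimX a b ->
  reduced_cohomology_vanishes F (open_interval a b) n.

Inductive two_sided_ideal (A : nzRingType) (S : A -> Prop) : A -> Prop :=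
| ideal0 : two_sided_ideal S 0
| idealD u v :
    two_sided_ideal S u -> two_sided_ideal S v -> two_sided_ideal S (u + v)
| idealM a s b : S s -> two_sided_ideal S (a * s * b).

Section SplittingAlgebra.
Context (F : fieldType) {disp : Order.disp_t} (G : finBPOrderType disp).

Definition gens := {x : G | x != \bot%O}.

Local Notation free_alg := {malg F[{fmonom gens}]}.

Definition var (x : gens) : free_alg := << fmu x >>.

Variant relator : free_alg -> Prop :=
| relator_mul (x y : gens) :
    val y \notin S_ (val x) 1 -> relator (var x * var y)
| relator_sum (x : gens) :
    relator (var x * \sum_(y : gens | val y \in S_ (val x) 1) var y).

Definition relators : {pred free_alg} :=
  fun p => `[< two_sided_ideal relator p >].

Lemma relatorsP p : reflect (two_sided_ideal relator p) (p \in relators).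
Proof. exact: asboolP. Qed.

Lemma relatorsMl p q : q \in relators -> p * q \in relators.
Proof.
move=> /relatorsP qI; apply/relatorsP; elim: qI => [|u v _ IHu _ IHv|a s b Ss].
- by rewrite mulr0; apply: ideal0.
- by rewrite mulrDr; apply: idealD.
- by rewrite !mulrA; apply: idealM.
Qed.

Lemma relatorsMr p q : q \in relators -> q * p \in relators.
Proof.
move=> /relatorsP qI; apply/relatorsP; elim: qI => [|u v _ IHu _ IHv|a s b Ss].
- by rewrite mul0r; apply: ideal0.
- by rewrite mulrDl; apply: idealD.
- rewrite -(mulrA (a * s)); exact: idealM.
Qed.

Lemma relators_zmod_closed : zmod_closed relators.
Proof.
split=> [|u v Iu Iv]; first by apply/relatorsP; apply: ideal0.
have /relatorsP Iv' : (-1) * v \in relators by exact: relatorsMl.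
by apply/relatorsP; rewrite -mulN1r; apply: idealD => //; exact/relatorsP.
Qed.

HB.instance Definition _ :=
  GRing.isZmodClosed.Build free_alg relators relators_zmod_closed.

Lemma mcoeff1_relators p : p \in relators -> p@_mone = 0.
Proof.
have var0 x : (var x)@_mone = 0.
  rewrite /var mcoeffU; case: eqP => // /(congr1 (@fdeg _)).
  by rewrite /fdeg fm1 fmuE.
move=> /relatorsP; elim=> [|u v _ IHu _ IHv|a s b].
- exact: mcoeff0.
- by rewrite mcoeffD IHu IHv addr0.
- by case=> [x y _|x]; rewrite !rmorphM /= var0 !(mul0r, mulr0).
Qed.

Definition splitting_alg := Quotient.quot relators.
HB.instance Definition _ := GRing.Zmodule.on splitting_alg.

Local Notation R := splitting_alg.

Definition proj : free_alg -> R := \pi_(Quotient.quot relators).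

Definition one_R : R := proj 1.
Definition mul_R (u v : R) : R := proj (repr u * repr v).
Definition scale_R (c : F) (u : R) : R := proj (c *: repr u).

Lemma proj_eqP p q : reflect (proj p = proj q) (p - q \in relators).
Proof. by rewrite Quotient.idealrBE; exact: eqP. Qed.

Lemma reprK_R u : proj (repr u) = u.
Proof. exact: reprK. Qed.

Lemma repr_proj p : repr (proj p) - p \in relators.
Proof. by apply/proj_eqP; rewrite reprK_R. Qed.

Lemma proj_additive : zmod_morphism proj.
Proof. exact: (raddfB (\pi_(Quotient.quot relators))). Qed.

Lemma projM p q : mul_R (proj p) (proj q) = proj (p * q).
Proof.
apply/proj_eqP; rewrite -[_ * _](addrNK (p * repr (proj q))) -mulrBl -addrA.
rewrite -mulrBr rpredD //; [apply: relatorsMr|apply: relatorsMl];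
  exact: repr_proj.
Qed.

Lemma projZ c p : scale_R c (proj p) = proj (c *: p).
Proof.
apply/proj_eqP; rewrite -scalerBr -[_ - _]mul1r scalerAl.
by apply: relatorsMl; exact: repr_proj.
Qed.

Lemma projD p q : proj p + proj q = proj (p + q).
Proof. by rewrite -{1}[p](addrK q) proj_additive addrNK. Qed.

Fact mul_RA : associative mul_R.
Proof.
by move=> u v w; rewrite -[u]reprK_R -[v]reprK_R -[w]reprK_R !projM mulrA.
Qed.

Fact mul_1R : left_id one_R mul_R.
Proof. by move=> u; rewrite -[u]reprK_R projM mul1r. Qed.

Fact mul_R1 : right_id one_R mul_R.
Proof. by move=> u; rewrite -[u]reprK_R projM mulr1. Qed.

Fact mul_RDl : left_distributive mul_R +%R.
Proof.
move=> u v w; rewrite -[u]reprK_R -[v]reprK_R -[w]reprK_R.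
by rewrite !(projD, projM) mulrDl.
Qed.

Fact mul_RDr : right_distributive mul_R +%R.
Proof.
move=> u v w; rewrite -[u]reprK_R -[v]reprK_R -[w]reprK_R.
by rewrite !(projD, projM) mulrDr.
Qed.

Fact one_R_neq0 : one_R != 0.
Proof.
apply/eqP=> one0; have /proj_eqP : one_R = proj 0.
  by rewrite one0 -[X in _ = proj X](subrr 0) proj_additive subrr.
by rewrite subr0 => /mcoeff1_relators; rewrite rmorph1; apply/eqP/oner_neq0.
Qed.

HB.instance Definition _ := GRing.Zmodule_isNzRing.Build R
  mul_RA mul_1R mul_R1 mul_RDl mul_RDr one_R_neq0.

Fact scale_RA c d u : scale_R c (scale_R d u) = scale_R (c * d) u.
Proof. by rewrite -[u]reprK_R !projZ scalerA. Qed.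

Fact scale_1R : left_id 1 scale_R.
Proof. by move=> u; rewrite -[u]reprK_R projZ scale1r. Qed.

Fact scale_RDr : right_distributive scale_R +%R.
Proof.
move=> c u v; rewrite -[u]reprK_R -[v]reprK_R.
by rewrite !(projD, projZ) scalerDr.
Qed.

Fact scale_RDl u : {morph scale_R^~ u : c d / c + d}.
Proof. by move=> c d; rewrite -[u]reprK_R !(projZ, projD) scalerDl. Qed.

HB.instance Definition _ := GRing.Zmodule_isLmodule.Build F R
  scale_RA scale_1R scale_RDr scale_RDl.

Fact scale_RAl c u v : scale_R c (mul_R u v) = mul_R (scale_R c u) v.
Proof. by rewrite -[u]reprK_R -[v]reprK_R !(projM, projZ) scalerAl. Qed.

HB.instance Definition _ := GRing.Lmodule_isLalgebra.Build F R scale_RAl.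

Lemma free_alg_scaleAr c (p q : free_alg) : c *: (p * q) = p * (c *: q).
Proof.
apply/malgP=> k; rewrite mcoeffZ (mcoeffMlw _ (fsubset_refl _) (fsubset_refl _)).
rewrite (mcoeffMlw _ (fsubset_refl _) (msuppZ_le _ _)) mulr_sumr.
apply: eq_bigr => k1 _; rewrite mulr_sumr; apply: eq_bigr => k2 _.
by rewrite mcoeffZ mulrnAr mulrCA.
Qed.

Fact scale_RAr c u v : scale_R c (mul_R u v) = mul_R u (scale_R c v).
Proof.
by rewrite -[u]reprK_R -[v]reprK_R !(projM, projZ) free_alg_scaleAr.
Qed.

HB.instance Definition _ := GRing.Lalgebra_isAlgebra.Build F R scale_RAr.

(* The image of the span of the words of length n. *)
Definition grade_R (n : nat) (u : R) : Prop :=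
  exists2 p : free_alg, forall m, p@_m != 0 -> fdeg m = n & u = proj p.

End SplittingAlgebra.

Arguments grade_R F {disp} G n u.

(* Homological algebra of a graded connected algebra A, with homogeneous
   components gr 0, gr 1, ...; F is the left A-module on which the components
   of positive degree act by zero. *)
Section Koszul.
Context (F : fieldType) (A : algType F) (gr : nat -> A -> Prop).

(* A free module with a basis of homogeneous elements of prescribed degrees. *)
Record gfree_module := GFreeModule {
  gf_mod :> lmodType A;
  gf_idx : eqType;
  gf_bas : gf_idx -> gf_mod;
  gf_deg : gf_idx -> nat;
  gf_span : forall v : gf_mod, exists (s : seq gf_idx) (c : gf_idx -> A),
    v = \sum_(i <- s) c i *: gf_bas i;
  gf_free : forall (s : seq gf_idx) (c : gf_idx -> A), uniq s ->
    \sum_(i <- s) c i *: gf_bas i = 0 -> {in s, forall i, c i = 0}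
}.

Definition homog (M : gfree_module) (k : nat) (v : M) : Prop :=
  exists (s : seq (gf_idx M)) (c : gf_idx M -> A),
    v = \sum_(i <- s) c i *: gf_bas i
    /\ {in s, forall i, exists2 j, gr j (c i) & (j + gf_deg i = k)%N}.

Definition linear_to_F (M : lmodType A) (f : M -> F) : Prop :=
  (forall c u v, f (c%:A *: u + v) = c * f u + f v)
  /\ (forall j a v, (0 < j)%N -> gr j a -> f (a *: v) = 0).

(* f is A-linear from M to F and vanishes outside degree k, i.e. it is a
   homomorphism of degree 0 into F placed in internal degree k. *)
Definition hom_to_F (M : gfree_module) (k : nat) (f : M -> F) : Prop :=
  linear_to_F f /\ (forall j v, homog j v -> j != k -> f v = 0).

Record gfree_resolution := GFreeResolution {
  res_mod :> nat -> gfree_module;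
  res_d : forall n, {linear res_mod n.+1 -> res_mod n};
  res_eps : res_mod 0 -> F;
  res_d_homog : forall n k v, homog k v -> homog k (res_d n v);
  res_eps_hom : hom_to_F 0 res_eps;
  res_eps_surj : forall c, exists v, res_eps v = c;
  res_exact0 : forall v, res_eps v = 0 <-> exists u, v = res_d 0 u;
  res_exactS : forall n v, res_d n v = 0 <-> exists u, v = res_d n.+1 u
}.

Section Yoneda.
Variable P : gfree_resolution.

(* Ext^{n,k}_A(F, F) is ext_cocycle n k modulo ext_coboundary n k. *)
Definition ext_cocycle n k (f : P n -> F) : Prop :=
  hom_to_F k f /\ forall v, f (res_d P n v) = 0.

Definition ext_coboundary n k : (P n -> F) -> Prop :=
  if n is m.+1 then
    fun f => exists2 g : P m -> F, hom_to_F k g & forall v, f v = g (res_d P m v)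
  else fun f => forall v, f v = 0.

(* A chain map of internal degree -k lifting the cocycle g : P n -> F. *)
Definition chain_lift n k (g : P n -> F)
    (phi : forall i, {linear P (i + n)%N -> P i}) : Prop :=
  [/\ forall v, res_eps (phi 0%N v) = g v,
      forall i v, res_d P i (phi i.+1 v) = phi i (res_d P (i + n)%N v),
      forall i j v, homog (j + k) v -> homog j (phi i v)
    & forall i j v, (j < k)%N -> homog j v -> phi i v = 0].

(* The cocycles whose classes lie in the subalgebra of the bigraded Yoneda
   algebra generated by Ext^{1,1}; the unit is the class of the augmentation. *)
Inductive generated_by_Ext11 : forall n k : nat, (P n -> F) -> Prop :=
| gen_coboundary n k f :
    @ext_coboundary n k f -> @generated_by_Ext11 n k f
| gen_unit : @generated_by_Ext11 0 0 (@res_eps P)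
| gen_Ext11 f : @ext_cocycle 1 1 f -> @generated_by_Ext11 1 1 f
| gen_linear n k (c : F) f g h :
    @generated_by_Ext11 n k f -> @generated_by_Ext11 n k g ->
    (forall v, h v = c * f v + g v) -> @generated_by_Ext11 n k h
| gen_product m k n l f g phi h :
    @generated_by_Ext11 m k f -> @generated_by_Ext11 n l g ->
    @chain_lift n l g phi -> (forall v, h v = f (phi m v)) ->
    @generated_by_Ext11 (m + n) (k + l) h.

End Yoneda.

(* By the comparison theorem the condition does not depend on P. *)
Definition koszul : Prop :=
  exists P : gfree_resolution, forall n k (f : P n -> F),
    ext_cocycle k f -> generated_by_Ext11 k f.

End Koszul.

(* Main.v *)
From HB Require Import structures.
Require Import Defs.
From mathcomp Require Import all_boot all_order all_algebra.
From mathcomp Require Import boolp finmap monalg zify.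
From mathcomp Require classical_sets.

(* Write s(x, j) for the sum of the generators r_y with y < x of rank j. The
   proof goes through the following property of R = R_Gamma: the annihilator
   {a | s(x, j+1) a = 0} is the right ideal L(x, j) generated by s(x, j) and the
   r_y with y not in level j below x (it is clear that L(x, j) annihilates).

   As right modules, R_+ is the direct sum of the r_y R, and the annihilator of
   r_x is L(x, rk x - 1). This identifies an element of degree i, modulo L(x, j),
   with a top-dimensional cochain, modulo coboundaries, on the poset of all
   y < x of rank in ]j - i, j]. The long exact sequences obtained by adding to
   such a band of ranks its next level (above or below) then show that the
   property is equivalent to the Cohen-Macaulay one: the links are lower bands
   in one case, and the open intervals (a, x) in the other.

   If P is a free resolution of F by left modules and Ext is diagonal, then
   Tor_n(M, F) = H_n(M P) lives in degree n + 1 for M = R_+, hence for its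
   summand r_x R, hence for the annihilator of r_x, hence for the summand
   s(x, rk x - 1) R of the latter, and so on down: every annihilator is generated
   in degree 1, where uniformity identifies it with L(x, j).

   Conversely, if the L(x, j) are the annihilators, then the family of all t R,
   with t = r_x or t = s(x, j), is closed under annihilators up to direct sums,
   and chasing a cycle of t P down a partial linear resolution P and back shows
   that P extends by one more linear step. A linear resolution has a diagonal Ext,
   which is generated in degree 1 because the differential of P is injective on
   generators. *)

Set Implicit Arguments.
Unset Strict Implicit.
Unset Printing Implicit Defensive.
Import Order.TTheory GRing.Theory.
Local Open Scope ring_scope.

(** * Ranks *)

(** The annihilators are right ideals, while [gfree_resolution] is made of left modules. For a right
    ideal M this lets M P_n be described coordinate by coordinate, so Tor_n(M, F) is read off P
    itself and no resolution of M is needed.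

    [koszul] provides an arbitrary P, perhaps not minimal and of infinite rank. Hence vanishing of
    Ext off the diagonal is turned into vanishing of Tor with functionals obtained from Zorn's
    lemma, and products off the diagonal have to be coboundaries for every choice of chain lift. In
    the other direction P can be chosen: it is a sequence of matrices with entries of degree 1,
    whose rows come from bases of finite-dimensional F-spaces.

    Diagonal Ext shows that an annihilator is generated in degree 1, but not by what. Uniformity
    fills this gap because it is the case of 0-cochains in the cochain form of the property: on a
    single level the coboundaries are the constants, and a function that is constant below each
    element of the next level is constant. *)

Section Rank.
Context {disp : Order.disp_t} (G : finBPOrderType disp) (hG : ranked G).
Implicit Types (x y z a b : G) (C D : {set G}).

Lemma max_chain_ext b D : chain D -> D \subset [set z | (\bot <= z <= b)%O] ->
  exists2 C, max_chain b C & D \subset C.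
Proof.
move=> cD sD.
have /maxset_exists[C mC sC] :
  [pred D : {set G} | chain D && (D \subset [set z | (\bot <= z <= b)%O])] D.
  by rewrite /= cD.
by exists C.
Qed.

Lemma rkE b C : max_chain b C -> rk b = #|C|.-1.
Proof.
move=> mC; rewrite /rk; apply/eqP; rewrite eqn_leq; apply/andP; split.
  by apply/bigmax_leqP => D mD; rewrite (hG mC mD).
exact: (@leq_bigmax_cond _ (max_chain b) (fun C => #|C|.-1)).
Qed.

Lemma chainP D : reflect {in D &, forall x y, (x >=< y)%O} (chain D).
Proof.
apply: (iffP idP) => [/forall_inP cD x y /cD/forall_inP|cD]; first exact.
by apply/forall_inP => x Dx; apply/forall_inP => y; apply: cD.
Qed.

Lemma chainU1 z C : chain C -> {in C, forall c, (z >=< c)%O} -> chain (z |: C).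
Proof.
move=> /chainP cC zC; apply/chainP => x y /setU1P[->|Cx] /setU1P[->|Cy].
- exact: comparablexx.
- exact: zC.
- by rewrite comparable_sym zC.
- exact: cC.
Qed.

Lemma max_chainP b C : max_chain b C ->
  [/\ chain C, {in C, forall c, (c <= b)%O} &
      forall z, (z <= b)%O -> {in C, forall c, (z >=< c)%O} -> z \in C].
Proof.
case/maxsetP => /andP[cC sC] mC; split=> // [c /(subsetP sC)|z zb zC].
  by rewrite inE => /andP[].
rewrite -(mC (z |: C)) ?setU11 ?subsetUr //=; rewrite chainU1 //=.
by apply/subsetP => c /setU1P[->|/(subsetP sC)//]; rewrite inE le0x.
Qed.

Lemma max_chain_bot b C : max_chain b C -> \bot%O \in C.
Proof.
by case/max_chainP=> _ _; apply=> [|c _]; rewrite ?le0x //; apply/orP; left;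
  rewrite le0x.
Qed.

Lemma max_chain_top b C : max_chain b C -> b \in C.
Proof.
by case/max_chainP=> _ sC; apply=> // c /sC cb; apply/orP; right.
Qed.

Lemma rk_card b C : max_chain b C -> #|C| = (rk b).+1.
Proof.
move=> mC; rewrite (rkE mC) prednK //.
by apply/card_gt0P; exists b; apply: max_chain_top mC.
Qed.

Lemma max_chain_exists b : exists C, max_chain b C.
Proof.
have [|C mC _] := @max_chain_ext b set0 _ (sub0set _); last by exists C.
by apply/chainP => x y; rewrite inE.
Qed.

Lemma rk_lt x y : (x < y)%O -> (rk x < rk y)%N.
Proof.
move=> xy; have [C mC] := max_chain_exists x.
have [cC sC _] := max_chainP mC.
have yC : y \notin C by apply/negP => /sC yx; move: (lt_le_trans xy yx); rewrite ltxx.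
have [||D mD sD] := @max_chain_ext y (y |: C).
- apply: chainU1 => // c /sC cx; apply/orP; right.
  exact: le_trans cx (ltW xy).
- apply/subsetP => c /setU1P[->|/sC cx]; rewrite inE le0x ?lexx //=.
  exact: le_trans cx (ltW xy).
have := subset_leq_card sD.
by rewrite cardsU1 yC (rk_card mC) (rk_card mD).
Qed.

Lemma rk0 : rk (\bot%O : G) = 0%N.
Proof.
have [C mC] := max_chain_exists \bot%O.
have [_ sC _] := max_chainP mC; rewrite (rkE mC).
suff -> : C = [set \bot%O] by rewrite cards1.
apply/setP => c; rewrite inE; apply/idP/eqP => [/sC|->];
  first by rewrite lex0 => /eqP.
exact: max_chain_bot mC.
Qed.

Lemma rk_gt0 x : (0 < rk x)%N = (x != \bot%O).
Proof.
have [->|x0] := eqVneq x \bot%O; first by rewrite rk0.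
by apply: leq_ltn_trans (rk_lt (_ : \bot < x)%O); rewrite ?rk0 // lt_def x0 le0x.
Qed.

(** As nothing lies strictly between, adding [y] to a maximal chain below [x] gives a maximal chain
    below [y], and in a ranked poset one maximal chain computes the rank. *)
Lemma rk_cover x y : (x < y)%O -> (forall z, (x < z)%O -> ~~ (z < y)%O) ->
  rk y = (rk x).+1.
Proof.
move=> xy cov; have [C mC] := max_chain_exists x.
have [cC sC inC] := max_chainP mC.
have yC : y \notin C by apply/negP => /sC yx; move: (lt_le_trans xy yx); rewrite ltxx.
suff mD : max_chain y (y |: C).
  by have := rk_card mD; rewrite cardsU1 yC (rk_card mC) => -[].
apply/maxsetP; split=> [/=|D /andP[/chainP cD /subsetP sD] sCD].
  apply/andP; split.
    apply: chainU1 => // c /sC cx; apply/orP; right.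
    exact: le_trans cx (ltW xy).
  apply/subsetP => c /setU1P[->|/sC cx]; rewrite inE le0x ?lexx //=.
  exact: le_trans cx (ltW xy).
apply/eqP; rewrite eqEsubset sCD andbT; apply/subsetP => z Dz.
have := sD z Dz; rewrite inE le0x /= le_eqVlt in_setU1 => /orP[->//|zy].
rewrite inC ?orbT //.
  have /orP[//|] := cD z x Dz (subsetP sCD _ (setU1r _ (max_chain_top mC))).
  by rewrite le_eqVlt => /orP[/eqP->//|/cov]; rewrite zy.
by move=> c Cc; apply: cD => //; apply: (subsetP sCD); apply: setU1r.
Qed.

Lemma cover_below y x : (y < x)%O ->
  exists z, [/\ (y <= z)%O, (z < x)%O & rk x = (rk z).+1].
Proof.
move=> yx; have Py : (y <= y < x)%O by rewrite lexx.
(* An element of maximal rank in [[y, x[] is covered by [x]. *)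
case: (@arg_maxnP _ y (fun z => (y <= z < x)%O) (@rk _ G) Py) => z /andP[yz zx] mz.
exists z; split=> //; apply: rk_cover => // w zw; apply/negP => wx.
have : (rk w <= rk z)%N by apply: mz; rewrite wx (le_trans yz (ltW zw)).
by rewrite leqNgt rk_lt.
Qed.

Lemma between_rk y x j : (y < x)%O -> (rk y <= j < rk x)%N ->
  exists z, [/\ (y <= z)%O, (z < x)%O & rk z = j].
Proof.
move: {2}(rk x) (erefl (rk x)) => r.
elim/ltn_ind: r x => r IH x rx yx /andP[yj jx].
have [z [yz zx rz]] := cover_below yx.
have [->|nj] := eqVneq j (rk z); first by exists z.
have jz : (j < rk z)%N by rewrite ltn_neqAle nj -ltnS -rz.
have yz' : (y < z)%O.
  rewrite lt_neqAle yz andbT; apply/eqP => yz'.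
  by move: jz; rewrite -yz' ltnNge yj.
have rzr : (rk z < r)%N by rewrite -rx rz.
have [|w [yw wz rw]] := IH _ rzr z erefl yz'; first by rewrite yj.
by exists w; split=> //; apply: lt_trans wz zx.
Qed.

End Rank.

(** * Cochains and links *)

Section Coboundary.
Context (F : fieldType) {disp : Order.disp_t} {G : finBPOrderType disp}.
Implicit Types (P : {set G}) (n : int) (s t : seq G) (f g : seq G -> F).

Definition is_cocycle P n f :=
  forall s, simplex P (n + 1) s -> coboundary f s = 0.

Definition is_coboundary P n f :=
  exists g, forall s, simplex P n s -> f s = coboundary g s.

Lemma coboundary_nil f : coboundary f [::] = 0.
Proof. by rewrite /coboundary big_ord0. Qed.

Lemma eq_coboundary f g s :
  (forall i, (i < size s)%N -> f (face i s) = g (face i s)) ->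
  coboundary f s = coboundary g s.
Proof. by move=> fg; apply: eq_bigr => i _; rewrite fg. Qed.

Lemma coboundaryD f g s :
  coboundary (fun u => f u + g u) s = coboundary f s + coboundary g s.
Proof. by rewrite -big_split; apply: eq_bigr => i _; rewrite mulrDr. Qed.

Lemma coboundaryB f g s :
  coboundary (fun u => f u - g u) s = coboundary f s - coboundary g s.
Proof. by rewrite -sumrB; apply: eq_bigr => i _; rewrite mulrBr. Qed.

Lemma coboundaryZ c f s : coboundary (fun u => c * f u) s = c * coboundary f s.
Proof. by rewrite /coboundary big_distrr; apply: eq_bigr => i _; rewrite mulrCA. Qed.

Lemma coboundary0 s : coboundary (fun _ : seq G => 0 : F) s = 0.
Proof. by rewrite /coboundary big1 // => i _; rewrite mulr0. Qed.

Lemma coboundary_cons f x t :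
  coboundary f (x :: t) = f t - coboundary (fun u => f (x :: u)) t.
Proof.
rewrite /coboundary big_ord_recl expr0 mul1r /face /= drop0; congr (_ + _).
by rewrite -sumrN; apply: eq_bigr => i _; rewrite exprS mulN1r mulNr.
Qed.

Lemma coboundary_rcons f t z : coboundary f (rcons t z) =
  (-1) ^+ size t * f t + coboundary (fun u => f (rcons u z)) t.
Proof.
rewrite /coboundary size_rcons big_ord_recr addrC /=; congr (_ + _); last first.
  rewrite /face -cats1 take_size_cat // drop_oversize ?cats0 //.
  by rewrite size_cat addn1.
apply: eq_bigr => i _; congr (_ * f _); rewrite /face -!cats1 takel_cat 1?ltnW //.
rewrite drop_cat -catA; congr (_ ++ _); case: ltnP => // ti.
have -> : i.+1 = size t by apply/eqP; rewrite eqn_leq ti ltn_ord.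
by rewrite subnn drop_size.
Qed.

(** Peeling off the first vertex replaces the cancellation in the double sum over pairs of faces by
    an induction on the sequence. *)
Lemma coboundaryK f s : coboundary (coboundary f) s = 0.
Proof.
elim: s f => [|x t IH] f; first exact: coboundary_nil.
suff E : coboundary (fun u => coboundary f (x :: u)) t = coboundary f t.
  by rewrite coboundary_cons E subrr.
transitivity (coboundary (fun u => f u - coboundary (fun v => f (x :: v)) u) t).
  by apply: eq_coboundary => i _; rewrite coboundary_cons.
by rewrite coboundaryB IH subr0.
Qed.

Lemma size_face i s : (i < size s)%N -> (size (face i s)).+1 = size s.
Proof.
by move=> si; rewrite /face size_cat size_takel ?size_drop 1?ltnW // -addnS subnSK //
  subnKC // ltnW.
Qed.

(** A factor that depends only on the size passes through the coboundary; the successor compensates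
    for the vertex lost in a face. It serves to absorb the signs [e]. *)
Lemma coboundaryZs (k : nat -> F) f s :
  coboundary (fun u => k (size u).+1 * f u) s = k (size s) * coboundary f s.
Proof. by rewrite -coboundaryZ; apply: eq_coboundary => i si; rewrite size_face. Qed.

Lemma simplex_face P n s i : simplex P (n + 1) s -> (i < size s)%N ->
  simplex P n (face i s).
Proof.
case/and3P => /= ss sP /eqP sz si; apply/and3P; split.
- apply: (subseq_sorted (@lt_trans _ _) _ ss).
  by rewrite /face -{3}(cat_take_drop i s)
    cat_subseq // -addn1 addnC -drop_drop drop_subseq.
- move: sP; rewrite -{1}(cat_take_drop i.+1 s) /face !all_cat => /andP[+ ->].
  by rewrite (take_nth (head \bot%O s)) // all_rcons => /andP[_ ->].
- have := size_face si; move: sz => + e; rewrite -e -addn1 PoszD => /eqP.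
  by rewrite (inj_eq (addIr _)).
Qed.

Lemma simplex_sub P P' n s : P \subset P' -> simplex P n s -> simplex P' n s.
Proof.
move=> sP /and3P[ss /allP sPs sz]; apply/and3P; split=> //.
by apply/allP => x /sPs; apply: (subsetP sP).
Qed.

Lemma simplex_size P n s : simplex P n s -> (size s)%:Z = n + 1.
Proof. by case/and3P => _ _ /eqP. Qed.

Lemma simplex_cons P n x t : simplex P (n + 1) (x :: t) =
  (x \in P) && simplex [set y in P | (x < y)%O] n t.
Proof.
rewrite /simplex /= path_sortedE; last exact: lt_trans.
rewrite -addn1 PoszD (inj_eq (addIr _)) -!andbA.
have -> : all [in [set y in P | (x < y)%O]] t = all [in P] t && all (> x)%O t.
  by rewrite -all_predI; apply: eq_all => y; rewrite /= inE.
by case: (x \in P); case: (all (> x)%O t); case: (sorted _ t); case: (all [in P] t);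
  rewrite /= ?andbF.
Qed.

Lemma simplex_rev P n s : simplex P n (rev s) =
  [&& sorted (fun x y => y < x)%O s, all [in P] s & (size s)%:Z == n + 1].
Proof. by rewrite /simplex rev_sorted all_rev size_rev. Qed.

Lemma simplex_rcons P n t z : simplex P (n + 1) (rcons t z) =
  (z \in P) && simplex [set y in P | (y < z)%O] n t.
Proof.
rewrite -[t]revK -rev_cons !simplex_rev /= path_sortedE; last first.
  by move=> y x w yx wy; apply: lt_trans wy yx.
rewrite -addn1 PoszD (inj_eq (addIr _)) -!andbA.
have -> : all [in [set y in P | (y < z)%O]] (rev t) =
          all [in P] (rev t) && all (< z)%O (rev t).
  by rewrite -all_predI; apply: eq_all => y; rewrite /= inE.
by case: (z \in P); case: (all (< z)%O _); case: (sorted _ _); case: (all [in P] _);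
  rewrite /= ?andbF.
Qed.

(* The long exact sequence of the pair (P, P'), where P is P' plus an antichain
   A: every chain of P not in P' is uniquely [ins z t] with z in A and t a chain
   of the link L z.  It is used with A the top level (ins = rcons) or the bottom
   level (ins = cons). *)
Section Link.
Context (ins : G -> seq G -> seq G) (hd : seq G -> option G) (tl : seq G -> seq G).
Hypothesis hd_ins : forall z t, hd (ins z t) = Some z.
Hypothesis tl_ins : forall z t, tl (ins z t) = t.
Context (e : nat -> F) (c : F).
Hypothesis ee : forall k, e k * e k = 1.
Hypothesis cc : c * c = 1.
Hypothesis coboundary_ins : forall f z t, coboundary f (ins z t) =
  e (size t) * f t + c * coboundary (fun u => f (ins z u)) t.
Context (P P' A : {set G}) (L : G -> {set G}).
Hypothesis simplex_split : forall n s, simplex P n s -> simplex P' n s \/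
  exists z t, [/\ z \in A, simplex (L z) (n - 1) t & s = ins z t].
Hypothesis simplex_ins : forall z n t,
  z \in A -> simplex (L z) n t -> simplex P (n + 1) (ins z t).
Hypothesis P'P : P' \subset P.
Hypothesis LP' : forall z, z \in A -> L z \subset P'.
Hypothesis hdP' : forall n s z, simplex P' n s -> hd s = Some z -> z \notin A.

(** A cochain on P is a cochain on P' together with one cochain on each link. *)
Let glue (u : G -> seq G -> F) f s :=
  if hd s is Some z then if z \in A then u z (tl s) else f s else f s.

Let glue_ins u f z t : z \in A -> glue u f (ins z t) = u z t.
Proof. by move=> zA; rewrite /glue hd_ins zA tl_ins. Qed.

Let glueP' u f n s : simplex P' n s -> glue u f s = f s.
Proof.
move=> sP'; rewrite /glue; case E: (hd s) => [z|//].
by rewrite (negPf (hdP' sP' E)).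
Qed.

Let cob_glue_ins u f z n t : z \in A -> simplex P' n t ->
  coboundary (glue u f) (ins z t) = e (size t) * f t + c * coboundary (u z) t.
Proof.
move=> zA tP'; rewrite coboundary_ins (glueP' _ _ tP'); congr (_ + _ * _).
by apply: eq_coboundary => i _; rewrite glue_ins.
Qed.

Let cob_glueP' u f n s : simplex P' (n + 1) s ->
  coboundary (glue u f) s = coboundary f s.
Proof.
move=> sP'; apply: eq_coboundary => i si.
exact: glueP' (simplex_face sP' si).
Qed.

(** The map from the cohomology of P' to that of the links is restriction. When it kills [f],
    primitives on the links extend [f] to a cocycle of P; a primitive of the extension restricts to
    one of [f]. *)
Lemma extend_coboundary n f : reduced_cohomology_vanishes F P n ->
  is_cocycle P' n f -> (forall z, z \in A -> is_coboundary (L z) n f) ->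
  is_coboundary P' n f.
Proof.
move=> HP fc fL.
have /choice[g gP] : forall z, exists g, z \in A ->
    forall s, simplex (L z) n s -> f s = coboundary g s.
  move=> z; case: (boolP (z \in A)) => [/fL[g gP]|_]; first by exists g.
  by exists (fun _ => 0).
(* The factor solves [e * f + c * coboundary u = 0] on the chains through [z], using [c * c = 1]. *)
pose u z s := - c * e (size s).+1 * g z s.
have [|h hP] := HP (glue u f).
  move=> s /simplex_split[sP'|[z [t [zA tL ->]]]].
    by rewrite (cob_glueP' _ _ sP') fc.
  rewrite addrK in tL; rewrite (cob_glue_ins _ _ zA (simplex_sub (LP' zA) tL)).
  rewrite (gP _ zA _ tL) /u (coboundaryZs (fun k => - c * e k)).
  by rewrite !mulrA mulrN cc mulN1r mulNr subrr.
by exists h => s sP'; rewrite -hP ?(glueP' _ _ sP') //; apply: simplex_sub sP'.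
Qed.

(** On the links a cocycle [f] of P is bounded by its own values on the chains [ins z t], so its
    restriction to P' is a coboundary. Subtracting this leaves a relative cocycle, which is a family
    of cocycles of degree [n - 1] on the links. *)
Lemma vanishing_of_links n :
  (forall f, is_cocycle P' n f -> (forall z, z \in A -> is_coboundary (L z) n f) ->
     is_coboundary P' n f) ->
  (forall z, z \in A -> reduced_cohomology_vanishes F (L z) (n - 1)) ->
  reduced_cohomology_vanishes F P n.
Proof.
move=> HP' HL f fc.
have fL z t : z \in A -> simplex (L z) n t ->
    e (size t) * f t + c * coboundary (fun u => f (ins z u)) t = 0.
  by move=> zA tL; rewrite -coboundary_ins fc // simplex_ins.
have [||g gP] := HP' f.
- by move=> s sP'; apply: fc; apply: simplex_sub sP'.
- move=> z zA; exists (fun t => - c * e (size t).+1 * f (ins z t)) => t tL.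
  rewrite (coboundaryZs (fun k => - c * e k)); have := fL z t zA tL.
  move=> /(congr1 (fun v => e (size t) * v)); rewrite mulr0 mulrDr !mulrA ee mul1r.
  by move=> /eqP; rewrite addr_eq0 mulNr mulNr (mulrC (e _)) => /eqP.
pose g0 := glue (fun _ _ => 0) g.
pose f1 s := f s - coboundary g0 s.
have f1P' s : simplex P' n s -> f1 s = 0.
  move=> sP'; apply/eqP; rewrite subr_eq0 gP //; apply/eqP.
  by rewrite -[n](subrK 1) in sP'; rewrite (cob_glueP' _ _ sP').
have f1c z t : z \in A -> simplex (L z) n t ->
    coboundary (fun u => f1 (ins z u)) t = 0.
  move=> zA tL; have: coboundary f1 (ins z t) = 0.
    by rewrite coboundaryB coboundaryK subr0 fc // simplex_ins.
  rewrite coboundary_ins f1P' ?(simplex_sub (LP' zA)) // mulr0 add0r.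
  by move=> /(congr1 ( *%R c)); rewrite mulr0 mulrA cc mul1r.
have /choice[h hP] : forall z, exists h, z \in A ->
    forall s, simplex (L z) (n - 1) s -> f1 (ins z s) = coboundary h s.
  move=> z; case: (boolP (z \in A)) => [zA|_]; last by exists (fun _ => 0).
  have [|h hP] := HL z zA (fun u => f1 (ins z u)); last by exists h.
  by move=> s; rewrite subrK; apply: f1c.
exists (fun s => g0 s + glue (fun z s => c * h z s) (fun _ => 0) s) => s sP.
rewrite coboundaryD; apply/eqP; rewrite addrC -subr_eq; apply/eqP.
rewrite -/(f1 s); case: (simplex_split sP) => [sP'|[z [t [zA tL ->]]]].
  rewrite f1P' //; rewrite -[n](subrK 1) in sP'.
  by rewrite (cob_glueP' _ _ sP') coboundary0.
rewrite (cob_glue_ins _ _ zA (simplex_sub (LP' zA) tL)) mulr0 add0r coboundaryZ.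
by rewrite mulrA cc mul1r hP.
Qed.

(** Extended by 0, a cocycle of one link is a cocycle of P, hence the coboundary of some [g]. On P'
    this [g] is a cocycle; correcting it by a primitive there makes it vanish on P', and its values
    on [ins z t] then bound the given cocycle up to [c]. *)
Lemma link_vanishing n : reduced_cohomology_vanishes F P' n ->
  reduced_cohomology_vanishes F P (n + 1) ->
  forall z, z \in A -> reduced_cohomology_vanishes F (L z) n.
Proof.
move=> HP' HP z zA f fc.
have [|g gP] := HP (glue (fun w s => if w == z then f s else 0) (fun _ => 0)).
  move=> s /simplex_split[sP'|[w [t [wA tL ->]]]].
    by rewrite (cob_glueP' _ _ sP') coboundary0.
  rewrite addrK in tL; rewrite (cob_glue_ins _ _ wA (simplex_sub (LP' wA) tL)).
  rewrite mulr0 add0r; case: eqP tL => [->|_] tL; last by rewrite coboundary0 mulr0.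
  by rewrite fc ?mulr0.
have [|h hP] := HP' g.
  by move=> s sP'; rewrite -gP ?(glueP' _ _ sP') //; apply: simplex_sub sP'.
pose h0 := glue (fun _ _ => 0) h.
pose g1 s := g s - coboundary h0 s.
have g1P' s : simplex P' n s -> g1 s = 0.
  move=> sP'; apply/eqP; rewrite subr_eq0 hP //; apply/eqP.
  by rewrite -[n](subrK 1) in sP'; rewrite (cob_glueP' _ _ sP').
exists (fun s => c * g1 (ins z s)) => s sL.
have := gP _ (simplex_ins zA sL); rewrite glue_ins // eqxx => ->.
rewrite coboundaryZ; transitivity (coboundary g1 (ins z s)).
  by rewrite coboundaryB coboundaryK subr0.
by rewrite coboundary_ins g1P' ?(simplex_sub (LP' zA)) // mulr0 add0r.
Qed.

End Link.
End Coboundary.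

(** * Cohen-Macaulay posets by rank bands *)

Section RankLevels.
Context (F : fieldType) {disp : Order.disp_t} (G : finBPOrderType disp).
Hypothesis hG : ranked G.
Implicit Types (x y z a b : G) (i j k l : nat) (n : int) (f : seq G -> F).

Local Notation vanishes P n := (reduced_cohomology_vanishes F P n).

Definition level x j : {set G} := [set y | (y < x)%O && (rk y == j)].

Definition rank_band x l j : {set G} :=
  [set y | (y < x)%O && (l < rk y <= j)%N].

Lemma levelP x j y : reflect ((y < x)%O /\ rk y = j) (y \in level x j).
Proof. by rewrite inE; apply: (iffP andP) => -[yx /eqP]. Qed.

Lemma rank_bandP x l j y :
  reflect [/\ (y < x)%O, (l < rk y)%N & (rk y <= j)%N] (y \in rank_band x l j).
Proof. by rewrite inE; apply: and3P. Qed.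

Lemma rank_band_size x l j n s : simplex (rank_band x l j) n s ->
  (size s <= j - l)%N.
Proof.
elim/last_ind: s j n => // s z IH j n.
rewrite -[n](subrK 1) simplex_rcons => /andP[/rank_bandP[zx lz zj] sP].
rewrite size_rcons.
have /(IH (rk z).-1 (n - 1)) : simplex (rank_band x l (rk z).-1) (n - 1) s; last lia.
apply: simplex_sub sP; apply/subsetP => y;
  rewrite inE => /andP[/rank_bandP[yx ly _] yz].
by apply/rank_bandP; split=> //; have := rk_lt hG yz; lia.
Qed.

Lemma rank_band_high x l j n s : (j - l)%:Z <= n -> ~~ simplex (rank_band x l j) n s.
Proof.
move=> jln; apply/negP => sP.
by have := simplex_size sP; have := rank_band_size sP; lia.
Qed.

Lemma rank_band_vanishes x l j n : (j - l)%:Z <= n -> vanishes (rank_band x l j) n.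
Proof. by move=> jln f _; exists f => s sP; have := rank_band_high x s jln;
  rewrite sP. Qed.

Lemma vanishes_negative (P : {set G}) n : n < -1 -> vanishes P n.
Proof. by move=> n1 f _; exists f => s /simplex_size; lia. Qed.

(** * Bands of ranks and their top level *)

Section TopLevel.
Context (x : G) (l j : nat).
Hypothesis lj : (l <= j)%N.

Let ins z (t : seq G) := rcons t z.
Let hd (s : seq G) := ohead (rev s).
Let tl (s : seq G) := rev (behead (rev s)).

Let hd_ins z t : hd (ins z t) = Some z.
Proof. by rewrite /hd rev_rcons. Qed.

Let tl_ins z t : tl (ins z t) = t.
Proof. by rewrite /tl rev_rcons /= revK. Qed.

Let sign2 k : (-1) ^+ k * (-1) ^+ k = 1 :> F.
Proof. by rewrite -expr2 sqrr_sign. Qed.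

Let cob_ins f z t : coboundary f (ins z t) =
  (-1) ^+ size t * f t + 1 * coboundary (fun u => f (ins z u)) t.
Proof. by rewrite mul1r coboundary_rcons. Qed.

Let split n s : simplex (rank_band x l j.+1) n s ->
  simplex (rank_band x l j) n s \/ exists z t,
  [/\ z \in level x j.+1, simplex (rank_band z l j) (n - 1) t & s = ins z t].
Proof.
case/lastP: s => [/and3P[_ _ sz]|t z]; first by left; apply/and3P.
rewrite -{1 2}[n](subrK 1) !simplex_rcons => /andP[/rank_bandP[zx lz zj] tP].
have [rz|rz] := eqVneq (rk z) j.+1; [right; exists z, t; split=> //|left].
- exact/levelP.
- apply: simplex_sub tP; apply/subsetP => y;
  rewrite inE => /andP[/rank_bandP[yx ly _] yz].
  by apply/rank_bandP; split=> //; have := rk_lt hG yz; lia.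
- apply/andP; split; first by apply/rank_bandP; split=> //; lia.
  apply: simplex_sub tP; apply/subsetP => y;
    rewrite !inE => /andP[/andP[-> /andP[-> _]] yz].
  by rewrite yz /= andbT; have := rk_lt hG yz; lia.
Qed.

Let join z n t : z \in level x j.+1 -> simplex (rank_band z l j) n t ->
  simplex (rank_band x l j.+1) (n + 1) (ins z t).
Proof.
move=> /levelP[zx rz] tP; rewrite simplex_rcons; apply/andP; split.
  by apply/rank_bandP; split=> //; lia.
apply: simplex_sub tP; apply/subsetP => y /rank_bandP[yz ly yj].
rewrite inE yz andbT; apply/rank_bandP; split=> //; last lia.
exact: lt_trans yz zx.
Qed.

Let lower : rank_band x l j \subset rank_band x l j.+1.
Proof.
by apply/subsetP => y /rank_bandP[yx ly yj]; apply/rank_bandP; split=> //; lia.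
Qed.

Let link_lower z : z \in level x j.+1 -> rank_band z l j \subset rank_band x l j.
Proof.
move=> /levelP[zx _]; apply/subsetP => y /rank_bandP[yz ly yj].
by apply/rank_bandP; split=> //; apply: lt_trans yz zx.
Qed.

Let hd_lower n s z : simplex (rank_band x l j) n s -> hd s = Some z ->
  z \notin level x j.+1.
Proof.
case/lastP: s => // t w; rewrite hd_ins -[n](subrK 1) simplex_rcons.
move=> /andP[/rank_bandP[wx lw wj] _] [<-]; apply/levelP => -[_]; lia.
Qed.

Lemma extend_coboundary_top n f : vanishes (rank_band x l j.+1) n ->
  is_cocycle (rank_band x l j) n f ->
  (forall z, z \in level x j.+1 -> is_coboundary (rank_band z l j) n f) ->
  is_coboundary (rank_band x l j) n f.
Proof.
exact: (extend_coboundary hd_ins tl_ins (mulr1 1)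
  cob_ins split lower link_lower hd_lower).
Qed.

Lemma vanishing_of_links_top n :
  (forall f, is_cocycle (rank_band x l j) n f ->
     (forall z, z \in level x j.+1 -> is_coboundary (rank_band z l j) n f) ->
     is_coboundary (rank_band x l j) n f) ->
  (forall z, z \in level x j.+1 -> vanishes (rank_band z l j) (n - 1)) ->
  vanishes (rank_band x l j.+1) n.
Proof.
exact: (vanishing_of_links hd_ins tl_ins sign2 (mulr1 1)
  cob_ins split join lower link_lower hd_lower).
Qed.

End TopLevel.


(** * Bands of ranks and their bottom level *)

Section BottomLevel.
Context (x : G) (l : nat).

Let j := (rk x).-1.
Let hd (s : seq G) := ohead s.
Let tl (s : seq G) := behead s.

Let cob_cons f z t : coboundary f (z :: t) =
  1 * f t + -1 * coboundary (fun u => f (z :: u)) t.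
Proof. by rewrite coboundary_cons mul1r mulN1r. Qed.

Let split n s : simplex (rank_band x l j) n s ->
  simplex (rank_band x l.+1 j) n s \/ exists z t,
  [/\ z \in level x l.+1, simplex (open_interval z x) (n - 1) t & s = z :: t].
Proof.
case: s => [/and3P[_ _ sz]|z t]; first by left; apply/and3P.
rewrite -{1 2}[n](subrK 1) !simplex_cons => /andP[/rank_bandP[zx lz zj] tP].
have [rz|rz] := eqVneq (rk z) l.+1; [right; exists z, t; split=> //|left].
- exact/levelP.
- apply: simplex_sub tP; apply/subsetP => y; rewrite !inE => /andP[/andP[yx _] zy].
  by rewrite zy.
- apply/andP; split; first by apply/rank_bandP; split=> //; lia.
  apply: simplex_sub tP; apply/subsetP => y;
    rewrite !inE => /andP[/andP[-> /andP[_ ->]] zy].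
  by rewrite zy /= !andbT; have := rk_lt hG zy; lia.
Qed.

Let join z n t : z \in level x l.+1 -> simplex (open_interval z x) n t ->
  simplex (rank_band x l j) (n + 1) (z :: t).
Proof.
move=> /levelP[zx rz] tP; rewrite simplex_cons; apply/andP; split.
  by apply/rank_bandP; split=> //; have := rk_lt hG zx; rewrite ?rz /j; lia.
apply: simplex_sub tP; apply/subsetP => y; rewrite !inE => /andP[zy yx].
by rewrite zy yx andbT /=; have := rk_lt hG zy; have := rk_lt hG yx; rewrite /j; lia.
Qed.

Let upper : rank_band x l.+1 j \subset rank_band x l j.
Proof.
by apply/subsetP => y /rank_bandP[yx ly yj]; apply/rank_bandP; split=> //; lia.
Qed.

Let link_upper z : z \in level x l.+1 -> open_interval z x \subset rank_band x l.+1 j.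
Proof.
move=> /levelP[zx rz]; apply/subsetP => y; rewrite !inE => /andP[zy yx].
by rewrite yx /=; have := rk_lt hG zy; have := rk_lt hG yx; rewrite /j; lia.
Qed.

Let hd_upper n s z : simplex (rank_band x l.+1 j) n s -> hd s = Some z ->
  z \notin level x l.+1.
Proof.
case: s => // w t; rewrite -[n](subrK 1) simplex_cons.
move=> /andP[/rank_bandP[wx lw wj] _] [<-]; apply/levelP => -[_]; lia.
Qed.

Let hd_cons (z : G) t : hd (z :: t) = Some z. Proof. by []. Qed.
Let tl_cons (z : G) t : tl (z :: t) = t. Proof. by []. Qed.
Let sqr1 : (-1) * (-1) = 1 :> F. Proof. by rewrite mulrNN mulr1. Qed.

Lemma extend_vanishing_bottom n : vanishes (rank_band x l j) n ->
  (forall z, z \in level x l.+1 -> vanishes (open_interval z x) n) ->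
  vanishes (rank_band x l.+1 j) n.
Proof.
move=> HP HL f fc.
apply: (extend_coboundary (e :=
  fun=> 1) hd_cons tl_cons sqr1 cob_cons split upper link_upper hd_upper) => // z zA.
apply: (HL z zA) => s sL; apply: fc.
exact: simplex_sub (link_upper zA) sL.
Qed.

Lemma link_vanishing_bottom n : vanishes (rank_band x l.+1 j) n ->
  vanishes (rank_band x l j) (n + 1) ->
  forall z, z \in level x l.+1 -> vanishes (open_interval z x) n.
Proof.
exact: (link_vanishing (e :=
  fun=> 1) hd_cons tl_cons cob_cons split join upper link_upper hd_upper).
Qed.

End BottomLevel.

(** The excluded degree is the dimension of the band, which reaches up to the last rank below
    [x]. *)
Definition bands_vanish := forall x l n, (l < rk x)%N ->
  n != (rk x)%:Z - l%:Z - 2 -> vanishes (rank_band x l (rk x).-1) n.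

Lemma cohen_macaulay_bands : cohen_macaulay F G <-> bands_vanish.
Proof.
have band0 x : rank_band x 0 (rk x).-1 = open_interval \bot%O x.
  apply/setP => y; rewrite !inE (rk_gt0 hG) lt0x.
  case: (boolP (y < x)%O) => yx; rewrite ?andbF //= andbT.
  by have := rk_lt hG yx; case: eqP => //=; lia.
split=> [CM x|B a x ax n].
  elim=> [|l IH] n lx nd.
    rewrite band0; apply: CM; last by rewrite /dimX rk0.
    by rewrite lt_def le0x -rk_gt0 ?lx.
  (* The one degree excluded by the induction hypothesis, [rk x - l - 2], exceeds the dimension of
     the smaller band and is settled here. *)
  have [n1|] := leP ((rk x).-1 - l.+1)%:Z n; first exact: rank_band_vanishes.
  move=> n1; apply: extend_vanishing_bottom.
    apply: IH; lia.
  move=> z /levelP[zx rz]; apply: CM => //; rewrite /dimX rz; lia.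
have [->|a0] := eqVneq a \bot%O.
  rewrite /dimX rk0 // subr0 => nd; rewrite -band0; apply: B; last lia.
  by rewrite rk_gt0 //; apply: contraTneq ax => ->; rewrite ltx0.
rewrite -rk_gt0 // in a0; rewrite /dimX => nd; have rax := rk_lt hG ax.
have ar : (rk a).-1.+1 = rk a by lia.
(* The interval [(a, x)] is the link of [a] in the band whose lowest rank is that of [a]. *)
apply: (@link_vanishing_bottom x (rk a).-1).
- rewrite ar; apply: B => //; lia.
- apply: B; lia.
- by apply/levelP.
Qed.

(** This is the cochain form of the annihilator property. For [i <= j] the band has [i] ranks, so
    [i - 1] is its top degree and every cochain is a cocycle. For [j < i] the truncated difference
    gives a band too short to contain a simplex of dimension [i - 1], and the condition is void. *)
Definition detects_coboundaries := forall x j i f, (j.+1 < rk x)%N ->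
  (forall z, z \in level x j.+1 ->
     is_coboundary (rank_band z (j - i) j) (i%:Z - 1) f) ->
  is_coboundary (rank_band x (j - i) j) (i%:Z - 1) f.

Lemma bands_vanish_detects : bands_vanish -> detects_coboundaries.
Proof.
move=> B x j i f jx fL; have [ji|ij] := ltnP j i.
  exists f => s sP; have := @rank_band_high x (j - i) j (i%:Z - 1) s.
  by rewrite sP => /(_ ltac:(lia)).
set l := (j - i)%N in fL *; set n := i%:Z - 1 in fL *.
have top z k : (l < k.+1)%N -> (k.+1 < rk x)%N -> (j < k)%N ->
    z \in level x k.+1 -> vanishes (rank_band z l k) n.
  by move=> lk kx jk /levelP[zx rz]; have := B z l n; rewrite rz /=; apply; lia.
(* Top levels are removed from the full band below [x] until [j.+1] is the highest rank. The links
   met on the way are full bands of dimension greater than [n], so the hypothesis covers them. *)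
have down d : (d < rk x - j.+1)%N -> vanishes (rank_band x l ((rk x).-1 - d)) n.
  elim: d => [|d IH] dx; first by rewrite subn0; apply: B; lia.
  have e : ((rk x).-1 - d)%N = ((rk x).-1 - d.+1).+1 by lia.
  move=> g gc; apply: (extend_coboundary_top _ _ gc).
  - lia.
  - by rewrite -e; apply: IH; lia.
  - move=> z zA; apply: (top z _ _ _ _ zA); try lia.
    move=> s sP; apply: gc; apply: simplex_sub sP; apply/subsetP => y.
    move/levelP: zA => [zx _] /rank_bandP[yz ly yj]; apply/rank_bandP; split=> //.
    exact: lt_trans yz zx.
have /extend_coboundary_top : vanishes (rank_band x l j.+1) n.
  by have := down ((rk x).-1 - j.+1)%N; rewrite subKn; [apply; lia|lia].
apply=> //; first lia.
by move=> s sP; have := @rank_band_high x l j (n + 1) s;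
  rewrite sP => /(_ ltac:(lia)).
Qed.

(** Below the top degree, one starts with the band whose top degree is [n] and adds levels. For the
    first added level, detection supplies the injectivity required by the exact sequence; afterwards
    the smaller band already has no cohomology in degree [n]. The links fall under the induction on
    the rank. *)
Lemma detects_bands_vanish : detects_coboundaries -> bands_vanish.
Proof.
move=> S x; move: {2}(rk x) (erefl (rk x)) => r.
elim/ltn_ind: r x => r IH x rx l n lx nd.
have [n1|n1] := ltP n (-1); first exact: vanishes_negative.
have [n2|n2] := leP ((rk x).-1 - l)%:Z n; first exact: rank_band_vanishes.
have [i ni] : exists i : nat, n = i%:Z - 1 by exists (absz (n + 1)); lia.
(* [n] is the top degree of the band []l, j]]; at least one more level lies below [x] because [n] is
   smaller than the dimension of the full band. *)
pose j := (i + l)%N; have jx : (j.+1 < rk x)%N by rewrite /j; lia.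
have links k z : (l <= k)%N -> n - 1 != k.+1%:Z - l%:Z - 2 -> z \in level x k.+1 ->
    vanishes (rank_band z l k) (n - 1).
  move=> lk nk /levelP[zx rz]; have := IH (rk z) _ z erefl l (n - 1).
  by rewrite rz /= -rx -rz; apply; rewrite ?(rk_lt hG zx) // rz; lia.
have up d : (j.+1 + d < rk x)%N -> vanishes (rank_band x l (j.+1 + d)) n.
  elim: d => [|d IHd] dx.
    rewrite addn0; apply: vanishing_of_links_top; first by rewrite /j; lia.
      move=> f _; rewrite ni; have -> : l = (j - i)%N by rewrite /j; lia.
      exact: S.
    by move=> z; apply: links; rewrite ?ni /j; lia.
  rewrite addnS; apply: vanishing_of_links_top; first by rewrite /j; lia.
    by move=> f fc _; apply: IHd => //; lia.
  by move=> z; apply: links; rewrite ?ni /j; lia.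
by have := up ((rk x).-1 - j.+1)%N; rewrite subnKC; [apply; lia|lia].
Qed.

Lemma cohen_macaulay_detects : cohen_macaulay F G <-> detects_coboundaries.
Proof.
rewrite cohen_macaulay_bands; split; last exact: detects_bands_vanish.
exact: bands_vanish_detects.
Qed.

End RankLevels.

(** * The splitting algebra *)

Lemma scale_mulE (F : fieldType) (A : algType F) (c d e : F) (u v w : A) :
  d *: (c *: (e *: u + v * w)) = (c * e) *: (d *: u) + (c *: v) * (d *: w).
Proof.
by rewrite -scalerAl -scalerAr !scalerDr !scalerA (mulrC _ d) (mulrC c d) mulrA.
Qed.

Section FreeMonoidAlgebra.
Context (F : fieldType) (I : choiceType).
Local Notation free_alg := {malg F[{fmonom I}]}.
Implicit Types (m : {fmonom I}) (p q : free_alg).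

Lemma malgU_scale (c : F) m : << c *g m >> = c *: (<< m >> : free_alg).
Proof.
apply/malgP => k; apply: etrans (esym (mcoeffZ c << m >> k)).
by rewrite [LHS]mcoeffU [in RHS]mcoeffU mulrnAr mulr1.
Qed.

Lemma malgU_mul m1 m2 : << m1 >> * << m2 >> = << mmul m1 m2 >> :> free_alg.
Proof.
by rewrite malgM_def (fgmulUU (R := F) 1 1 m1 m2) mulr1.
Qed.

Lemma eq_additive (V : zmodType) (f g : free_alg -> V) :
  (forall p q, f (p + q) = f p + f q) -> (forall p q, g (p + q) = g p + g q) ->
  (forall c m, f << c *g m >> = g << c *g m >>) -> f =1 g.
Proof.
have z (h : free_alg -> V) : (forall p q, h (p + q) = h p + h q) -> h 0 = 0.
  by move=> hD; apply: (@addIr _ (h 0)); rewrite -hD !add0r.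
move=> fD gD fg p; rewrite (monalgE p).
rewrite (big_morph f fD (z _ fD)) (big_morph g gD (z _ gD)).
by apply: eq_bigr => m _.
Qed.

Lemma fmonom_nil : FMonom [::] = mone :> {fmonom I}.
Proof. exact: esym (fmoneE _). Qed.

Lemma fmonom_cons x t : (FMonom (x :: t) == mone :> {fmonom I}) = false.
Proof. by rewrite -fmonom_nil. Qed.

End FreeMonoidAlgebra.

(** * Left division in the free algebra *)

Section FreeAlgebra.
Context (F : fieldType) {disp : Order.disp_t} (G : finBPOrderType disp).
Local Notation gens := (gens G).
Local Notation free_alg := {malg F[{fmonom gens}]}.
Local Notation R := (splitting_alg F G).
Local Notation proj := (@proj F disp G).
Implicit Types (x y : gens) (m : {fmonom gens}) (p q : free_alg) (a b : R).

Definition gen x : R := proj (var F x).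

Lemma proj_one : proj 1 = 1. Proof. by []. Qed.

Lemma proj0 : proj 0 = 0.
Proof. by rewrite -(subrr 0) proj_additive subrr. Qed.

Lemma projE p q : proj (p * q) = proj p * proj q.
Proof. by rewrite -projM. Qed.

Lemma projZE c p : proj (c *: p) = c *: proj p.
Proof. by rewrite -projZ. Qed.

Lemma projDE p q : proj (p + q) = proj p + proj q.
Proof. by rewrite projD. Qed.

Lemma proj_sum (I : Type) (s : seq I) (P : pred I) (f : I -> free_alg) :
  proj (\sum_(i <- s | P i) f i) = \sum_(i <- s | P i) proj (f i).
Proof. exact: (big_morph _ projDE proj0). Qed.

Lemma proj_eq0 p : p \in @relators F disp G -> proj p = 0.
Proof. by move=> pI; rewrite -proj0; apply/proj_eqP; rewrite subr0. Qed.

Lemma proj_eq0P p : proj p = 0 -> p \in @relators F disp G.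
Proof. by rewrite -proj0 => /proj_eqP; rewrite subr0. Qed.

(** Removes a leading letter [x] and kills all other words. It reads off the component in
    [gen x * R] before the relations are imposed on that component. *)
Definition ldiv x : free_alg -> R := mmap (GRing.in_alg R)
  (fun m => if (m : seq gens) is y :: t then
              if y == x then proj << FMonom t >> else 0 else 0).

Lemma ldivD x p q : ldiv x (p + q) = ldiv x p + ldiv x q.
Proof. exact: mmapD. Qed.

Lemma ldivU x c m : ldiv x << c *g m >> =
  c *: (if (m : seq gens) is y :: t then
          if y == x then proj << FMonom t >> else 0 else 0).
Proof. by rewrite /ldiv (mmapU (f := GRing.in_alg R)) /= mulr_algl. Qed.

Lemma ldivZ x c p : ldiv x (c *: p) = c *: ldiv x p.
Proof.
move: p; apply: eq_additive => [p q|p q|d m].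
- by rewrite scalerDr ldivD.
- by rewrite ldivD scalerDr.
have -> : c *: << d *g m >> = << c * d *g m >> :> free_alg.
  apply/malgP => k; apply: etrans (mcoeffZ c << d *g m >> k) _.
  by rewrite [in LHS]mcoeffU [RHS]mcoeffU mulrnAr.
by rewrite [LHS]ldivU [in RHS]ldivU [RHS]scalerA.
Qed.

Lemma ldivMU x m1 m2 : ldiv x (<< m1 >> * << m2 >>) =
  (<< m1 >> : free_alg)@_mone *: ldiv x << m2 >> + ldiv x << m1 >> * proj << m2 >>.
Proof.
rewrite malgU_mul [LHS]ldivU [in RHS]ldivU [X in _ + X * _]ldivU 3!scale1r.
rewrite [X in X *: _]mcoeffU1; case: m1 => -[|y t].
  rewrite fmonom_nil.
  by rewrite mul1m eqxx scale1r fm1 mul0r addr0.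
rewrite fmonom_cons.
rewrite scale0r add0r fmM /=; case: eqP => _; last by rewrite mul0r.
by rewrite -projE malgU_mul /mmul /= fmmulE.
Qed.

(** A word of the product begins with a letter from [p], except when the word from [p] is empty. *)
Lemma ldivM x p q : ldiv x (p * q) = p@_mone *: ldiv x q + ldiv x p * proj q.
Proof.
move: p; apply: eq_additive => [p1 p2|p1 p2|c m].
- by rewrite mulrDl ldivD.
- by rewrite mcoeffD scalerDl ldivD mulrDl addrACA.
move: q; apply: eq_additive => [q1 q2|q1 q2|d m'].
- by rewrite mulrDr ldivD.
- by rewrite ldivD scalerDr projDE mulrDr addrACA.
rewrite (malgU_scale c m) (malgU_scale d m').
rewrite -[in LHS](free_alg_scaleAr d (c *: << m >>)) -[in LHS](scalerAl c).
rewrite [LHS](ldivZ x d) [in LHS](ldivZ x c) ldivMU.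
set P : free_alg := << m >>; set Q : free_alg := << m' >>.
have e1 : (c *: P)@_mone = c * P@_mone by exact: mcoeffZ.
have e2 : proj (d *: Q) = d *: proj Q by exact: projZE.
have e3 : ldiv x (d *: Q) = d *: ldiv x Q by exact: ldivZ.
have e4 : ldiv x (c *: P) = c *: ldiv x P by exact: ldivZ.
rewrite e1 e2 [X in _ = _ *: X + _]e3 [X in _ = _ + X * _]e4.
exact: scale_mulE.
Qed.

Lemma ldiv_var x y : ldiv x (var F y) = (y == x)%:R.
Proof.
apply: etrans (ldivU _ _ _) _; rewrite scale1r [fmu y]fmuE.
rewrite /= fmonom_nil; case: (y == x); last exact: erefl.
exact: proj_one.
Qed.

Lemma var_mone y : (var F y)@_mone = 0.
Proof.
have -> : (var F y)@_mone = (fmu y == mone)%:R by rewrite [LHS]mcoeffU1.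
by rewrite [fmu y]fmuE fmonom_cons.
Qed.

Lemma mcoeff1M p q : (p * q)@_mone = p@_mone * q@_mone.
Proof. by have [+ _] := mcoeff1g_is_multiplicative ({fmonom gens} : monomType) F;
  apply. Qed.

Lemma ldiv_varM x y p : ldiv x (var F y * p) = (y == x)%:R * proj p.
Proof. by rewrite [LHS]ldivM [in LHS]ldiv_var var_mone scale0r add0r. Qed.

Lemma ldiv1 x : ldiv x 1 = 0.
Proof.
by apply: etrans (ldivU x 1 mone) _; rewrite -fmonom_nil scaler0.
Qed.

End FreeAlgebra.

Section LevelIdeals.
Context (F : fieldType) {disp : Order.disp_t} (G : finBPOrderType disp).
Context (A : algType F) (gen : gens G -> A).
Local Notation gens := (gens G).
Implicit Types (a b : A).

Lemma S1_level (hG : ranked G) (x : G) : x != \bot%O -> S_ x 1 = level x (rk x).-1.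
Proof.
rewrite -(rk_gt0 hG) => x0; apply/setP => y; rewrite !inE lt_neqAle addn1.
rewrite -[in LHS](prednK x0) eqSS; have [->|//] := eqVneq y x.
by rewrite lexx -[in LHS](eqSS (rk x)) prednK // eqn_leq ltnn.
Qed.

(* The s(x, j) and L(x, j) of the introduction. *)
Definition gen_sum (x : G) j : A := \sum_(y : gens | val y \in level x j) gen y.

Definition level_ideal (x : G) j a : Prop := exists (b : gens -> A) (u : A),
  a = \sum_(y : gens | val y \notin level x j) gen y * b y + gen_sum x j * u.

Lemma level_idealD x j a b :
  level_ideal x j a -> level_ideal x j b -> level_ideal x j (a + b).
Proof.
move=> [b1 [u1 ->]] [b2 [u2 ->]]; exists (fun y => b1 y + b2 y), (u1 + u2).
rewrite mulrDr addrACA; congr (_ + _).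
by rewrite -big_split; apply: eq_bigr => y _; rewrite mulrDr.
Qed.

Lemma level_idealM x j a b : level_ideal x j a -> level_ideal x j (a * b).
Proof.
move=> [c [u ->]]; exists (fun y => c y * b), (u * b).
rewrite mulrDl mulrA big_distrl; congr (_ + _).
by apply: eq_bigr => y _; rewrite mulrA.
Qed.

Lemma level_ideal0 x j : level_ideal x j 0.
Proof.
exists (fun=> 0), 0; rewrite mulr0 addr0 big1 // => y _.
by rewrite mulr0.
Qed.

Lemma level_idealZ x j c a : level_ideal x j a -> level_ideal x j (c *: a).
Proof. by move=> /(@level_idealM x j a c%:A); rewrite mulr_algr. Qed.

Lemma level_ideal_gen x j (y : gens) a : val y \notin level x j ->
  level_ideal x j (gen y * a).
Proof.
move=> yx; exists (fun z => if z == y then a else 0), 0.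
rewrite mulr0 addr0 (bigD1 y) //= eqxx big1 ?addr0 // => z /andP[_ /negPf->].
by rewrite mulr0.
Qed.

Lemma level_ideal_sum x j a : level_ideal x j (gen_sum x j * a).
Proof.
exists (fun=> 0), a; rewrite [X in X + _]big1 ?add0r // => y _.
by rewrite mulr0.
Qed.

End LevelIdeals.

Lemma scale_mul0 (F : fieldType) (A : algType F) (c : F) (u v w z : A) :
  0 *: u + (c *: v + w * 0) * z = (c *: v) * z.
Proof. by rewrite scale0r add0r mulr0 addr0. Qed.

Section SplittingAlgebra.
Context (F : fieldType) {disp : Order.disp_t} (G : finBPOrderType disp).
Local Notation gens := (gens G).
Local Notation free_alg := {malg F[{fmonom gens}]}.
Local Notation R := (splitting_alg F G).
Local Notation proj := (@proj F disp G).
Local Notation gen := (@gen F disp G).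
Implicit Types (p q : free_alg) (a b : R).

Local Notation level_ideal := (level_ideal gen).
Local Notation gen_sum := (gen_sum gen).

Lemma relatorMl p s : relator s -> p * s \in @relators F disp G.
Proof.
by move=> rs; apply/relatorsP; have := idealM p 1 rs; rewrite mulr1.
Qed.

Lemma relator_in s : relator s -> s \in @relators F disp G.
Proof. by move=> rs; have := relatorMl 1 rs; rewrite mul1r. Qed.

Lemma genM_eq0 (x y : gens) : val y \notin S_ (val x) 1 -> gen x * gen y = 0.
Proof.
move=> xy; rewrite -projE; apply: proj_eq0; apply: relator_in.
exact: relator_mul.
Qed.

Lemma gen_sumS (x : gens) : gen x * (\sum_(y :
  gens | val y \in S_ (val x) 1) gen y) = 0.
Proof.
rewrite -proj_sum -projE; apply: proj_eq0; apply: relator_in.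
exact: relator_sum.
Qed.

Hypothesis hG : ranked G.

(** In [a * s * b] with [s] a relator, the product rule leaves only the constant term of [a] times
    the quotient of [s], because [a * s] has no constant term and [s] projects to 0. The quotient of
    a relator by its first letter is a defining generator of the level ideal. *)
Lemma level_ideal_relators (x : gens) p : p \in @relators F disp G ->
  level_ideal (val x) (rk (val x)).-1 (ldiv x p).
Proof.
move=> /relatorsP; elim=> [|p1 p2 _ IH1 _ IH2|a s b rs].
- rewrite -[0](scale0r (1 : free_alg)) ldivZ scale0r; exact: level_ideal0.
- by rewrite ldivD; apply: level_idealD.
have ps : proj s = 0.
  by apply: proj_eq0; apply: relator_in.
have as0 : (a * s)@_mone = 0.
  by apply: (@mcoeff1_relators F disp G); apply: relatorMl.
rewrite [ldiv x _](etrans (ldivM x (a * s) b)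
  (congr2 +%R (congr1 ( *:%R^~ _) as0) (congr1 ( *%R^~ _) (ldivM x a s)))).
rewrite ps scale_mul0 -scalerAl; apply: level_idealZ; apply: level_idealM.
case: rs => [y z yz|y]; rewrite ldiv_varM; case: (eqVneq y x) => [yx|_];
  rewrite ?mul0r ?mul1r; try exact: level_ideal0.
- rewrite -[proj _]mulr1; apply: level_ideal_gen.
  by rewrite -(S1_level hG) ?(valP x) // -yx.
- rewrite proj_sum -[X in level_ideal _ _ X]mulr1 yx (S1_level hG) ?(valP x) //.
  exact: level_ideal_sum.
Qed.

Lemma gen_decomp a : exists (c : F) (b : gens -> R),
  a = c%:A + \sum_y gen y * b y.
Proof.
pose p := repr a; exists (p@_mone), (fun y => ldiv y p).
rewrite -[LHS](reprK_R a) -/p; move: p; apply: eq_additive => [p q|p q|c m].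
- exact: projDE.
- rewrite mcoeffD scalerDl addrACA; congr (_ + _).
  by rewrite -big_split; apply: eq_bigr => y _; rewrite ldivD mulrDr.
rewrite malgU_scale projZE mcoeffZ mcoeffU1.
under eq_bigr do rewrite ldivZ -scalerAr.
rewrite -scaler_sumr -scalerA -scalerDr; congr (_ *: _).
case: m => -[|x t].
  rewrite fmonom_nil.
  rewrite eqxx scale1r big1 ?addr0 //.
  by move=> y _; rewrite ldivU fm1 scaler0 mulr0.
rewrite fmonom_cons.
rewrite scale0r add0r (bigD1 x) //= big1 ?addr0.
  rewrite ldivU /= eqxx scale1r -projE malgU_mul.
  by rewrite -[mmul _ _]/(fmmul _ _) fmmulE fmuE.
by move=> y; rewrite eq_sym ldivU /= => /negPf->; rewrite scaler0 mulr0.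
Qed.

(** The relation lifts to an element of the ideal of relators, and left division by [x] extracts
    [b x] from it. *)
Lemma gen_free (c : F) (b : gens -> R) : c%:A + \sum_y gen y * b y = 0 ->
  c = 0 /\ forall x, level_ideal (val x) (rk (val x)).-1 (b x).
Proof.
pose p : free_alg := c *: 1 + \sum_y var F y * repr (b y) => E.
have pE : proj p = c%:A + \sum_y gen y * b y.
  apply: etrans (projDE _ _) _; apply: congr2; first exact: projZE.
  apply: etrans (proj_sum _ _ _) _; apply: eq_bigr => y _.
  by apply: etrans (projE _ _) _; congr (_ * _); apply: reprK_R.
have /proj_eq0P pI : proj p = 0 by rewrite pE.
split=> [|x].
  have := mcoeff1_relators pI; rewrite mcoeffD mcoeffZ mcoeff1 eqxx mulr1.
  rewrite raddf_sum big1 ?addr0 // => y _.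
  by apply: etrans (mcoeff1M _ _) _; rewrite var_mone mul0r.
have := level_ideal_relators x pI; rewrite ldivD ldivZ ldiv1 scaler0 add0r.
have -> : ldiv x (\sum_y var F y * repr (b y)) = b x; last by [].
rewrite (big_morph (ldiv x) (ldivD x) (id1 := 0)); last first.
  by rewrite -[0](scale0r (1 : free_alg)) ldivZ scale0r.
rewrite (bigD1 x) //= big1 ?addr0; last first.
  by move=> y /negPf yx; rewrite ldiv_varM yx mul0r.
by rewrite ldiv_varM eqxx mul1r reprK_R.
Qed.

End SplittingAlgebra.

(** An interface that hides the quotient of the free algebra. [cg_sum] holds for all large bounds so
    that finitely many elements can share one. *)
Record connected_grading (F : fieldType) (A : algType F)
    (gr : nat -> A -> Prop) (pi : nat -> A -> A) : Prop := ConnectedGrading {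
  cgD : forall n a b, pi n (a + b) = pi n a + pi n b;
  cgZ : forall n c a, pi n (c *: a) = c *: pi n a;
  cgP : forall n a, gr n a <-> pi n a = a;
  cg_pi : forall m n a, pi m (pi n a) = if m == n then pi n a else 0;
  cg_sum : forall a, exists N, forall M, (N <= M)%N -> a = \sum_(n < M) pi n a;
  cgM : forall m n a b, gr m a -> gr n b -> gr (m + n)%N (a * b);
  cg0 : forall a, gr 0%N a -> exists c, a = c%:A;
  cg1 : gr 0%N 1
}.

(** * Descent of the word length to a quotient *)

Section Grading.
Context (F : fieldType) (I : choiceType) (A : algType F).
Local Notation free_alg := {malg F[{fmonom I}]}.
Context (pr : free_alg -> A).
Hypothesis prD : forall p q, pr (p + q) = pr p + pr q.
Hypothesis prM : forall p q, pr (p * q) = pr p * pr q.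
Hypothesis prZ : forall c p, pr (c *: p) = c *: pr p.
Hypothesis pr1 : pr 1 = 1.

(** The coefficients are the images of the components by length. Since this map is multiplicative,
    it kills the two-sided ideal generated by homogeneous elements that [pr] kills; this is how the
    grading passes to the quotient. *)
Definition grade_poly : free_alg -> {poly A} :=
  mmap (polyC \o GRing.in_alg A) (fun m => (pr << m >>)%:P * 'X^(fdeg m)).

Lemma polyC_XnM (u v : A) i j :
  (u%:P * 'X^i) * (v%:P * 'X^j) = (u * v)%:P * 'X^(i + j).
Proof.
rewrite -mulrA [X in _ * X]mulrA -(commr_polyXn v%:P i) -mulrA -exprD.
by rewrite mulrA -polyCM.
Qed.

Lemma grade_polyD p q : grade_poly (p + q) = grade_poly p + grade_poly q.
Proof. exact: (mmapD (f := (polyC \o GRing.in_alg A) : {additive F ->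
  {poly A}})). Qed.

Lemma grade_poly0 : grade_poly 0 = 0.
Proof. by apply: (addIr (grade_poly 0)); rewrite -grade_polyD !add0r. Qed.

Lemma grade_polyU c m : grade_poly << c *g m >> = (pr << c *g m >>)%:P * 'X^(fdeg m).
Proof.
apply: etrans (mmapU (f := (polyC \o GRing.in_alg A) : {additive F ->
  {poly A}}) _ _) _.
rewrite mulrA /= -polyCM; congr (_%:P * _).
by rewrite (malgU_scale c m) prZ mulr_algl.
Qed.

Lemma malgUU_mul (c d : F) (m m' : {fmonom I}) :
  << c *g m >> * << d *g m' >> = << c * d *g mmul m m' >> :> free_alg.
Proof. exact: (fgmulUU (R := F) c d m m'). Qed.

Lemma grade_polyM p q : grade_poly (p * q) = grade_poly p * grade_poly q.
Proof.
move: p; apply: eq_additive => [p1 p2|p1 p2|c m].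
- by rewrite mulrDl grade_polyD.
- by rewrite grade_polyD mulrDl.
move: q; apply: eq_additive => [q1 q2|q1 q2|d m'].
- by rewrite mulrDr grade_polyD.
- by rewrite grade_polyD mulrDr.
rewrite malgUU_mul !grade_polyU polyC_XnM -prM malgUU_mul.
by congr (_ * 'X^_); apply: fdegM.
Qed.

Definition homogeneous n (p : free_alg) := forall m, p@_m != 0 -> fdeg m = n.

Lemma grade_poly_homogeneous n p : homogeneous n p ->
  grade_poly p = (pr p)%:P * 'X^n.
Proof.
move=> hp; rewrite {1}(monalgE p) [in RHS](monalgE p).
have g0 := grade_poly0.
have p0 : pr 0 = 0 by apply: (addIr (pr 0)); rewrite -prD !add0r.
rewrite (big_morph grade_poly grade_polyD g0) (big_morph pr prD p0).
rewrite rmorph_sum mulr_suml !big_seq; apply: eq_bigr => m mp.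
by rewrite grade_polyU hp // mcoeff_neq0.
Qed.

Lemma grade_poly_eq0 n a s b : homogeneous n s -> pr s = 0 ->
  grade_poly (a * s * b) = 0.
Proof.
move=> hs s0; rewrite !grade_polyM (grade_poly_homogeneous hs) s0.
by rewrite polyC0 mul0r mulr0 mul0r.
Qed.

Lemma grade_polyD0 p q : grade_poly p = 0 -> grade_poly q = 0 ->
  grade_poly (p + q) = 0.
Proof. by move=> p0 q0; rewrite grade_polyD p0 q0 add0r. Qed.

Lemma grade_poly_horner1 p : (grade_poly p).[1] = pr p.
Proof.
move: p; apply: eq_additive => [p q|p q|c m].
- by rewrite grade_polyD hornerD.
- exact: prD.
by rewrite grade_polyU hornerCM hornerXn expr1n mulr1.
Qed.

Definition component n (p : free_alg) : free_alg :=
  \sum_(m <- msupp p | fdeg m == n) << p@_m *g m >>.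

Lemma component_homogeneous n p : homogeneous n (component n p).
Proof.
move=> m; rewrite /component raddf_sum /= => /eqP; apply: contra_notP => mn.
rewrite big1 // => k /eqP kn; apply: etrans (mcoeffU _ _ _) _.
by case: eqP => // km; case: mn; rewrite -km.
Qed.

Lemma grade_poly_coef n p : (grade_poly p)`_n = pr (component n p).
Proof.
have g0 := grade_poly0.
have p0 : pr 0 = 0 by apply: (addIr (pr 0)); rewrite -prD !add0r.
rewrite {1}(monalgE p) (big_morph grade_poly grade_polyD g0) coef_sum.
rewrite /component (big_morph pr prD p0) [RHS]big_mkcond.
apply: eq_bigr => m _; rewrite grade_polyU coefCM coefXn eq_sym.
by case: eqP; rewrite ?mulr1 ?mulr0.
Qed.

Lemma homogeneous_const (c : F) : homogeneous 0 (c *: 1 : free_alg).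
Proof.
move=> m; rewrite mcoeffZ mcoeff1; have [-> _|_] := eqVneq m mone; first exact: fdeg1.
by rewrite mulr0 eqxx.
Qed.

Lemma grade_polyZ c p : grade_poly (c *: p) = c%:A%:P * grade_poly p.
Proof.
have -> : c *: p = (c *: 1) * p by rewrite -scalerAl mul1r.
rewrite grade_polyM (grade_poly_homogeneous (@homogeneous_const c)).
by rewrite prZ pr1 expr0 mulr1.
Qed.

Hypothesis pr_hom : forall p, pr p = 0 -> grade_poly p = 0.
Hypothesis pr_surj : forall a, exists p, a = pr p.

Lemma grading_by_length : exists pi : nat -> A -> A,
  connected_grading (fun n a => exists2 p, homogeneous n p & a = pr p) pi.
Proof.
(* An arbitrary set-theoretic section suffices: by [pr_hom], two preimages have the same
   [grade_poly]. *)
have /choice[sec prK] : forall a, exists p, pr p = a.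
  by move=> a; have [p ->] := pr_surj a; exists p.
have prN p : pr (- p) = - pr p by rewrite -scaleN1r prZ scaleN1r.
have gpN p : grade_poly (- p) = - grade_poly p.
  apply/eqP; rewrite -addr_eq0 -grade_polyD addNr.
  by rewrite grade_poly0.
have secE p q : pr p = pr q -> grade_poly p = grade_poly q.
  move=> E; apply/eqP; rewrite -subr_eq0 -gpN -grade_polyD; apply/eqP/pr_hom.
  by rewrite prD prN E subrr.
pose pi n a := (grade_poly (sec a))`_n.
have piE n p : pi n (pr p) = pr (component n p).
  by rewrite /pi (secE _ p) ?prK // grade_poly_coef.
have piH m n p : homogeneous n p -> pi m (pr p) = if m == n then pr p else 0.
  move=> hp; rewrite /pi (secE _ p) ?prK // (grade_poly_homogeneous hp).
  by rewrite coefCM coefXn; case: eqP; rewrite ?mulr1 ?mulr0.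
exists pi; split.
- move=> n a b; rewrite /pi -coefD -grade_polyD.
  by rewrite (secE _ (sec a + sec b)) // prD !prK.
- move=> n c a; rewrite /pi (secE _ (c *: sec a)) ?prZ ?prK // grade_polyZ.
  by rewrite coefCM mulr_algl.
- move=> n a; split=> [[p hp ->]|E]; first by rewrite (piH _ _ _ hp) eqxx.
  exists (component n (sec a)); first exact: component_homogeneous.
  by rewrite -piE prK E.
- move=> m n a; have := piH m n _ (@component_homogeneous n (sec a)).
  by rewrite -piE prK.
- move=> a; exists (size (grade_poly (sec a))) => M sM.
  rewrite -[LHS]prK -grade_poly_horner1 (horner_coef_wide _ sM).
  by apply: eq_bigr => i _; rewrite expr1n mulr1.
- move=> m n a b [p hp ->] [q hq ->].
  have E : grade_poly (p * q) = (pr (p * q))%:P * 'X^(m + n).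
    rewrite grade_polyM (grade_poly_homogeneous hp) (grade_poly_homogeneous hq).
    by rewrite polyC_XnM prM.
  exists (component (m + n) (p * q)); first exact: component_homogeneous.
  by rewrite -grade_poly_coef E coefCM coefXn eqxx mulr1 prM.
- move=> a [p hp ->]; exists (p@_mone); rewrite -pr1 -prZ; congr (pr _).
  apply/malgP => m; apply: etrans (esym (mcoeffZ _ 1 m)).
  rewrite mcoeff1; have [->|m1] := eqVneq m mone; first by rewrite mulr1.
  rewrite mulr0; apply/eqP; apply: contraNT m1 => /hp m0.
  by rewrite -(fdeg_eq0 m) m0.
- by exists (1 *: 1); [apply: homogeneous_const | rewrite prZ pr1 scale1r].
Qed.

End Grading.

(* All that is used of R_Gamma. In [ra_free] the ideal annihilates [gen x], by
   [ra_mul0] and [ra_sum0]. *)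
Record ranked_algebra (F : fieldType) (disp : Order.disp_t) (G : finBPOrderType disp)
    (A : algType F) (gen : gens G -> A) (gr : nat -> A -> Prop)
    (pi : nat -> A -> A) : Prop := RankedAlgebra {
  ra_grading : connected_grading gr pi;
  ra_gen : forall x, gr 1%N (gen x);
  ra_mul0 : forall x y : gens G, val y \notin S_ (val x) 1 -> gen x * gen y = 0;
  ra_sum0 : forall x : gens G,
    gen x * (\sum_(y : gens G | val y \in S_ (val x) 1) gen y) = 0;
  ra_free : forall (c : F) (b : gens G -> A), c%:A + \sum_y gen y * b y = 0 ->
    c = 0 /\ forall x, level_ideal gen (val x) (rk (val x)).-1 (b x);
  ra_decomp : forall a, exists (c : F) (b : gens G -> A),
    a = c%:A + \sum_y gen y * b y
}.

Section SplittingRanked.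
Context (F : fieldType) {disp : Order.disp_t} (G : finBPOrderType disp).
Hypothesis hG : ranked G.
Local Notation gens := (gens G).
Local Notation free_alg := {malg F[{fmonom gens}]}.
Local Notation R := (splitting_alg F G).
Local Notation proj := (@proj F disp G).

Lemma var_homogeneous (x : gens) : homogeneous 1 (var F x).
Proof.
move=> m /eqP; apply: contra_notP => m1; rewrite [LHS]mcoeffU1.
by case: eqP => // E; case: m1; rewrite -E [fmu x]fmuE.
Qed.

Lemma var2_homogeneous (x y : gens) : homogeneous 2 (var F x * var F y).
Proof.
move=> m; rewrite /var malgU_mul => /eqP; apply: contra_notP => m2.
rewrite [LHS]mcoeffU1.
by case: eqP => // E; case: m2; rewrite -E fdegM !fdegU.
Qed.

Lemma homogeneous_sum n (J : finType) (P : pred J) (f : J -> free_alg) :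
  (forall j, homogeneous n (f j)) -> homogeneous n (\sum_(j | P j) f j).
Proof.
move=> hf m /eqP; apply: contra_notP => mn; rewrite raddf_sum big1 // => j _.
by apply/eqP; apply: contra_notT mn; apply: hf.
Qed.

Lemma relator_homogeneous s : @relator F disp G s -> homogeneous 2 s.
Proof.
case=> [x y _|x]; first exact: var2_homogeneous.
rewrite mulr_sumr; apply: homogeneous_sum => y; exact: var2_homogeneous.
Qed.

Lemma splitting_graded (p : free_alg) : proj p = 0 -> grade_poly proj p = 0.
Proof.
move=> /proj_eq0P/relatorsP; elim=> [|u v _ IHu _ IHv|a s b rs].
- exact: grade_poly0.
- exact: grade_polyD0.
- apply: (grade_poly_eq0 (@projDE F disp G) (@projE F disp G) (@projZE F disp G)).
    exact: relator_homogeneous.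
  exact: proj_eq0 (relator_in rs).
Qed.

Lemma splitting_ranked : exists pi, ranked_algebra (@gen F disp G) (grade_R F G) pi.
Proof.
have [pi gpi] := grading_by_length (@projDE F disp G) (@projE F disp G)
  (@projZE F disp G) (@proj_one F disp G) splitting_graded
  (fun a => ex_intro _ (repr a) (esym (reprK_R a))).
exists pi; split.
- exact: gpi.
- by move=> x; exists (var F x) => //; apply: var_homogeneous.
- exact: genM_eq0.
- exact: gen_sumS.
- exact: gen_free.
- exact: gen_decomp.
Qed.

End SplittingRanked.

(** * Annihilators and cochains *)

Section ConnectedGrading.
Context (F : fieldType) (A : algType F) (gr : nat -> A -> Prop) (pi : nat -> A -> A).
Hypothesis gA : connected_grading gr pi.
Implicit Types (a b : A) (c : F) (k m n : nat).

Lemma piD n a b : pi n (a + b) = pi n a + pi n b.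
Proof. exact: cgD gA _ _ _. Qed.

Lemma pi0 n : pi n 0 = 0.
Proof. by apply: (addIr (pi n 0)); rewrite -piD !add0r. Qed.

Lemma piN n a : pi n (- a) = - pi n a.
Proof. by apply/eqP; rewrite -addr_eq0 -piD addNr pi0. Qed.

Lemma piB n a b : pi n (a - b) = pi n a - pi n b.
Proof. by rewrite piD piN. Qed.

Lemma pi_sum n (I : Type) (s : seq I) (P : pred I) (f : I -> A) :
  pi n (\sum_(i <- s | P i) f i) = \sum_(i <- s | P i) pi n (f i).
Proof. exact: (big_morph _ (piD n) (pi0 n)). Qed.

Lemma gr_pi n a : gr n (pi n a).
Proof. by apply/(cgP gA); rewrite (cg_pi gA) eqxx. Qed.

Lemma pi_gr m n a : gr n a -> pi m a = if m == n then a else 0.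
Proof. by move=> /(cgP gA) <-; apply: cg_pi gA _ _ _. Qed.

Lemma pi_id n a : gr n a -> pi n a = a.
Proof. by move/(cgP gA). Qed.

Lemma gr_zero n : gr n 0.
Proof. by apply/(cgP gA); rewrite pi0. Qed.

Lemma grD n a b : gr n a -> gr n b -> gr n (a + b).
Proof. by move=> /(cgP gA) ga /(cgP gA) gb; apply/(cgP gA); rewrite piD ga gb. Qed.

Lemma grZ n c a : gr n a -> gr n (c *: a).
Proof. by move=> /(cgP gA) ga; apply/(cgP gA); rewrite (cgZ gA) ga. Qed.

Lemma gr_sum n (I : Type) (s : seq I) (P : pred I) (f : I -> A) :
  (forall i, P i -> gr n (f i)) -> gr n (\sum_(i <- s | P i) f i).
Proof. by move=> gf; elim/big_rec: _ => [|i x Pi gx]; [exact: gr_zero|apply: grD;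
  auto]. Qed.

Lemma gr_scalar c : gr 0%N (c%:A).
Proof. by apply: grZ; apply: cg1 gA. Qed.

Lemma piMl k m a b : gr m a ->
  pi k (a * b) = if (m <= k)%N then a * pi (k - m) b else 0.
Proof.
move=> ga; have [N bN] := cg_sum gA b.
rewrite {1}(bN (maxn N k.+1)) ?leq_maxl // mulr_sumr pi_sum.
have E (i : 'I_(maxn N k.+1)) : pi k (a * pi i b) =
    if (m + i == k)%N then a * pi i b else 0.
  by rewrite (pi_gr _ (cgM gA ga (gr_pi i b))) eq_sym.
rewrite (eq_bigr _ (fun i _ => E i)) -big_mkcond /=.
case: leqP => [mk|km]; last by rewrite big1 // => i /eqP; lia.
have lt : (k - m < maxn N k.+1)%N by rewrite leq_max ltnS leq_subr orbT.
rewrite (big_pred1 (Ordinal lt)) //= => i.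
by apply/eqP/eqP => [ik|->/=]; [apply: val_inj => /=; lia|lia].
Qed.

Lemma piMr k m a b : gr m b ->
  pi k (a * b) = if (m <= k)%N then pi (k - m) a * b else 0.
Proof.
move=> gb; have [N aN] := cg_sum gA a.
rewrite {1}(aN (maxn N k.+1)) ?leq_maxl // mulr_suml pi_sum.
have E (i : 'I_(maxn N k.+1)) : pi k (pi i a * b) =
    if (i + m == k)%N then pi i a * b else 0.
  by rewrite (pi_gr _ (cgM gA (gr_pi i a) gb)) eq_sym.
rewrite (eq_bigr _ (fun i _ => E i)) -big_mkcond /=.
case: leqP => [mk|km]; last by rewrite big1 // => i /eqP; lia.
have lt : (k - m < maxn N k.+1)%N by rewrite leq_max ltnS leq_subr orbT.
rewrite (big_pred1 (Ordinal lt)) //= => i.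
by apply/eqP/eqP => [ik|->/=]; [apply: val_inj => /=; lia|lia].
Qed.

End ConnectedGrading.

Section RankedAlgebra.
Context (F : fieldType) {disp : Order.disp_t} (G : finBPOrderType disp).
Hypothesis hG : ranked G.
Context (A : algType F) (gen : gens G -> A) (gr : nat -> A -> Prop) (pi : nat -> A ->
  A).
Hypothesis raA : ranked_algebra gen gr pi.
Let gA := ra_grading raA.
Local Notation gens := (gens G).
Implicit Types (a b : A) (i j k : nat) (c d g : seq G -> F).
Local Notation level_ideal := (level_ideal gen).
Local Notation gen_sum := (gen_sum gen).

Lemma gen_ann (x : gens) a :
  gen x * a = 0 <-> level_ideal (val x) (rk (val x)).-1 a.
Proof.
split=> [E|[b [u ->]]].
  have [|_ /(_ x)] := ra_free raA (c := 0) (b := fun y => if y == x then a else 0).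
    rewrite scale0r add0r (bigD1 x) //= eqxx E big1 ?addr0 // => y /negPf->.
    by rewrite mulr0.
  by rewrite eqxx.
rewrite mulrDr mulrA /gen_sum -(S1_level hG) ?(valP x) //.
rewrite (ra_sum0 raA) mul0r addr0 big_distrr big1 //= => y yx.
by rewrite mulrA (ra_mul0 raA) // mul0r.
Qed.

Lemma gen_indep (b : gens -> A) : \sum_y gen y * b y = 0 ->
  forall x, gen x * b x = 0.
Proof.
move=> E x; apply/gen_ann; have [|_] := ra_free raA (c := 0) (b := b); last exact.
by rewrite scale0r add0r.
Qed.

Lemma gr_gen_sum x j : gr 1%N (gen_sum x j).
Proof. by apply: (gr_sum gA) => y _; apply: ra_gen raA _. Qed.

(** The right ideals generated by distinct generators form a direct sum, so the terms vanish
    separately. *)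
Lemma gen_sumM_eq0 x j a :
  gen_sum x j * a = 0 <-> forall z : gens, val z \in level x j -> gen z * a = 0.
Proof.
split=> [E z zx|E].
  have /gen_indep/(_ z) : \sum_y gen y * (if val y \in level x j then a else 0) = 0.
    rewrite -[RHS]E mulr_suml [RHS]big_mkcond; apply: eq_bigr => y _.
    by case: ifP; rewrite ?mulr0.
  by rewrite zx.
by rewrite mulr_suml big1.
Qed.

Lemma level_ideal_homogeneous x j a :
  (forall n, level_ideal x j (pi n a)) -> level_ideal x j a.
Proof.
move=> h; have [N /(_ N (leqnn N))->] := cg_sum gA a.
by elim/big_rec: _ => [|i b _]; [apply: level_ideal0|apply: level_idealD].
Qed.

(** Sends a sequence to the product of its generators in reverse order: simplices are listed
    upwards, whereas [gen x * gen y] can be nonzero only if [y] lies one rank below [x]. *)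
Fixpoint ev i c : A :=
  if i is i'.+1 then \sum_(y : gens) gen y * ev i' (fun t => c (rcons t (val y)))
  else (c [::])%:A.

Lemma evB i c d : ev i (fun s => c s - d s) = ev i c - ev i d.
Proof.
elim: i c d => [|i IH] c d /=; first by rewrite scalerBl.
by rewrite -sumrB; apply: eq_bigr => y _; rewrite IH mulrBr.
Qed.

Lemma eq_ev i c d : c =1 d -> ev i c = ev i d.
Proof.
elim: i c d => [|i IH] c d cd /=; first by rewrite cd.
by apply: eq_bigr => y _; congr (_ * _); apply: IH => s.
Qed.

Lemma gr_ev i c : gr i (ev i c).
Proof.
elim: i c => [|i IH] c /=; first exact: gr_scalar gA _.
apply: (gr_sum gA) => y _; rewrite -add1n; apply: (cgM gA) (IH _).
exact: ra_gen raA _.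
Qed.

Definition glue_last (h : G -> seq G -> F) (e : seq G -> F) s : F :=
  if rev s is z :: t then h z (rev t) else e s.

Lemma glue_last_rcons h e t z : glue_last h e (rcons t z) = h z t.
Proof. by rewrite /glue_last rev_rcons revK. Qed.

Lemma ev_surj i a : gr i a -> exists c, a = ev i c.
Proof.
elim: i a => [|i IH] a ga.
  by have [c ->] := cg0 gA ga; exists (fun=> c).
have [c [b E]] := ra_decomp raA a.
have /choice[h hE] : forall y : gens, exists h, pi i (b y) = ev i h.
  by move=> y; apply/IH/(gr_pi gA).
(* Cochains are functions on all of [G]; the value at [\bot], which is not a generator, is set to
   0. *)
have /choice[u uE] : forall y : G, exists u, forall y' : gens, val y' = y -> h y' = u.
  move=> y; have [->|y0] := eqVneq y \bot%O; last by exists (h (Sub y y0)) => y' yy;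
    congr h; apply: val_inj.
  by exists (fun=> 0) => y' E'; have := valP y'; rewrite E' eqxx.
exists (glue_last u (fun=> 0)).
rewrite -[LHS](pi_id gA ga) E (piD gA) (pi_gr gA _ (gr_scalar gA c))
  add0r (pi_sum gA) /=.
apply: eq_bigr => y _; rewrite (piMl gA _ _ (ra_gen raA y)) /= subSS subn0 hE.
congr (_ * _); apply: eq_ev => t; rewrite glue_last_rcons.
by rewrite (uE _ y erefl).
Qed.

(** A chain of [i.+1] elements in a band of [i.+1] ranks takes every rank, so its last element has
    rank [j]. *)
Lemma simplex_top_level (x : G) i j s :
  simplex (rank_band x (j - i.+1) j) (i.+1%:Z - 1) s <->
  exists t z, [/\ s = rcons t z, z \in level x j, (0 < j)%N &
                  simplex (rank_band z (j.-1 - i) j.-1) (i%:Z - 1) t].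
Proof.
have -> : i.+1%:Z - 1 = (i%:Z - 1) + 1 by lia.
have -> : (j - i.+1 = j.-1 - i)%N by lia.
split=> [sP|[t [z [-> /levelP[zx rz] j0 tP]]]]; last first.
  rewrite simplex_rcons; apply/andP; split; first by apply/rank_bandP; split=> //;
    lia.
  apply: simplex_sub tP; apply/subsetP => y /rank_bandP[yz ly yj].
  rewrite inE yz andbT; apply/rank_bandP; split=> //; last lia.
  exact: lt_trans yz zx.
case/lastP: s sP => [/simplex_size/=|t z]; first by lia.
rewrite simplex_rcons => /andP[/rank_bandP[zx lz zj] tP].
have tP' : simplex (rank_band z (j.-1 - i) (rk z).-1) (i%:Z - 1) t.
  apply: simplex_sub tP; apply/subsetP => y;
    rewrite inE => /andP[/rank_bandP[yx ly _] yz].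
  by apply/rank_bandP; split=> //; have := rk_lt hG yz; lia.
have rz : rk z = j.
  by have := rank_band_size hG tP'; have := simplex_size tP'; lia.
exists t, z; split=> //; [exact/levelP|lia|by rewrite -{2}rz].
Qed.

(* A homogeneous element of degree i is a cochain on chains of size i; the
   chains of size i of the band of ranks ]j - i, j] are the saturated ones. *)
Lemma level_ideal_ev i x j c : level_ideal x j (ev i c) <->
  is_coboundary (rank_band x (j - i) j) (i%:Z - 1) c.
Proof.
elim: i x j c => [|i IH] x j c.
  split=> [[b [u /= E]]|[g gP]].
    have [|c0 _] := ra_free raA (c := c [::])
      (b := fun y => - (if val y \in level x j then u else b y)).
      rewrite E [X in X + gen_sum x j * _]big_mkcond mulr_suml [X in _ + X +
        _]big_mkcond.
      rewrite -!big_split big1 // => y _ /=.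
      by case: (val y \in level x j); rewrite /= mulrN ?add0r ?addr0 subrr.
    exists (fun=> 0) => s /simplex_size; rewrite subrK; case: s => // _.
    by rewrite coboundary_nil.
  rewrite /= gP ?coboundary_nil ?scale0r; first exact: level_ideal0.
  by rewrite /simplex.
pose cy (y : G) t := c (rcons t y).
(* Generators outside the level are free to absorb their terms. On the level, one common cochain
   [d], from the coefficient of [gen_sum x j], must agree with each [cy y] modulo the annihilator of
   [gen y]. *)
have step : level_ideal x j (ev i.+1 c) <-> exists d, forall y : gens,
    val y \in level x j -> gen y * ev i (fun t => cy (val y) t - d t) = 0.
  split=> [[b [u /= E]]|[d dP]].
    have [d dE] := ev_surj (gr_pi gA i u); exists d => y yx.
    pose b' y := ev i (cy (val y)) - (if val y \in level x j then u else b y).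
    have /gen_indep/(_ y) : \sum_y gen y * b' y = 0.
      under eq_bigr do rewrite mulrBr.
      rewrite sumrB E [X in X + gen_sum x j * _]big_mkcond mulr_suml.
      rewrite [X in _ + X - _]big_mkcond -big_split -sumrB big1 // => z _ /=.
      by case: (val z \in level x j); rewrite /= ?add0r ?addr0 subrr.
    rewrite /b' yx => /(congr1 (pi i.+1)); rewrite (pi0 gA).
    rewrite (piMl gA _ _ (ra_gen raA y)) /= subSS subn0 (piB gA).
    by rewrite (pi_id gA (gr_ev _ _)) dE evB.
  exists (fun y => ev i (cy (val y))), (ev i d);
    rewrite /= (bigID (fun y => val y \in level x j)).
  rewrite addrC /=; congr (_ + _); rewrite mulr_suml; apply: eq_bigr => y /dP.
  by rewrite evB mulrBr => /eqP; rewrite subr_eq0 => /eqP.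
have step2 : level_ideal x j (ev i.+1 c) <-> exists d, forall y,
    y \in level x j -> (0 < j)%N ->
    is_coboundary (rank_band y (j.-1 - i) j.-1) (i%:Z - 1) (fun t => cy y t - d t).
  rewrite step; split=> -[d dP]; exists d => y yx.
    move=> j0; have [_ ry] := levelP _ _ _ yx.
    have y0 : y != \bot%O by rewrite -(rk_gt0 hG) ry.
    by have /gen_ann := dP (Sub y y0) yx; rewrite /= ry => /IH.
  have [_ ry] := levelP _ _ _ yx; apply/gen_ann; rewrite ry; apply/IH/dP => //.
  by rewrite -ry (rk_gt0 hG) (valP y).
rewrite step2; split=> [[d dP]|[g gP]].
  have /choice[h hP] : forall y, exists h, y \in level x j -> (0 < j)%N ->
      forall s, simplex (rank_band y (j.-1 - i) j.-1) (i%:Z - 1) s ->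
      cy y s - d s = coboundary h s.
    move=> y; case: (boolP ((y \in level x j) && (0 < j)%N)) => [/andP[yx j0]|nyx].
      by have [h hP] := dP y yx j0; exists h.
    by exists (fun=> 0) => yx j0; rewrite yx j0 in nyx.
  (* The face of [rcons t z] without [z] carries the sign [(-1) ^+ i] and is the only one that does
     not end in rank [j]. So [g] is [(-1) ^+ i * d] there and [h z] on the other faces. *)
  exists (fun s => glue_last (fun y t => if rk y == j then h y t else (-1) ^+ i * d s)
                     (fun s => (-1) ^+ i * d s) s).
  move=> s /simplex_top_level[t [z [-> zx j0 tP]]].
  have /eqP := hP z zx j0 t tP; rewrite subr_eq addrC => /eqP; rewrite /cy => ->.
  rewrite coboundary_rcons; have [_ rz] := levelP _ _ _ zx.
  have -> : size t = i by have := simplex_size tP; lia.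
  congr (_ + _); last by apply: eq_coboundary => k _; rewrite glue_last_rcons rz eqxx.
  suff -> : glue_last (fun y t' => if rk y == j then h y t' else (-1) ^+ i * d t)
    (fun s => (-1) ^+ i * d s) t = (-1)
      ^+ i * d t by rewrite mulrA -expr2 sqrr_sign mul1r.
  case/lastP: t tP => // t w; rewrite glue_last_rcons.
  have -> : i%:Z - 1 = (i%:Z - 1 - 1) + 1 by lia.
  by rewrite simplex_rcons => /andP[/rank_bandP[_ _ wj] _]; case: eqP => //; lia.
exists (fun t => (-1) ^+ i * g t) => y yx j0; exists (fun t => g (rcons t y)) => t tP.
rewrite /cy gP; last by apply/simplex_top_level; exists t, y.
rewrite coboundary_rcons; have -> : size t = i by have := simplex_size tP; lia.
by rewrite addrC addKr.
Qed.

Definition annihilators_are_level_ideals := forall x j a, (j.+1 < rk x)%N ->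
  gen_sum x j.+1 * a = 0 -> level_ideal x j a.

(** [gen_sum x j.+1] kills [a] exactly when each [gen z] of that level does, that is, when [a] lies
    in [level_ideal z j] for every such [z]. In each degree [level_ideal_ev] translates this into
    coboundaries. *)
Lemma annihilators_detect :
  annihilators_are_level_ideals <-> detects_coboundaries F G.
Proof.
split=> [ann x j i c jx cL|det x j a jx E].
  apply/level_ideal_ev/ann => //; apply/gen_sumM_eq0 => z zx.
  have [_ rz] := levelP _ _ _ zx.
  by apply/gen_ann; rewrite rz; apply/level_ideal_ev/cL.
apply: level_ideal_homogeneous => i.
have [c cE] := ev_surj (gr_pi gA i a); rewrite cE; apply/level_ideal_ev.
apply: det => // z zx; have [_ rz] := levelP _ _ _ zx.
have z0 : z != \bot%O by rewrite -(rk_gt0 hG) rz.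
have /gen_sumM_eq0/(_ (Sub z z0)) : gen_sum x j.+1 * pi i a = 0.
  have := congr1 (pi i.+1) E.
  by rewrite (pi0 gA) (piMl gA _ _ (gr_gen_sum x _)) /= subSS subn0.
by rewrite cE => /(_ zx)/gen_ann; rewrite /= rz => /level_ideal_ev.
Qed.

End RankedAlgebra.

(** * Uniformity *)

Section Uniform.
Context (F : fieldType) {disp : Order.disp_t} (G : finBPOrderType disp).
Hypothesis hG : ranked G.
Implicit Types (x y z w a b : G) (j : nat).

Lemma level_inhabited x j : (j < rk x)%N -> exists y, y \in level x j.
Proof.
move=> jx; have [] := @between_rk _ _ hG \bot%O x j.
- by rewrite lt0x -(rk_gt0 hG); lia.
- by rewrite (rk0 hG).
- by move=> y [_ yx ry]; exists y; apply/levelP.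
Qed.

Lemma level_trans x y j : (y < x)%O -> level y j \subset level x j.
Proof.
move=> yx; apply/subsetP => z /levelP[zy rz]; apply/levelP; split=> //.
exact: lt_trans zy yx.
Qed.

Lemma level_below x y j : (j < rk x)%N -> y \in level x j -> (j.+1 < rk x)%N ->
  exists2 z, z \in level x j.+1 & y \in level z j.
Proof.
move=> jx /levelP[yx ry] jx'.
have [|z [yz zx rz]] := @between_rk _ _ hG y x j.+1 yx; first by rewrite ry leqnSn.
exists z; apply/levelP; split=> //; rewrite lt_neqAle yz andbT.
by apply/eqP => E; move: rz; rewrite -E ry; lia.
Qed.

Lemma S1_rk x j : rk x = j.+1 -> S_ x 1 = level x j.
Proof. by move=> rx; rewrite (S1_level hG) ?rx // -(rk_gt0 hG) rx. Qed.

Lemma uniform_simP : uniform G <-> forall x a b, x != \bot%O ->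
  a \in S_ x 1 -> b \in S_ x 1 -> sim x a b.
Proof.
split=> [uG x a b x0 ax bx|simG x x0].
  have /eqP/cards1P[B BE] := uG x x0.
  pose E c := [set d in S_ x 1 | sim x c d].
  have inB c : c \in S_ x 1 -> E c = B.
    by move=> cx; apply/set1P; rewrite -BE; apply: imset_f.
  have : b \in E b by rewrite inE bx /sim connect0.
  by rewrite (inB b) // -(inB a) // inE => /andP[].
have [y] := @level_inhabited x (rk x).-1 ltac:(by rewrite prednK // (rk_gt0 hG)).
rewrite -(S1_level hG) // => yx.
rewrite (_ : equivalence_partition _ _ = [set [set d in S_ x 1 | sim x y d]])
  ?cards1 //.
apply/setP => B; rewrite inE; apply/imsetP/eqP => [[c cx ->]|->]; last by exists y.
apply/setP => d; rewrite [LHS]in_set [RHS]in_set.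
by apply/andP/andP => -[dx _]; split=> //; apply: simG.
Qed.

Lemma meets_belowP x a b j : rk x = j.+2 ->
  reflect [/\ a \in level x j.+1, b \in level x j.+1 &
    exists c, c \in level a j :&: level b j] (meets_below x a b).
Proof.
move=> rx; rewrite /meets_below (S1_rk rx).
apply: (iffP and3P) => -[ax bx]; have [_ ra] := levelP _ _ _ ax;
  have [_ rb] := levelP _ _ _ bx;
  rewrite ?(S1_rk ra) ?(S1_rk rb).
  by move=> /existsP.
by move=> E; split=> //; apply/existsP.
Qed.

(** Induction on [rk x - j], pushing [f] up to a function on level [j.+1]. Two neighbours for
    [meets_below w] share an element of rank [j], so uniformity at [w] of rank [j.+2] makes the new
    function constant below [w]. *)
Lemma uniform_levels (T : Type) x j (f : G -> T) : uniform G -> (j.+1 < rk x)%N ->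
  (forall z, z \in level x j.+1 -> {in level z j &, forall y y', f y = f y'}) ->
  {in level x j &, forall y y', f y = f y'}.
Proof.
move=> /uniform_simP uG; move: {2}(rk x - j)%N (erefl (rk x - j)%N) => r.
elim/ltn_ind: r j f => r IH j f rE jx fL.
(* [f \o p] is [f] pushed up one level; by hypothesis the choice of [p z] below [z] does not affect
   its value. *)
pose p z := if [pick y in level z j] is Some y then y else \bot%O.
have pP z : z \in level x j.+1 -> p z \in level z j.
  move=> /levelP[_ rz]; rewrite /p; case: pickP => // none.
  by have [y] := @level_inhabited z j ltac:(by rewrite rz); have := none y => /= ->.
have fp y z : z \in level x j.+1 -> y \in level z j -> f y = f (p z).
  by move=> zx yz; apply: fL zx _ _ yz (pP z zx).
have step w : (w <= x)%O -> rk w = j.+2 ->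
  {in level w j.+1 &, forall z z', f (p z) = f (p z')}.
  move=> wx rw z z' zw z'w.
  have wL v : v \in level w j.+1 -> v \in level x j.+1.
    move: wx; rewrite le_eqVlt => /orP[/eqP<-//|wx]; exact/subsetP/level_trans.
  have := uG w z z'; rewrite (S1_rk rw) -(rk_gt0 hG) rw => /(_ isT zw z'w).
  move=> /connectP[s]; elim: s z zw => [|v s IHs] z zw /=; first by move=> _ ->.
  move=> /andP[/(meets_belowP _ _ rw)[_ vw [c /setIP[cz cv]]] sP zL].
  by rewrite -(fp c z) ?wL // (fp c v) ?wL //; apply: IHs.
move=> y y' yx y'x.
have jx' : (j < rk x)%N by lia.
have [z zx yz] := level_below jx' yx jx.
have [z' z'x y'z'] := level_below jx' y'x jx.
rewrite (fp y z) // (fp y' z') //.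
have [rx|rx] := eqVneq (rk x) j.+2; first exact: step.
apply: (IH (rk x - j.+1)%N _ j.+1 (f \o p)) => //; try lia.
by move=> w /levelP[wx rw]; apply: step => //; apply: ltW.
Qed.

(** The band is one level, and reduced coboundaries of points are the constants. The element of rank
    0 belongs to no band, whence the condition [0 < j]. *)
Lemma coboundary_points x j (c : seq G -> F) :
  is_coboundary (rank_band x (j - 1) j) (1%N%:Z - 1) c <->
  ((0 < j)%N -> {in level x j &, forall y y', c [:: y] = c [:: y']}).
Proof.
have pt y : simplex (rank_band x (j - 1) j) (1%N%:Z - 1) [:: y] =
    (y \in level x j) && (0 < j)%N.
  rewrite /simplex /= subrK eqxx !andbT; apply/idP/idP => [/rank_bandP[yx]|].
    by move=> ly yj; rewrite inE yx /=; apply/andP; split; [apply/eqP|]; lia.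
  by move=> /andP[/levelP[yx ry] j0]; apply/rank_bandP; split=> //; lia.
split=> [[g gP] j0 y y' yx y'x|cE].
  by rewrite !gP ?pt ?yx ?y'x //= !coboundary_cons !coboundary_nil.
case: (posnP j) => [j0|j0].
  exists c => s sP; have := @rank_band_high _ _ hG x (j - 1) j (1%N%:Z - 1) s.
  by rewrite sP => /(_ ltac:(lia)).
case: (set_0Vmem (level x j)) => [E|[y yx]].
  exists c => -[/simplex_size//|y [|y' s] /[dup] sP /simplex_size //].
  by move: sP; rewrite pt E inE.
exists (fun=> c [:: y]) => -[/simplex_size//|y' [|z s] /[dup] sP /simplex_size //] _.
move: sP; rewrite pt => /andP[y'x _].
by rewrite coboundary_cons coboundary_nil subr0; apply: cE.
Qed.

Lemma uniform_detects : uniform G -> forall x j (c : seq G -> F), (j.+1 < rk x)%N ->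
  (forall z, z \in level x j.+1 ->
     is_coboundary (rank_band z (j - 1) j) (1%N%:Z - 1) c) ->
  is_coboundary (rank_band x (j - 1) j) (1%N%:Z - 1) c.
Proof.
move=> uG x j c jx cL; apply/coboundary_points => j0.
apply: (uniform_levels (f := fun y => c [:: y])) => // z /cL/coboundary_points; exact.
Qed.

(** Detection of 0-cochains is applied to the indicator of the elements of rank [j] lying below the
    class of [a]. It is constant below each [z] of rank [j.+1], hence constant, and so nonzero at an
    element below [b]. *)
Lemma detects_uniform : detects_coboundaries F G -> uniform G.
Proof.
move=> det; apply/uniform_simP => x a b x0; rewrite -(rk_gt0 hG) in x0.
case rx : (rk x) x0 => [//|[|j]] _.
  rewrite !(S1_rk rx) => /levelP[_ /eqP ra] /levelP[_ /eqP rb].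
  have bot (z : G) : rk z == 0%N -> z = \bot%O.
    by move=> z0; apply/eqP; move: z0; rewrite eqn0Ngt (rk_gt0 hG) negbK.
  by rewrite (bot a) // (bot b) // /sim connect0.
rewrite !(S1_rk rx) => ax bx.
have sim_step z z' y : z \in level x j.+1 -> z' \in level x j.+1 ->
    y \in level z j -> y \in level z' j -> sim x a z -> sim x a z'.
  move=> zx z'x yz yz' az; apply: connect_trans az (connect1 _).
  by apply/(meets_belowP _ _ rx); split=> //; exists y; rewrite inE yz.
have [_ ra] := levelP _ _ _ ax; have [_ rb] := levelP _ _ _ bx.
have [ya yaP] := @level_inhabited a j ltac:(lia).
have [yb ybP] := @level_inhabited b j ltac:(lia).
(* In rank 0 the band is empty and gives no information, but then [a] and [b] both lie above
   [\bot]. *)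
case: (posnP j) => [j0|j0].
  have bot (z y : G) : y \in level z j -> y = \bot%O.
    by move=> /levelP[_]; rewrite j0 => /eqP;
      rewrite eqn0Ngt (rk_gt0 hG) negbK => /eqP.
  apply: (sim_step a b ya) => //; last exact: connect0.
  by rewrite (bot _ _ yaP) -(bot _ _ ybP).
pose f y := [exists z in level x j.+1, sim x a z && (y \in level z j)].
pose c (s : seq G) : F := (f (head \bot%O s))%:R.
have /coboundary_points : is_coboundary (rank_band x (j - 1) j) (1%N%:Z - 1) c.
  apply: det => [|z zx]; first by rewrite rx.
  apply/coboundary_points => _ y y' yz y'z; rewrite /c /=; congr (nat_of_bool _)%:R.
  have fz w : w \in level z j -> f w = sim x a z.
    move=> wz; apply/idP/idP => [/exists_inP[z' z'x /andP[az' wz']]|az].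
      exact: (sim_step z' z w).
    by apply/exists_inP; exists z => //; rewrite az.
  by rewrite !fz.
move=> /(_ j0 ya yb) E.
have : f yb.
  have : f ya by apply/exists_inP; exists a => //; rewrite yaP /sim connect0.
  have /subsetP sa := level_trans j (proj1 (levelP _ _ _ ax)).
  have /subsetP sb := level_trans j (proj1 (levelP _ _ _ bx)).
  move: E => /(_ (sa _ yaP) (sb _ ybP)); rewrite /c /=.
  by case: (f ya); case: (f yb) => // /eqP; rewrite oner_eq0.
move=> /exists_inP[z zx /andP[az ybz]].
exact: (sim_step z b yb).
Qed.

End Uniform.

(** * Graded free modules and resolutions *)

Lemma big_uniq_widen (V : zmodType) (I : eqType) (s t : seq I) (f : I -> V) :
  uniq s -> uniq t -> {subset s <= t} -> (forall i, i \notin s -> f i = 0) ->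
  \sum_(i <- s) f i = \sum_(i <- t) f i.
Proof.
move=> us ut st f0; rewrite [RHS](bigID [in s]) /= [X in _ + X]big1 // addr0.
rewrite -[RHS]big_filter; apply: perm_big; apply: uniq_perm => // [|i].
  exact: filter_uniq.
by rewrite mem_filter /=; case: (boolP (i \in s)) => //= /st.
Qed.

Section Coordinates.
Context (F : fieldType) (A : algType F) (M : gfree_module A).
Implicit Types (u v : M) (i : gf_idx M) (s t : seq (gf_idx M)).
Local Notation e := (@gf_bas _ _ M).

Lemma gf_span_uniq v : exists sc : seq (gf_idx M) * (gf_idx M -> A),
  [/\ uniq sc.1, forall i, i \notin sc.1 -> sc.2 i = 0 &
      v = \sum_(i <- sc.1) sc.2 i *: e i].
Proof.
have [s [c ->]] := gf_span v.
exists (undup s, fun i => \sum_(j <- s | j == i) c j); split=> [|i|] /=.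
- exact: undup_uniq.
- rewrite mem_undup => si; rewrite big_seq_cond big1 // => j /andP[js /eqP ji].
  by rewrite -ji js in si.
under [RHS]eq_bigr do rewrite scaler_suml.
rewrite (exchange_big_dep xpredT) //= big_seq [RHS]big_seq; apply: eq_bigr => j js.
under eq_bigl do rewrite eq_sym.
by rewrite -big_filter filter_pred1_uniq ?undup_uniq ?mem_undup // big_seq1.
Qed.

(** The list depends on a chosen expansion and may contain indices with coefficient 0; the
    coordinates are canonical by [gcoord_unique]. *)
Definition supp v := (projT1 (cid (gf_span_uniq v))).1.
Definition gcoord v := (projT1 (cid (gf_span_uniq v))).2.

Lemma supp_uniq v : uniq (supp v).
Proof. by rewrite /supp; case: cid => sc []. Qed.

Lemma gcoord_out v i : i \notin supp v -> gcoord v i = 0.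
Proof. by rewrite /supp /gcoord; case: cid => sc [/= _ h _]; apply: h. Qed.

Lemma gcoordE v : v = \sum_(i <- supp v) gcoord v i *: e i.
Proof. by rewrite /supp /gcoord; case: cid => sc []. Qed.

Lemma gcoord_unique v s (c : gf_idx M -> A) : uniq s ->
  (forall i, i \notin s -> c i = 0) -> v = \sum_(i <- s) c i *: e i ->
  forall i, gcoord v i = c i.
Proof.
move=> us c0 vE; pose t := undup (s ++ supp v).
have vt1 : v = \sum_(i <- t) c i *: e i.
  rewrite [LHS]vE; apply: big_uniq_widen => //; first exact: undup_uniq.
    by move=> i si; rewrite mem_undup mem_cat si.
  by move=> i /c0->; rewrite scale0r.
have vt2 : v = \sum_(i <- t) gcoord v i *: e i.
  rewrite [LHS]gcoordE; apply: big_uniq_widen;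
    [exact: supp_uniq|exact: undup_uniq| |].
    by move=> i si; rewrite mem_undup mem_cat si orbT.
  by move=> i /gcoord_out->; rewrite scale0r.
have : \sum_(i <- t) (gcoord v i - c i) *: e i = 0.
  under eq_bigr do rewrite scalerBl.
  by rewrite sumrB -vt1 -vt2 subrr.
move=> /(gf_free (undup_uniq _)) E i; case: (boolP (i \in t)) => [/E/eqP|].
  by rewrite subr_eq0 => /eqP.
by rewrite mem_undup mem_cat negb_or => /andP[/c0-> /gcoord_out->].
Qed.

Lemma gcoord_expand v t : uniq t -> (forall i, i \notin t -> gcoord v i = 0) ->
  v = \sum_(i <- t) gcoord v i *: e i.
Proof.
move=> ut ct; pose w := undup (t ++ supp v).
rewrite [LHS]gcoordE (big_uniq_widen (t := w)); first last.
- by move=> i /gcoord_out->; rewrite scale0r.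
- by move=> i si; rewrite mem_undup mem_cat si orbT.
- exact: undup_uniq.
- exact: supp_uniq.
apply/esym/big_uniq_widen => //; first exact: undup_uniq.
  by move=> i si; rewrite mem_undup mem_cat si.
by move=> i /ct->; rewrite scale0r.
Qed.

Lemma gcoord_linear a u v i : gcoord (a *: u + v) i = a * gcoord u i + gcoord v i.
Proof.
move: i; apply: (gcoord_unique (undup_uniq (supp u ++ supp v))) => [i|].
  rewrite mem_undup mem_cat negb_or => /andP[/gcoord_out-> /gcoord_out->].
  by rewrite mulr0 addr0.
set t := undup _; under [RHS]eq_bigr do rewrite scalerDl -scalerA.
rewrite big_split -scaler_sumr; congr (_ *: _ + _).
  apply: gcoord_expand; first exact: undup_uniq.
  by move=> i; rewrite mem_undup mem_cat negb_or => /andP[/gcoord_out].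
apply: gcoord_expand; first exact: undup_uniq.
by move=> i; rewrite mem_undup mem_cat negb_or => /andP[_ /gcoord_out].
Qed.

Lemma gcoordD u v i : gcoord (u + v) i = gcoord u i + gcoord v i.
Proof. by rewrite -[u]scale1r gcoord_linear scale1r mul1r. Qed.

Lemma gcoord0 i : gcoord 0 i = 0.
Proof. by apply: (addIr (gcoord 0 i)); rewrite -gcoordD !add0r. Qed.

Lemma gcoordZ a u i : gcoord (a *: u) i = a * gcoord u i.
Proof. by rewrite -[a *: u]addr0 gcoord_linear gcoord0 addr0. Qed.

Lemma gcoordB u v i : gcoord (u - v) i = gcoord u i - gcoord v i.
Proof. by rewrite gcoordD -scaleN1r gcoordZ mulN1r. Qed.

Lemma gcoord_sum (I : Type) (r : seq I) (P : pred I) (f : I -> M) i :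
  gcoord (\sum_(j <- r | P j) f j) i = \sum_(j <- r | P j) gcoord (f j) i.
Proof. exact: (big_morph (fun v => gcoord v i) (fun u v => gcoordD u v i)
  (gcoord0 i)). Qed.

Lemma gcoord_bas i j : gcoord (e i) j = (i == j)%:R.
Proof.
move: j; apply: (@gcoord_unique _ [:: i]) => // [j|].
  by rewrite inE eq_sym => /negPf->.
by rewrite big_seq1 eqxx scale1r.
Qed.

Lemma gcoord_inj u v : (forall i, gcoord u i = gcoord v i) -> u = v.
Proof.
move=> uv; apply/eqP; rewrite -subr_eq0 [_ - _]gcoordE big1 // => i _.
by rewrite gcoordB uv subrr scale0r.
Qed.

Lemma gcoord_build s (c : gf_idx M -> A) : (forall i, i \notin s -> c i = 0) ->
  exists v, forall i, gcoord v i = c i.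
Proof.
move=> c0; exists (\sum_(i <- undup s) c i *: e i).
by apply: gcoord_unique (undup_uniq s) _ _ => // i; rewrite mem_undup; apply: c0.
Qed.

Section Extension.
Context (N : lmodType A) (g : gf_idx M -> N).

Definition gf_ext v : N := \sum_(i <- supp v) gcoord v i *: g i.

Lemma gf_extE v t : uniq t -> (forall i, i \notin t -> gcoord v i = 0) ->
  gf_ext v = \sum_(i <- t) gcoord v i *: g i.
Proof.
move=> ut ct; pose w := undup (t ++ supp v).
rewrite /gf_ext (big_uniq_widen (t := w)); first last.
- by move=> i /gcoord_out->; rewrite scale0r.
- by move=> i si; rewrite mem_undup mem_cat si orbT.
- exact: undup_uniq.
- exact: supp_uniq.
apply/esym/big_uniq_widen => //; first exact: undup_uniq.
  by move=> i si; rewrite mem_undup mem_cat si.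
by move=> i /ct->; rewrite scale0r.
Qed.

Lemma gf_ext_linear : linear gf_ext.
Proof.
move=> a u v; pose t := undup (supp u ++ supp v).
have out w i : i \notin t -> w = u \/ w = v -> gcoord w i = 0.
  by rewrite mem_undup mem_cat negb_or => /andP[iu iv] [->|->]; apply: gcoord_out.
have ut := undup_uniq (supp u ++ supp v).
rewrite !(gf_extE (t := t)) //; try by move=> i it; apply: out it _; auto.
  rewrite scaler_sumr -big_split; apply: eq_bigr => i _.
  by rewrite gcoord_linear scalerDl scalerA.
by move=> i it; rewrite gcoord_linear !(out _ _ it) ?mulr0 ?addr0; auto.
Qed.

HB.instance Definition _ := GRing.isLinear.Build A M N *:%R gf_ext gf_ext_linear.

Lemma gf_ext_bas i : gf_ext (e i) = g i.
Proof.
rewrite (@gf_extE _ [:: i]) //; first by rewrite big_seq1 gcoord_bas eqxx scale1r.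
by move=> j; rewrite inE gcoord_bas eq_sym => /negPf->.
Qed.

Lemma extend_basis : exists f : {linear M -> N}, forall i, f (e i) = g i.
Proof. by exists gf_ext; apply: gf_ext_bas. Qed.

End Extension.

Lemma linear_gcoord (N : lmodType A) (f : {linear M -> N}) v :
  f v = \sum_(i <- supp v) gcoord v i *: f (e i).
Proof.
by rewrite {1}[v]gcoordE linear_sum; apply: eq_bigr => i _; rewrite linearZ.
Qed.

End Coordinates.

Section Augmentation.
Context (F : fieldType) (A : algType F) (gr : nat -> A -> Prop) (pi : nat -> A -> A).
Hypothesis gA : connected_grading gr pi.
Implicit Types (a b : A) (c : F).

Lemma scalar_inj c c' : c%:A = c'%:A :> A -> c = c'.
Proof.
move=> /eqP; rewrite -subr_eq0 -scalerBl scaler_eq0 oner_eq0 orbF subr_eq0.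
by move/eqP.
Qed.

Lemma aug_exists a : exists c, pi 0 a = c%:A.
Proof. exact: (cg0 gA (gr_pi gA 0 a)). Qed.

Definition aug a : F := projT1 (cid (aug_exists a)).

Lemma augE a : pi 0 a = (aug a)%:A.
Proof. by rewrite /aug; case: cid. Qed.

Lemma augD a b : aug (a + b) = aug a + aug b.
Proof. by apply: scalar_inj; rewrite scalerDl -!augE (piD gA). Qed.

Lemma aug_scale c a : aug (c%:A * a) = c * aug a.
Proof. by apply: scalar_inj; rewrite -augE mulr_algl (cgZ gA) augE scalerA. Qed.

Lemma aug_scalar c : aug c%:A = c.
Proof. by apply: scalar_inj; rewrite -augE (pi_id gA (gr_scalar gA c)). Qed.

Lemma aug_eq0 a : pi 0 a = 0 -> aug a = 0.
Proof. by move=> a0; apply: scalar_inj; rewrite -augE a0 scale0r. Qed.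

Lemma aug_gr j a : gr j a -> (0 < j)%N -> aug a = 0.
Proof. by move=> ga j0; apply: aug_eq0; rewrite (pi_gr gA _ ga); case: j ga j0. Qed.

End Augmentation.

Section HomogeneousElements.
Context (F : fieldType) (A : algType F) (gr : nat -> A -> Prop) (pi : nat -> A -> A).
Hypothesis gA : connected_grading gr pi.
Context (M : gfree_module A).
Implicit Types (u v : M) (i : gf_idx M) (j k l m n : nat).
Local Notation e := (@gf_bas _ _ M).
Local Notation deg := (@gf_deg _ _ M).
Local Notation homog := (@homog _ _ gr M).

(** The guard is needed because the subtraction is truncated: a basis element of degree above [k]
    contributes nothing in degree [k]. *)
Definition gcoord_comp k v i : A :=
  if (deg i <= k)%N then pi (k - deg i) (gcoord v i) else 0.

Lemma homogP k v : homog k v <-> forall i, gcoord v i = gcoord_comp k v i.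
Proof.
split=> [[s [c [-> sc]]] i|h].
  rewrite /gcoord_comp gcoord_sum (pi_sum gA) big_seq [in RHS]big_seq.
  under eq_bigr do rewrite gcoordZ gcoord_bas.
  under [in RHS]eq_bigr do rewrite gcoordZ gcoord_bas.
  case: leqP => [ik|ki].
    apply: eq_bigr => j js; have [j' gj jk] := sc j js.
    case: eqP => [ji|_]; last by rewrite !mulr0 (pi0 gA).
    by rewrite mulr1 (pi_id gA) // -ji -jk addnK.
  rewrite big1 // => j js; have [j' _ jk] := sc j js.
  by case: eqP => [ji|_]; [move: ki; rewrite -ji -jk; lia|rewrite mulr0].
exists [seq i <- supp v | gcoord v i != 0], (gcoord v); split=> [|i].
  rewrite big_filter {1}[v]gcoordE [RHS]big_mkcond; apply: eq_bigr => i _.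
  by case: eqP => [->|] //; rewrite scale0r.
rewrite mem_filter => /andP[ci _]; move: ci; rewrite h /gcoord_comp.
case: leqP => [ik _|]; last by rewrite eqxx.
by exists (k - deg i)%N; [apply: gr_pi gA _ _|lia].
Qed.

Definition hcomp k v : M := \sum_(i <- supp v) gcoord_comp k v i *: e i.

Lemma gcoord_compE k v i : gcoord (hcomp k v) i = gcoord_comp k v i.
Proof.
move: i; apply: gcoord_unique (supp_uniq v) _ _ => // i /gcoord_out vi.
by rewrite /gcoord_comp vi (pi0 gA); case: ifP.
Qed.

Lemma hcomp_homog k v : homog k (hcomp k v).
Proof.
apply/homogP => i; rewrite /gcoord_comp gcoord_compE /gcoord_comp.
by case: ifP => // _; rewrite (cg_pi gA) eqxx.
Qed.

Lemma hcomp_id k v : homog k v -> hcomp k v = v.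
Proof. by move=> /homogP h; apply: gcoord_inj => i; rewrite gcoord_compE -h. Qed.

Lemma hcomp_neq j k v : homog j v -> j != k -> hcomp k v = 0.
Proof.
move=> /homogP h jk; apply: gcoord_inj => i;
  rewrite gcoord_compE gcoord0 /gcoord_comp h.
rewrite /gcoord_comp; case: leqP => // ik; case: leqP => [ij|];
  last by rewrite (pi0 gA).
by rewrite (cg_pi gA); case: eqP => //; lia.
Qed.

Lemma hcompD k u v : hcomp k (u + v) = hcomp k u + hcomp k v.
Proof.
apply: gcoord_inj => i; rewrite gcoordD !gcoord_compE /gcoord_comp gcoordD.
by case: ifP; rewrite ?addr0 // (piD gA).
Qed.

Lemma hcomp0 k : hcomp k 0 = 0.
Proof. by apply: (addIr (hcomp k 0)); rewrite -hcompD !add0r. Qed.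

Lemma hcomp_sum k (I : Type) (s : seq I) (P : pred I) (f : I -> M) :
  hcomp k (\sum_(i <- s | P i) f i) = \sum_(i <- s | P i) hcomp k (f i).
Proof. exact: (big_morph _ (hcompD k) (hcomp0 k)). Qed.

Lemma homog_decomp v : exists N, v = \sum_(k < N) hcomp k v.
Proof.
have bound i : exists N, forall N', (N <= N')%N ->
    gcoord v i = \sum_(k < N') gcoord_comp k v i.
  have [N vN] := cg_sum gA (gcoord v i); exists (deg i + N)%N => N' NN'.
  rewrite [LHS](vN (N' - deg i)%N); last lia.
  rewrite -[in RHS](@subnKC (deg i) N'); last lia.
  rewrite big_split_ord /= [X in _ = X + _]big1 ?add0r.
    by apply: eq_bigr => k _; rewrite /gcoord_comp leq_addr addKn.
  by move=> k _; rewrite /gcoord_comp leqNgt ltn_ord.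
have [N vN] : exists N, forall i, i \in supp v ->
  gcoord v i = \sum_(k < N) gcoord_comp k v i.
  suff [N vN] : exists N, forall N', (N <= N')%N -> forall i, i \in supp v ->
      gcoord v i = \sum_(k < N') gcoord_comp k v i by exists N; apply: vN.
  elim: (supp v) => [|i s [N1 IH]]; first by exists 0%N.
  have [N2 h] := bound i; exists (maxn N1 N2) => N';
    rewrite geq_max => /andP[h1 h2] i'.
  by rewrite inE => /orP[/eqP->|]; [apply: h|apply: IH].
exists N; apply: gcoord_inj => i; rewrite gcoord_sum.
under eq_bigr do rewrite gcoord_compE.
case: (boolP (i \in supp v)) => [/vN//|/gcoord_out vi].
by rewrite big1 ?vi // => k _; rewrite /gcoord_comp vi (pi0 gA); case: ifP.
Qed.

Lemma homog0 k : homog k 0.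
Proof. by rewrite -(hcomp0 k); apply: hcomp_homog. Qed.

Lemma homogD k u v : homog k u -> homog k v -> homog k (u + v).
Proof. by move=> /hcomp_id {1}<- /hcomp_id {1}<-; rewrite -hcompD;
  apply: hcomp_homog. Qed.

Lemma homog_sum k (I : Type) (s : seq I) (P : pred I) (f : I -> M) :
  (forall z, P z -> homog k (f z)) -> homog k (\sum_(j <- s | P j) f j).
Proof. by move=> h; elim/big_rec: _ => [|j x Pj hx]; [apply: homog0|apply: homogD;
  auto]. Qed.

Lemma homogZ j k a v : gr j a -> homog k v -> homog (j + k) (a *: v).
Proof.
move=> ga /homogP h; apply/homogP => i; rewrite /gcoord_comp gcoordZ h /gcoord_comp.
case: (leqP (deg i) k) => ik.
  by rewrite (piMl gA _ _ ga) !ifT ?(cg_pi gA) ?ifT //; try lia; rewrite eqnE; lia.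
by rewrite mulr0 (pi0 gA); case: ifP.
Qed.

Lemma homog_bas i : homog (deg i) (e i).
Proof.
apply/homogP => j; rewrite /gcoord_comp gcoord_bas; case: eqP => [->|_].
  by rewrite leqnn subnn (pi_id gA (cg1 gA)).
by rewrite (pi0 gA); case: ifP.
Qed.

End HomogeneousElements.

Section HomToF.
Context (F : fieldType) (A : algType F) (gr : nat -> A -> Prop) (pi : nat -> A -> A).
Hypothesis gA : connected_grading gr pi.
Local Notation aug := (aug gA).
Implicit Types (j k l m n : nat).

Section LinearToF.
Context (M : lmodType A) (f : M -> F).
Hypothesis f_lin : linear_to_F gr f.

Lemma linear_to_F_D u v : f (u + v) = f u + f v.
Proof. by have [h _] := f_lin; have := h 1 u v; rewrite scale1r scale1r mul1r. Qed.

Lemma linear_to_F_0 : f 0 = 0.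
Proof. by apply: (addIr (f 0)); rewrite -linear_to_F_D !add0r. Qed.

Lemma linear_to_F_sum (I : Type) (s : seq I) (P : pred I) (g : I -> M) :
  f (\sum_(i <- s | P i) g i) = \sum_(i <- s | P i) f (g i).
Proof. exact: (big_morph f linear_to_F_D linear_to_F_0). Qed.

Lemma linear_to_F_Z a v : f (a *: v) = aug a * f v.
Proof.
have [fc f0] := f_lin; have [N aN] := cg_sum gA a.
rewrite {1}(aN N.+1) ?leqnSn // big_ord_recl /= scalerDl (augE gA) fc.
rewrite scaler_suml linear_to_F_sum big1 ?addr0 // => i _.
by apply: f0 (gr_pi gA _ _).
Qed.

End LinearToF.

Context (M : gfree_module A).
Local Notation e := (@gf_bas _ _ M).
Local Notation deg := (@gf_deg _ _ M).

Lemma linear_to_F_coord (f : M -> F) v : linear_to_F gr f ->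
  f v = \sum_(i <- supp v) aug (gcoord v i) * f (e i).
Proof.
move=> fl; rewrite {1}[v]gcoordE (linear_to_F_sum fl); apply: eq_bigr => i _.
exact: linear_to_F_Z.
Qed.

Lemma linear_to_F_eq (f g : M -> F) : linear_to_F gr f -> linear_to_F gr g ->
  (forall i, f (e i) = g (e i)) -> forall v, f v = g v.
Proof.
move=> fl gl fg v; rewrite (linear_to_F_coord v fl) (linear_to_F_coord v gl).
by apply: eq_bigr => i _; rewrite fg.
Qed.

Lemma hom_to_F_build k (h : gf_idx M -> F) : (forall i, h i != 0 -> deg i = k) ->
  exists2 f : M -> F, hom_to_F gr k f & forall i, f (e i) = h i.
Proof.
move=> hk; have [p pE] := @extend_basis _ _ M A^o (fun i => (h i)%:A).
have fl : linear_to_F gr (fun v => aug (p v)).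
  split=> [c u v|j a v j0 ga].
    by rewrite linearP (augD gA); congr (_ + _); apply: (aug_scale gA).
  rewrite linearZ; apply: aug_eq0; rewrite (piMl gA _ _ ga).
  by case: j j0 ga.
have fE i : aug (p (e i)) = h i by rewrite pE (aug_scalar gA).
exists (fun v => aug (p v)) => //; split=> // j v /(homogP gA) hv jk.
rewrite (linear_to_F_coord v fl) big1 // => i _; rewrite fE.
have [->|/hk ik] := eqVneq (h i) 0; first by rewrite mulr0.
rewrite hv /gcoord_comp ik; case: leqP => kj; last first.
  by rewrite (aug_eq0 gA) ?mul0r // (pi0 gA).
rewrite (aug_gr gA (gr_pi gA _ _)) ?mul0r //.
by move/eqP: jk; lia.
Qed.

Lemma hom_to_F_bas k (f : M -> F) i : hom_to_F gr k f -> deg i != k -> f (e i) = 0.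
Proof. by move=> [_ h] ik; apply: h (homog_bas gA i) ik. Qed.

Lemma hom_to_F_D k (f g : M -> F) c : hom_to_F gr k f -> hom_to_F gr k g ->
  hom_to_F gr k (fun v => c * f v + g v).
Proof.
move=> [[f1 f2] f3] [[g1 g2] g3]; split; first split.
- by move=> d u v; rewrite f1 g1 !mulrDr addrACA (mulrCA c d) .
- by move=> j a v j0 ga; rewrite (f2 j) // (g2 j) // mulr0 addr0.
- by move=> j v hv jk; rewrite (f3 j) // (g3 j) // mulr0 addr0.
Qed.

Lemma hom_to_F_0 k : hom_to_F gr k (fun _ : M => 0 : F).
Proof. by split; [split=> // c u v; rewrite mulr0 addr0|]. Qed.

End HomToF.

Section Shift.
Context (F : fieldType) (A : algType F) (gr : nat -> A -> Prop) (pi : nat -> A -> A).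
Hypothesis gA : connected_grading gr pi.
Context (M N : gfree_module A).
Implicit Types (j k l m n : nat).
Local Notation e := (@gf_bas _ _ M).
Local Notation deg := (@gf_deg _ _ M).

(* Homomorphisms of internal degree -l. *)
Definition shift l (f : M -> N) : Prop :=
  (forall j v, homog gr (j + l) v -> homog gr j (f v)) /\
  (forall j v, (j < l)%N -> homog gr j v -> f v = 0).

Lemma shift_bas l (f : {linear M -> N}) :
  (forall i, (l <= deg i)%N -> homog gr (deg i - l) (f (e i))) ->
  (forall i, (deg i < l)%N -> f (e i) = 0) -> shift l f.
Proof.
move=> fl f0; split=> [j v /(homogP gA) hv|j v jl /(homogP gA) hv];
    rewrite linear_gcoord.
  apply: (homog_sum gA) => i _; have [il|li] := ltnP (deg i) l.
    by rewrite f0 // scaler0; exact: (homog0 gA).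
  rewrite hv /gcoord_comp; case: leqP => [ij|_]; last by rewrite scale0r;
    exact: (homog0 gA).
  have := homogZ gA (gr_pi gA (j + l - deg i) (gcoord v i)) (fl i li).
  by congr (homog _ _ _); lia.
rewrite big1 // => i _; rewrite hv /gcoord_comp; case: leqP => [ij|_];
  last exact: scale0r.
by rewrite f0 ?scaler0 //; lia.
Qed.

Lemma hcomp_linear (f : {linear M -> N}) k v :
  (forall j u, homog gr j u -> homog gr j (f u)) ->
  hcomp pi k (f v) = f (hcomp pi k v).
Proof.
move=> fh; have [n vn] := homog_decomp gA v.
rewrite [in LHS]vn linear_sum (hcomp_sum gA) [v in RHS]vn (hcomp_sum gA) linear_sum.
apply: eq_bigr => i _; have hi := hcomp_homog gA i v.
have [<-|ik] := eqVneq (i : nat) k.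
  by rewrite (hcomp_id gA hi) (hcomp_id gA) //; apply: fh.
by rewrite (hcomp_neq gA hi ik) linear0 (hcomp_neq gA (fh _ _ hi) ik).
Qed.

End Shift.

(** * Lifting along a resolution and Yoneda products *)

Section Resolution.
Context (F : fieldType) (A : algType F) (gr : nat -> A -> Prop) (pi : nat -> A -> A).
Hypothesis gA : connected_grading gr pi.
Context (P : gfree_resolution gr).
Implicit Types (j k l m n : nat).

Definition is_cycle n : P n -> Prop :=
  match n with
  | 0 => fun v => res_eps v = 0
  | n'.+1 => fun v => res_d P n' v = 0
  end.
Arguments is_cycle : clear implicits.

Lemma is_cycleP n v : is_cycle n v <-> exists u, v = res_d P n u.
Proof. by case: n v => [|n] v; [apply: res_exact0|apply: res_exactS]. Qed.

Lemma is_cycle_d n u : is_cycle n (res_d P n u).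
Proof. by apply/is_cycleP; exists u. Qed.

Lemma d_hcomp n k (v : P n.+1) :
  hcomp pi k (res_d P n v) = res_d P n (hcomp pi k v).
Proof. by apply: (hcomp_linear gA) => j u; apply: res_d_homog. Qed.

Lemma eps_linear : linear_to_F gr (@res_eps _ _ _ P).
Proof. by have [] := res_eps_hom P. Qed.

(** Projectivity in graded form: preimages are chosen on the basis, and their component of the right
    degree is again a preimage because the differential preserves degrees. *)
Lemma res_lift (M : gfree_module A) n l (f : {linear M -> P n}) :
  shift gr l f -> (forall v, is_cycle n (f v)) ->
  exists g : {linear M -> P n.+1}, shift gr l g /\ forall v, res_d P n (g v) = f v.
Proof.
move=> [fl f0] fc.
have /choice[h hP] : forall i : gf_idx M, exists w : P n.+1,
    [/\ (l <= gf_deg i)%N -> homog gr (gf_deg i - l) w,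
        (gf_deg i < l)%N -> w = 0 & res_d P n w = f (gf_bas i)].
  move=> i; have hi := homog_bas gA i; have [il|li] := ltnP (gf_deg i) l.
    by exists 0; split=> //; rewrite linear0 (f0 _ _ il hi).
  have [u uE] := (is_cycleP _).1 (fc (gf_bas i)).
  exists (hcomp pi (gf_deg i - l) u); split; [by move=> _;
    apply: hcomp_homog|by move=> il; move: li; lia|].
  rewrite -d_hcomp -uE (hcomp_id gA) //; apply: fl; by rewrite subnK.
have [g gE] := extend_basis h; exists g; split.
  by apply: (shift_bas gA) => i il; rewrite gE; have [h1 h2 _] := hP i; auto.
move=> v; rewrite (linear_gcoord g) (linear_gcoord f) linear_sum;
  apply: eq_bigr => i _.
by rewrite linearZ gE; have [_ _ ->] := hP i.
Qed.

Lemma eps_unit : exists2 v : P 0, homog gr 0 v & res_eps v = 1.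
Proof.
have [v vE] := res_eps_surj P 1; exists (hcomp pi 0 v); first exact: hcomp_homog.
have [N vN] := homog_decomp gA v; rewrite -vE.
have : res_eps v = \sum_(k < N) res_eps (hcomp pi k v).
  by rewrite {1}vN (linear_to_F_sum eps_linear).
case: N vN => [vN|N vN].
  rewrite big_ord0 => v0; move: vE; rewrite v0 => /esym/eqP.
  by rewrite oner_eq0.
rewrite big_ord_recl [X in _ + X]big1 ?addr0 => // i _.
by have [_ h] := res_eps_hom P; apply: (h _ _ (hcomp_homog gA _ _)).
Qed.

Lemma lift_to_P0 (M : gfree_module A) l (g : M -> F) : hom_to_F gr l g ->
  exists f : {linear M -> P 0}, shift gr l f /\ forall v, res_eps (f v) = g v.
Proof.
move=> gh; have [v0 hv0 v01] := eps_unit.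
have [f fE] := extend_basis (fun i : gf_idx M => (g (gf_bas i))%:A *: v0).
exists f; split.
  apply: (shift_bas gA) => i il; rewrite fE.
    have [<-|ne] := eqVneq (gf_deg i) l.
      by rewrite subnn; apply: (homogZ gA (gr_scalar gA _) hv0).
    by rewrite (hom_to_F_bas gA gh ne) scale0r scale0r; apply: homog0 gA _ _.
  by rewrite (hom_to_F_bas gA gh) ?scale0r ?scale0r // neq_ltn il.
apply: (linear_to_F_eq gA).
- have [e1 e2] := eps_linear; split=> [c u v|j a v j0 ga].
    by rewrite linearP e1.
  by rewrite linearZ (e2 j).
- by have [] := gh.
- by move=> i; rewrite fE (linear_to_F_Z gA eps_linear) (aug_scalar gA) v01 mulr1.
Qed.

Lemma hom_comp_shift (M : gfree_module A) n k l (f : P n -> F) (h : {linear M ->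
  P n}) :
  hom_to_F gr k f -> shift gr l h -> hom_to_F gr (k + l) (fun v => f (h v)).
Proof.
move=> [[f1 f2] f3] [h1 h2]; split; first split.
- by move=> c u v; rewrite linearP f1.
- by move=> j a v j0 ga; rewrite linearZ (f2 j).
move=> j v hv jkl; have [jl|lj] := ltnP j l.
  by rewrite (h2 _ _ jl hv) (linear_to_F_0 (conj f1 f2)).
apply: (f3 (j - l)%N); last lia.
by apply: h1; rewrite subnK.
Qed.

Lemma chain_lift_shift n l g phi i : @chain_lift _ _ _ P n l g phi ->
  shift gr l (phi i).
Proof. by case=> _ _ h1 h2; split=> [j v|j v]; [apply: h1|apply: h2]. Qed.

(* If g has a lift [psi] to P_0 that vanishes on boundaries, as a coboundary g
   does, then [phi] is homotopic to the extension of [psi] by 0. *)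
Lemma chain_lift_null n l (g : P n -> F) phi (psi : {linear P n -> P 0}) :
  @chain_lift _ _ _ P n l g phi -> shift gr l psi ->
  (forall v, res_eps (psi v) = g v) -> (forall v, psi (res_d P n v) = 0) ->
  forall i, exists h : {linear P (i + n)%N -> P i.+1},
    shift gr l h /\
    forall v : P (i.+1 + n)%N,
      res_d P i (phi i.+1 v) = res_d P i (h (res_d P (i + n) v)).
Proof.
move=> pl sl pg pd; have [e0 cm _ _] := pl.
have sphi i := chain_lift_shift i pl.
elim=> [|i [h [sh hE]]].
  pose f : {linear P n -> P 0} := (phi 0%N \- psi)%R : {linear _ -> _}.
  have [||h [sh hE]] := @res_lift (P n) 0 l f.
  - have [s1 s2] := sphi 0%N; have [t1 t2] := sl; split=> [j v hv|j v jl hv] /=.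
      rewrite -scaleN1r; apply: (homogD gA); first exact: s1.
      rewrite scaleN1r -scaleN1r; apply: (homogZ (j := 0%N) gA); last exact: t1.
      by rewrite -scaleN1r; apply: gr_scalar gA _.
    by rewrite (s2 j) // (t2 j) // subr0.
  - move=> v; rewrite /is_cycle /f /=.
    rewrite (linear_to_F_D eps_linear) e0 -scaleN1r (linear_to_F_Z gA eps_linear) pg.
    by rewrite -scaleN1r (aug_scalar gA) mulN1r subrr.
  exists h; split=> // v; rewrite cm hE /f /= pd subr0 //.
pose f : {linear P (i.+1 + n)%N ->
  P i.+1} := (phi i.+1 \- (h \o res_d P (i + n)))%R : {linear _ -> _}.
have [||h' [sh' hE']] := @res_lift (P (i.+1 + n)%N) i.+1 l f.
- have [s1 s2] := sphi i.+1; have [t1 t2] := sh; split=> [j v hv|j v jl hv] /=.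
    apply: (homogD gA); first exact: s1.
    rewrite -scaleN1r; apply: (homogZ (j := 0%N) gA); last by apply: t1;
      apply: res_d_homog.
    by rewrite -scaleN1r; apply: gr_scalar gA _.
  by rewrite (s2 j) // (t2 j) ?subr0 //; apply: res_d_homog.
- by move=> v; rewrite /is_cycle /f /= linearB /= hE subrr.
exists h'; split=> // v; rewrite cm hE' /f /=.
have -> : res_d P (i + n) (res_d P (i.+1 + n) v) = 0 by apply:
  (is_cycle_d (n := (i + n).+1)).
by rewrite linear0 subr0.
Qed.

(** [Ext^{1,1}] is on the diagonal, and a product off the diagonal has a factor off the diagonal,
    which is a coboundary by induction. The work is to see that such a product is a coboundary for
    the given lift [phi]. *)
Lemma generated_cocycle n k f : @generated_by_Ext11 _ _ _ P n k f ->
  ext_cocycle k f /\ (n != k -> ext_coboundary k f).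
Proof.
elim=> {n k f}.
- move=> n k f cf; split=> //; case: n f cf => [|n] f /= cf.
    split=> [|v]; last exact: cf.
    by split; [split=> [c u v|j a v _ _]|move=> j v _ _]; rewrite !cf ?mulr0 ?addr0.
  have [g gh fg] := cf; split; first split.
  - have [[g1 g2] _] := gh; split=> [c u v|j a v j0 ga].
      by rewrite !fg linearP g1.
    by rewrite fg linearZ (g2 j).
  - move=> j v hv jk; rewrite fg; have [_ g3] := gh.
    by apply: (g3 j) jk; apply: res_d_homog.
  - move=> v; rewrite fg.
    have -> : res_d P n (res_d P n.+1 v) = 0 by apply: (is_cycle_d (n := n.+1)).
    by rewrite (linear_to_F_0 (proj1 gh)).
- split=> //; split; first exact: res_eps_hom.
  by move=> v; apply: (is_cycle_d (n := 0)).
- by move=> f cf; split.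
- move=> n k c f g h _ [[fh fd] fc] _ [[gh gd] gc] hE; split.
    split=> [|v]; last by rewrite hE fd gd mulr0 addr0.
    have [[h1 h2] h3] := hom_to_F_D c fh gh.
    split; [split=> [c' u v|j a v j0 ga]|move=> j v hv jk].
    + by rewrite !hE h1.
    + by rewrite hE (h2 j).
    + by rewrite hE (h3 j).
  move=> nk; move: (fc nk) (gc nk);
    case: n f g h {nk fh fd fc gh gd gc} hE => [|n] f g h hE /=.
    by move=> f0 g0 v; rewrite hE f0 g0 mulr0 addr0.
  move=> [f' fh' fE] [g' gh' gE]; exists (fun v => c * f' v + g' v).
    exact: hom_to_F_D.
  by move=> v; rewrite hE fE gE.
move=> m k n l f g phi h _ [[fh fd] fc] _ [[gh gd] gc] pl hE.
have [e0 cm _ _] := pl; have sphi i := chain_lift_shift i pl.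
have hh : hom_to_F gr (k + l) h.
  have [[h1 h2] h3] := hom_comp_shift fh (sphi m).
  split; [split=> [c' u v|j a v j0 ga]|move=> j v hv jk].
  - by rewrite !hE h1.
  - by rewrite hE (h2 j).
  - by rewrite hE (h3 j).
split=> [|mnkl].
  by split=> // v; rewrite hE -(cm m) fd.
(* If the left factor is [f' \o d], commuting [phi] with the differential bounds the product by
   [f' \o phi]. *)
have [mk|mk] := eqVneq m k; last first.
  move: (fc mk); case: m f h phi hE {fh fd fc mk mnkl} pl e0 cm sphi hh => [|m] f h
    phi hE pl e0 cm sphi hh /=.
    move=> f0; case: n g phi h hE {pl e0 cm sphi hh gh gd gc}=> [|n] g phi h hE /=.
      by move=> v; rewrite hE f0.
    exists (fun _ => 0); first exact: hom_to_F_0.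
    by move=> v; rewrite hE f0.
  move=> [f' fh' fE]; exists (fun v => f' (phi m v)).
    exact: hom_comp_shift.
  by move=> v; rewrite hE fE cm.
have nl : n != l by move: mnkl; rewrite mk eqn_add2l.
(* If the right factor is [g' \o d], a lift of [g'] to [P 0] composed with [d] is a lift [psi] of
   [g] that vanishes on boundaries. The last clause settles the case where the left factor has
   cohomological degree 0. *)
have [psi [spsi psig psid psif]] : exists psi : {linear P n -> P 0},
    [/\ shift gr l psi, forall v, res_eps (psi v) = g v,
        forall v, psi (res_d P n v) = 0 &
        forall f0 : P 0 -> F, hom_to_F gr k f0 ->
          ext_coboundary (k + l) (fun v => f0 (psi v))].
  move: (gc nl); case: n g phi h hE {pl e0 cm sphi hh gh gd gc nl mnkl}=> [|n] g phi
    h hE /=.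
    move=> g0; exists (\0 : {linear P 0 -> P 0}); split=> //.
    - by split=> // j v _; apply: homog0 gA _ _.
    - by move=> v; rewrite g0 (linear_to_F_0 eps_linear).
    - by move=> f0 fh0 v; rewrite /= (linear_to_F_0 (proj1 fh0)).
  move=> [g' gh' gE]; have [h0 [sh0 h0E]] := lift_to_P0 gh'.
  exists (h0 \o res_d P n); split=> /=.
  - have [s1 s2] := sh0; split=> [j v hv|j v jl hv] /=.
      by apply: s1; apply: res_d_homog.
    by apply: (s2 j) => //; apply: res_d_homog.
  - by move=> v; rewrite h0E gE.
  - move=> v; have -> : res_d P n (res_d P n.+1 v) = 0 by apply:
    (is_cycle_d (n := n.+1)).
    exact: linear0.
  - by move=> f0 fh0; exists (fun v => f0 (h0 v)) => //; apply: hom_comp_shift sh0.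
have null := chain_lift_null pl spsi psig psid.
case: m f h hE mk mnkl fh fd fc hh => [|m] f h hE mk mnkl fh fd fc hh.
  have E v : f (phi 0%N v) = f (psi v).
    have [u uE] : exists u, phi 0%N v - psi v = res_d P 0 u.
      apply/(is_cycleP (n := 0)); rewrite /is_cycle (linear_to_F_D eps_linear) e0.
      by rewrite -scaleN1r (linear_to_F_Z gA eps_linear)
        psig -scaleN1r (aug_scalar gA) mulN1r subrr.
    by rewrite -[phi 0%N v](subrK (psi v)) uE (linear_to_F_D (proj1 fh)) fd add0r.
  move: (psif f fh); case: n g phi h psi {gh gd gc pl e0 cm sphi nl spsi psig psid
    psif null hh mnkl} hE E
    => [|n] g phi h psi hE E /=.
    by move=> h0 v; rewrite hE E h0.
  by move=> [h' hh' hE']; exists h' => // v; rewrite hE E hE'.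
(* [phi m.+1] and [h0 \o d] differ by boundaries, which the cocycle [f] kills; so [f \o h0] bounds
   the product. *)
have [h0 [sh0 hE0]] := null m.
exists (fun v => f (h0 v)); first exact: hom_comp_shift sh0.
move=> v; rewrite hE; apply/eqP; rewrite -subr_eq0; apply/eqP.
have [u uE] : exists u, phi m.+1 v - h0 (res_d P (m + n) v) = res_d P m.+1 u.
  by apply/(is_cycleP (n := m.+1)); rewrite /is_cycle linearB /= hE0 subrr.
rewrite -[RHS](fd u) -uE (linear_to_F_D (proj1 fh)); congr (_ + _).
rewrite -[RHS]mulr1 -scaleN1r (linear_to_F_Z gA (proj1 fh)).
by rewrite -scaleN1r (aug_scalar gA) mulN1r mulr1.
Qed.

End Resolution.

(** * Koszul algebras have level ideals as annihilators *)

Section SeparatingFunctional.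
Context (F : fieldType) (A : algType F) (V : lmodType A).
Implicit Types (u v w x : V) (c : F).

Definition F_subspace (U : V -> Prop) := U 0 /\ forall c u w, U u -> U w ->
  U (c%:A *: u + w).

Lemma F_subspaceD U u w : F_subspace U -> U u -> U w -> U (u + w).
Proof. by move=> [_ h] Uu Uw; have := h 1 _ _ Uu Uw; rewrite scale1r scale1r. Qed.

Lemma F_subspaceZ U c u : F_subspace U -> U u -> U (c%:A *: u).
Proof. by move=> [U0 h] Uu; rewrite -[_ *: u]addr0; apply: h. Qed.

Lemma F_subspaceB U u w : F_subspace U -> U u -> U w -> U (u - w).
Proof.
move=> sU Uu Uw; apply: F_subspaceD => //.
by rewrite -scaleN1r -[- 1]scaleN1r; exact: (F_subspaceZ (-1) sU Uw).
Qed.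

(** A subspace that contains W and is maximal among those avoiding [v] has codimension one; [f] is
    the coordinate along [v]. *)
Lemma separating_functional (W : V -> Prop) v : F_subspace W -> ~ W v ->
  exists f : V -> F, [/\ forall c u w, f (c%:A *: u + w) = c * f u + f w,
                         forall w, W w -> f w = 0 & f v = 1].
Proof.
move=> sW Wv.
pose T := {U : V -> Prop | [/\ F_subspace U, forall w, W w -> U w & ~ U v]}.
pose R (U1 U2 : T) := `[< forall w, sval U1 w -> sval U2 w >].
have W0 : [/\ F_subspace W, forall w, W w -> W w & ~ W v] by split.
have [||||[U [sU WU Uv]] Umax] := @classical_sets.Zorn T R.
- by move=> U; apply/asboolP.
- by move=> U1 U2 U3 /asboolP h1 /asboolP h2; apply/asboolP => w /h1/h2.
- move=> [U1 P1] [U2 P2] /asboolP h1 /asboolP h2; apply: eq_exist; apply: funext => w.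
  by apply: propext; split; [apply: h1|apply: h2].
- move=> C Ctot; case: (pselect (exists U0 : T, C U0)) => [[U0 CU0]|nC]; last first.
    by exists (exist _ W W0) => U1 CU; case: nC; exists U1.
  pose U w := exists2 U1 : T, C U1 & sval U1 w.
  have sU : F_subspace U.
    split; first by exists U0 => //; have [[]] := svalP U0.
    move=> c u w [U1 CU1 Uu] [U2 CU2 Uw].
    have [/asboolP h|/asboolP h] := Ctot _ _ CU1 CU2.
      by exists U2 => //; have [[_ hU2] _ _] := svalP U2; apply: hU2 => //; apply: h.
    by exists U1 => //; have [[_ hU1] _ _] := svalP U1; apply: hU1 => //; apply: h.
  have UP : [/\ F_subspace U, forall w, W w -> U w & ~ U v].
    split=> // [w Ww|[U1 _]]; last by have [_ _] := svalP U1.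
    by exists U0 => //; have [_ h _] := svalP U0; apply: h.
  by exists (exist _ U UP) => U1 CU1; apply/asboolP => w Uw; exists U1.
(* Otherwise adjoining [x] to [U] would still avoid [v], against maximality. *)
have coef x : exists c, U (x - c%:A *: v).
  apply: contrapT => nx.
  pose U' w := exists c, U (w - c%:A *: x).
  have sU' : F_subspace U'.
    split; first by exists 0; rewrite scale0r scale0r subr0; exact: sU.1.
    move=> c u w [d Ud] [d' Ud']; exists (c * d + d').
    have := sU.2 c _ _ Ud Ud'; congr U.
    by rewrite scalerBr !scalerDl opprD addrACA scalerA mulr_algl scalerA.
  have U'v : ~ U' v.
    move=> [d Ud]; have [d0|d0] := eqVneq d 0.
      by move: Ud; rewrite d0 scale0r scale0r subr0.
    apply: nx; exists d^-1; have := F_subspaceZ (- d^-1) sU Ud; congr U.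
    rewrite scalerBr !scalerA !mulr_algl !scalerA mulNr mulVf // scaleN1r scaleN1r
      opprK.
    by rewrite scaleNr scaleNr addrC.
  have UU' w : U w -> U' w by move=> Uw; exists 0; rewrite scale0r scale0r subr0.
  have U'P : [/\ F_subspace U', forall w, W w -> U' w & ~ U' v].
    by split=> // w /WU/UU'.
  have /(congr1 sval) /= E := Umax (exist _ U' U'P) (asboolT UU').
  apply: nx; exists 0; rewrite scale0r scale0r subr0 -[U]E.
  by exists 1; rewrite scale1r scale1r subrr; exact: sU.1.
have /choice[f fP] := coef.
have f_uniq x c : U (x - c%:A *: v) -> f x = c.
  move=> Uc; apply: contrapT => fc; apply: (Uv : ~ _); move/eqP in fc.
  have := F_subspaceB sU Uc (fP x);
    rewrite opprB addrC addrA subrK -scalerBl -scalerBl.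
  move=> /(F_subspaceZ (f x - c)^-1 sU).
  by rewrite scalerA mulr_algl scalerA mulVf ?subr_eq0 // scale1r scale1r.
exists f; split=> [c u w|w Ww|].
- apply: f_uniq; have := sU.2 c _ _ (fP u) (fP w); congr U.
  by rewrite scalerBr !scalerDl opprD addrACA scalerA mulr_algl scalerA.
- by apply: f_uniq; rewrite scale0r scale0r subr0; exact: (WU _ Ww).
- by apply: f_uniq; rewrite scale1r scale1r subrr; exact: sU.1.
Qed.

End SeparatingFunctional.

(** * Tor of right ideals in linear degrees *)

Section LinearTor.
Context (F : fieldType) (A : algType F) (gr : nat -> A -> Prop) (pi : nat -> A -> A).
Hypothesis gA : connected_grading gr pi.
Context (P : gfree_resolution gr).
Hypothesis ext_diagonal : forall n k (f : P n -> F), n != k ->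
  ext_cocycle k f -> ext_coboundary k f.
Implicit Types (j k l m n : nat) (a b t : A).

(** Unlike in [is_cycle], the augmentation is left out: Tor is the homology of the unaugmented
    complex, where everything in position 0 is a cycle. *)
Definition d_closed n : P n -> Prop :=
  match n with 0 => fun=> True | n'.+1 => fun v => res_d P n' v = 0 end.

Section Multiples.
Context (M : A -> Prop).

(* The submodule M P_n of P_n, for a right ideal M. *)
Definition in_mult n (v : P n) : Prop := forall i, M (gcoord v i).

Definition right_ideal : Prop :=
  [/\ M 0, forall a b, M a -> M b -> M (a + b) & forall a b, M a -> M (a * b)].

(* Tor_n(M, F) lives in degree n + 1. *)
Definition linear_tor : Prop := forall n m (z : P n), m != n.+1 ->
  homog gr m z -> in_mult z -> d_closed z ->
  exists2 w : P n.+1, in_mult w & z = res_d P n w.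

Hypothesis MI : right_ideal.

Lemma right_ideal_sum (I : Type) (s : seq I) (Q : pred I) (f : I -> A) :
  (forall i, Q i -> M (f i)) -> M (\sum_(i <- s | Q i) f i).
Proof. by move=> h; have [? ? _] := MI; elim/big_rec: _ => [//|i x Qi]; auto. Qed.

Lemma right_idealN a : M a -> M (- a).
Proof. by move=> Ma; have [_ _ h] := MI; rewrite -mulrN1; apply: h. Qed.

Lemma gcoord_d n (w : P n.+1) i : gcoord (res_d P n w) i =
  \sum_(j <- supp w) gcoord w j * gcoord (res_d P n (gf_bas j)) i.
Proof.
by rewrite linear_gcoord gcoord_sum; apply: eq_bigr => j _; rewrite gcoordZ.
Qed.

Lemma in_mult_d n (w : P n.+1) : in_mult w -> in_mult (res_d P n w).
Proof.
move=> wM i; rewrite gcoord_d; apply: right_ideal_sum => j _.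
by have [_ _ h] := MI; apply: h.
Qed.

Lemma in_multD n (v w : P n) : in_mult v -> in_mult w -> in_mult (v + w).
Proof. by move=> vM wM i; rewrite gcoordD; have [_ h _] := MI; apply: h. Qed.

Lemma in_multB n (v w : P n) : in_mult v -> in_mult w -> in_mult (v - w).
Proof.
move=> vM wM i; rewrite gcoordB; have [_ h _] := MI; apply: h => //.
exact: right_idealN.
Qed.

End Multiples.

Definition irrelevant a : Prop := pi 0 a = 0.

Lemma irrelevant_ideal : right_ideal irrelevant.
Proof.
split=> [|a b a0 b0|a b a0]; rewrite /irrelevant; first exact: (pi0 gA).
  by rewrite (piD gA) a0 b0 addr0.
have [N aN] := cg_sum gA a; rewrite (aN N) // mulr_suml (pi_sum gA) big1 // => i _.
rewrite (piMl gA _ _ (gr_pi gA i a)); case: i => -[|i] iN //=.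
by rewrite a0 mul0r.
Qed.

Lemma irrelevantMl j a b : gr j a -> (0 < j)%N -> irrelevant (a * b).
Proof. by move=> ga j0; rewrite /irrelevant (piMl gA _ _ ga); case: j j0 ga. Qed.

Lemma irrelevant_hom k (M : gfree_module A) (f : M -> F) v : hom_to_F gr k f ->
  (forall i, irrelevant (gcoord v i)) -> f v = 0.
Proof.
move=> [fl _] v0; rewrite (linear_to_F_coord gA v fl) big1 // => i _.
by rewrite (aug_eq0 gA (v0 i)) mul0r.
Qed.

(* Tor_n(F, F) lives in degree n. *)
Lemma tor_diagonal n k (v : P n) : n != k -> homog gr k v ->
  (match n return P n -> Prop with
   | 0 => fun=> True | n'.+1 => fun v => in_mult irrelevant (res_d P n' v) end) v ->
  exists u r, v = res_d P n u + r /\ in_mult irrelevant r.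
Proof.
move=> nk hv dv.
(* A functional that vanishes on [W] kills boundaries and irrelevant multiples and lives in degree
   [k], so it is a cocycle. By [ext_diagonal] it factors through the differential, hence vanishes at
   [v]; so no functional separates [v] from [W]. *)
pose W (w : P n) := exists u r h,
  [/\ w = res_d P n u + r + h, in_mult irrelevant r & hcomp pi k h = 0].
have irrZ c (r : P n) : in_mult irrelevant r -> in_mult irrelevant (c%:A *: r).
  move=> r0 i; rewrite gcoordZ /irrelevant (piMl gA _ _ (gr_scalar gA c)) /=.
  by rewrite r0 mulr0.
have compZ c (h : P n) : hcomp pi k (c%:A *: h) = c%:A *: hcomp pi k h.
  apply: gcoord_inj => i; rewrite gcoordZ !(gcoord_compE gA) /gcoord_comp gcoordZ.
  by case: ifP; rewrite ?mulr0 // (piMl gA _ _ (gr_scalar gA c)) /= subn0.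
have sW : F_subspace W.
  split.
    exists 0, 0, 0; split; first by rewrite linear0 !addr0.
      by move=> i; rewrite gcoord0; exact: (pi0 gA).
    exact: (hcomp0 gA).
  move=> c _ _ [u [r [h [-> r0 h0]]]] [u' [r' [h' [-> r0' h0']]]].
  exists (c%:A *: u + u'), (c%:A *: r + r'), (c%:A *: h + h'); split.
  - by rewrite linearP !scalerDr addrACA [X in X + _]addrACA.
  - by apply: in_multD irrelevant_ideal _ _ _ _ _ => //; apply: irrZ.
  - by rewrite (hcompD gA) compZ h0 h0' scaler0 addr0.
have [[u [r [h [vE r0 h0]]]]|nW] := pselect (W v).
  exists (hcomp pi k u), (hcomp pi k r); split.
    by rewrite -(d_hcomp gA) -(hcompD gA) -[RHS]addr0 -h0 -(hcompD gA)
      -vE (hcomp_id gA).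
  move=> i; rewrite (gcoord_compE gA) /irrelevant /gcoord_comp.
  case: ifP => // _; rewrite ?(pi0 gA) // (cg_pi gA).
  by case: eqP => // <-; apply: r0.
have [f [fl fW fv]] := separating_functional sW nW.
have fh : hom_to_F gr k f.
  split; first split=> // j a w j0 ga.
    apply: fW; exists 0, (a *: w), 0; split; first by rewrite linear0 add0r addr0.
      by move=> i; rewrite gcoordZ; apply: irrelevantMl ga j0.
    exact: (hcomp0 gA).
  move=> j w hw jk; apply: fW; exists 0, 0, w; split; first by rewrite linear0 !add0r.
    by move=> i; rewrite gcoord0; exact: (pi0 gA).
  exact: (hcomp_neq gA hw jk).
have fd u : f (res_d P n u) = 0.
  apply: fW; exists u, 0, 0; split; first by rewrite !addr0.
    by move=> i; rewrite gcoord0; exact: (pi0 gA).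
  exact: (hcomp0 gA).
have := ext_diagonal nk (conj fh fd).
case: n v dv f fh fv {nk hv W irrZ compZ sW nW fl fW fd} => [|n] v dv f fh fv /=.
  by move=> /(_ v); rewrite fv => /eqP; rewrite oner_eq0.
move=> [g gh /(_ v)]; rewrite fv (irrelevant_hom gh dv) => /eqP.
by rewrite oner_eq0.
Qed.

Lemma cycle_irrelevant (M : A -> Prop) n (z : P n) : (forall a, M a ->
  irrelevant a) ->
  in_mult M z -> d_closed z -> exists u, z = res_d P n u.
Proof.
move=> M0 zM zc; apply/is_cycleP; case: n z zM zc => [|n] z zM zc //.
by apply: irrelevant_hom (res_eps_hom P) _ => i; apply/M0/zM.
Qed.

(** Dimension shift: [Tor_n(R_+, F)] is [Tor_{n+1}(F, F)]. A primitive of [z] in [P n.+1] can be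
    moved by a boundary into the irrelevant multiples. *)
Lemma linear_tor_irrelevant : linear_tor irrelevant.
Proof.
move=> n m z nm hz z0 zc.
have [w0 w0E] : exists w, z = res_d P n w by apply:
  (cycle_irrelevant (M := irrelevant)).
pose w := hcomp pi m w0.
have wE : z = res_d P n w by rewrite -(d_hcomp gA) -w0E (hcomp_id gA).
have [|||u [r [wE' r0]]] := @tor_diagonal n.+1 m w.
- by rewrite eq_sym.
- exact: hcomp_homog.
- by rewrite -wE.
exists r => //; rewrite wE wE' linearD.
have -> : res_d P n (res_d P n.+1 u) = 0 by apply: (is_cycle_d (n := n.+1)).
by rewrite add0r.
Qed.

Lemma linear_tor_summand (M M1 M2 : A -> Prop) :
  right_ideal M1 -> right_ideal M2 -> (forall a, M1 a -> M a) ->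
  (forall a, M a -> exists b c, [/\ M1 b, M2 c & a = b + c]) ->
  (forall a, M1 a -> M2 a -> a = 0) -> linear_tor M -> linear_tor M1.
Proof.
move=> MI1 MI2 M1M split M12 lin n m z nm hz z1 zc.
have [|w wM wE] := lin n m z nm hz _ zc; first by move=> i; apply/M1M/z1.
(* Outside [supp w] both parts are forced to be 0, so that the families of parts are vectors of the
   free module. *)
have /choice[bc bcP] : forall i, exists bc : A * A,
    [/\ M1 bc.1, M2 bc.2, gcoord w i = bc.1 + bc.2 &
        i \notin supp w -> bc.1 = 0 /\ bc.2 = 0].
  move=> i; have [b [c [b1 c2 E]]] := split _ (wM i).
  case: (boolP (i \in supp w)) => [_|iw]; first by exists (b, c); split.
  exists (0, 0); split=> //=; [by case: MI1|by case: MI2|].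
  by rewrite gcoord_out // addr0.
have [w1 w1E] := @gcoord_build _ _ _ (supp w) (fun i => (bc i).1)
  (fun i iw => proj1 (let: And4 _ _ _ h := bcP i in h iw)).
have [w2 w2E] := @gcoord_build _ _ _ (supp w) (fun i => (bc i).2)
  (fun i iw => proj2 (let: And4 _ _ _ h := bcP i in h iw)).
have w12 : w = w1 + w2.
  by apply: gcoord_inj => i; rewrite gcoordD w1E w2E; have [_ _ -> _] := bcP i.
have in1 : in_mult M1 w1 by move=> i; rewrite w1E; have [] := bcP i.
have in2 : in_mult M2 w2 by move=> i; rewrite w2E; have [] := bcP i.
(* The error [z - d w1 = d w2] has its coordinates in both M1 and M2. *)
exists w1 => //; apply/eqP; rewrite -subr_eq0; apply/eqP/gcoord_inj => i.
rewrite gcoord0; apply: M12; first exact: (in_multB MI1 z1 (in_mult_d MI1 in1)).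
have -> : z - res_d P n w1 = res_d P n w2 by rewrite wE w12 linearD addrC addKr.
exact: in_mult_d.
Qed.

(** Dimension shift along the sequence of the annihilator, [A] and [t A], with a degree shift by the
    degree 1 of [t]: for [z = d w], the cycle [t w] bounds some [t w3] by linearity for [t A], and
    [w - d w3] is annihilated by [t]. *)
Lemma linear_tor_annihilator t : gr 1 t -> (forall a, t * a = 0 -> irrelevant a) ->
  linear_tor (fun a => exists b, a = t * b) -> linear_tor (fun a => t * a = 0).
Proof.
move=> gt tirr lin n m z nm hz zt zc.
have [w0 w0E] : exists w, z = res_d P n w.
  exact: (cycle_irrelevant (M := fun a => t * a = 0)).
pose w := hcomp pi m w0.
have wE : z = res_d P n w by rewrite -(d_hcomp gA) -w0E (hcomp_id gA).
have tz0 : t *: z = 0 by apply: gcoord_inj => i; rewrite gcoordZ gcoord0.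
have [||||w2 w2t w2E] := lin n.+1 m.+1 (t *: w).
- by rewrite eqSS.
- exact: (homogZ (j := 1%N) gA gt (hcomp_homog gA m w0)).
- by move=> i; exists (gcoord w i); rewrite gcoordZ.
- by rewrite /= linearZ /= -wE tz0.
have /choice[b bP] : forall i, exists b, gcoord w2 i = t * b /\ (i \notin supp w2 ->
  b = 0).
  move=> i; have [b bE] := w2t i; case: (boolP (i \in supp w2)) => [_|i2].
    by exists b.
  by exists 0; rewrite mulr0 gcoord_out.
have [w3 w3E] := @gcoord_build _ _ _ (supp w2) b (fun i => (bP i).2).
have w23 : w2 = t *: w3.
  by apply: gcoord_inj => i; rewrite gcoordZ w3E (bP i).1.
exists (w - res_d P n.+1 w3).
  move=> i; rewrite -gcoordZ scalerBr w2E w23 linearZ subrr; exact: gcoord0.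
rewrite linearB /= -wE.
have -> : res_d P n (res_d P n.+1 w3) = 0 by apply: (is_cycle_d (n := n.+1)).
by rewrite subr0.
Qed.

(** [Tor_0(J, F) = J / J R_+] lives in degree 1. In higher degrees an element of J is thus a sum of
    products of elements of J of smaller degree with elements of [R_+]. *)
Lemma generated_in_degree1 (J K : A -> Prop) :
  right_ideal J -> right_ideal K -> (forall a, J a -> irrelevant a) ->
  (forall n a, J a -> J (pi n a)) -> linear_tor J ->
  (forall a, gr 1 a -> J a -> K a) -> forall a, J a -> K a.
Proof.
move=> JI KI J0 Jpi lin JK.
suff main m u : gr m u -> J u -> K u.
  move=> a Ja; have [N aN] := cg_sum gA a; rewrite (aN N) //.
  by apply: (right_ideal_sum KI) => i _; apply: (main i);
    [apply: gr_pi gA _ _|apply: Jpi].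
elim/ltn_ind: m u => m IH u; case: m IH => [|[|m]] IH gu Ju; first 2 last.
- have [v0 hv0 v01] := eps_unit gA P.
  have [||||w wJ wE] := lin 0 m.+2 (u *: v0) => //.
    by have := homogZ gA gu hv0; rewrite addn0.
    by move=> i; rewrite gcoordZ; have [_ _ h] := JI; apply: h.
  (* [p] lifts the augmentation to a map from [P 0] to [A], so it sends boundaries to elements
     without constant term. *)
  have [p pE] := extend_basis (fun i : gf_idx (P 0) => (res_eps (gf_bas i))%:A : A^o).
  have pi_p v : pi 0 (p v) = (res_eps v)%:A.
    rewrite (linear_gcoord p) (pi_sum gA) (linear_to_F_coord gA v (eps_linear P)).
    rewrite scaler_suml; apply: eq_bigr => i _; rewrite pE.
    by rewrite (piMr gA _ _ (gr_scalar gA _)) /= (augE gA) mulr_algr scalerA mulrC.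
  have uE : u = pi m.+2 (p (u *: v0)).
    rewrite linearZ /= (piMl gA _ _ gu) leqnn subnn pi_p v01.
    by rewrite scale1r mulr1.
  rewrite uE wE (linear_gcoord (res_d P 0)) linear_sum (pi_sum gA).
  apply: (right_ideal_sum KI) => i _; rewrite linearZ /=.
  set a := gcoord w i; set b := p (res_d P 0 (gf_bas i)); rewrite -[_ *: _]/(a * b).
  have b0 : pi 0 b = 0.
    by rewrite pi_p (_ : res_eps _ = 0) ?scale0r //; apply: (is_cycle_d (n := 0)).
  have [N aN] := cg_sum gA a; rewrite (aN N) // mulr_suml (pi_sum gA).
  apply: (right_ideal_sum KI) => k _; rewrite (piMl gA _ _ (gr_pi gA k a)).
  case: leqP => [km|_]; last by have [] := KI.
  have [->|ne] := eqVneq (k : nat) m.+2.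
    by rewrite subnn b0 mulr0; have [] := KI.
  have [_ _ h] := KI; apply: h; apply: (IH k); last exact/Jpi/wJ.
    by rewrite ltn_neqAle ne.
  exact: gr_pi gA _ _.
- by move: (J0 u Ju); rewrite /irrelevant (pi_id gA gu) => ->; have [] := KI.
- exact: JK.
Qed.

End LinearTor.

Section KoszulToAnnihilators.
Context (F : fieldType) {disp : Order.disp_t} (G : finBPOrderType disp).
Hypothesis hG : ranked G.
Context (A : algType F) (gen : gens G -> A) (gr : nat -> A -> Prop) (pi : nat -> A ->
  A).
Hypothesis raA : ranked_algebra gen gr pi.
Let gA := ra_grading raA.
Local Notation gens := (gens G).
Implicit Types (a b : A) (i j k : nat).
Local Notation level_ideal := (level_ideal gen).
Local Notation gen_sum := (gen_sum gen).

Lemma level_ideal_right x j : right_ideal (level_ideal x j).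
Proof.
split=> [|a b|a b]; [exact: level_ideal0|exact: level_idealD|exact: level_idealM].
Qed.

Lemma principal_right t : right_ideal (fun a => exists b, a = t * b).
Proof.
split=> [|a b [c ->] [d ->]|a b [c ->]].
- by exists 0; rewrite mulr0.
- by exists (c + d); rewrite mulrDr.
- by exists (c * b); rewrite mulrA.
Qed.

Lemma gens_right (Q : pred gens) :
  right_ideal (fun a => exists b : gens -> A, a = \sum_(y | Q y) gen y * b y).
Proof.
split=> [|a b [c ->] [d ->]|a b [c ->]].
- by exists (fun=> 0); rewrite big1 // => y _; rewrite mulr0.
- exists (fun y => c y + d y); rewrite -big_split; apply: eq_bigr => y _.
  by rewrite mulrDr.
- exists (fun y => c y * b); rewrite mulr_suml; apply: eq_bigr => y _.
  by rewrite mulrA.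
Qed.

Lemma level_ideal_irrelevant x j a : level_ideal x j a -> irrelevant pi a.
Proof.
move=> [b [u ->]]; rewrite /irrelevant (piD gA) (pi_sum gA) big1.
  by rewrite add0r (piMl gA _ _ (gr_gen_sum raA x j)).
by move=> y _; rewrite (piMl gA _ _ (ra_gen raA y)).
Qed.

Lemma level_ideal_mono x j z a : z \in level x j.+1 ->
  level_ideal x j a -> level_ideal z j a.
Proof.
move=> /levelP[zx _] [b [u ->]]; have /subsetP zxj := level_trans j zx.
apply: level_idealD.
  elim/big_rec: _ => [|y c yx IH]; first exact: level_ideal0.
  apply: level_idealD => //; apply: level_ideal_gen.
  by apply: contra yx; apply: zxj.
rewrite /gen_sum (bigID (fun y : gens => val y \in level z j)) /= mulrDl;
  apply: level_idealD.
  rewrite (_ : \sum_(y | _) _ = gen_sum z j); first exact: level_ideal_sum.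
  apply: eq_bigl => y; rewrite andbC; case: (boolP (_ \in level z j)) => //= yz.
  exact: zxj.
rewrite mulr_suml; elim/big_rec: _ => [|y c /andP[_ yz] IH];
  first exact: level_ideal0.
by apply: level_idealD => //; apply: level_ideal_gen.
Qed.

Lemma gen_sum_level_ideal x j a : level_ideal x j a -> gen_sum x j.+1 * a = 0.
Proof.
move=> xa; apply/(gen_sumM_eq0 hG raA) => z zx; apply/(gen_ann hG raA).
have [_ rz] := levelP _ _ _ zx; rewrite rz; exact: level_ideal_mono xa.
Qed.

(** Uniformity enters here, as the detection of 0-cochains. *)
Lemma annihilator_degree1 x j a : uniform G -> (j.+1 < rk x)%N -> gr 1%N a ->
  gen_sum x j.+1 * a = 0 -> level_ideal x j a.
Proof.
move=> uG jx ga E; have [c cE] := ev_surj raA ga; rewrite cE.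
apply/(level_ideal_ev hG raA)/(uniform_detects hG uG jx) => z zx.
have [_ rz] := levelP _ _ _ zx.
have z0 : z != \bot%O by rewrite -(rk_gt0 hG) rz.
have /(gen_sumM_eq0 hG raA)/(_ (Sub z z0) zx)/(gen_ann hG raA) := E.
by rewrite /= rz cE => /(level_ideal_ev hG raA).
Qed.

Section Koszul.
Hypothesis uG : uniform G.
Context (P : gfree_resolution gr).
Hypothesis ext_diagonal : forall n k (f : P n -> F), n != k ->
  ext_cocycle k f -> ext_coboundary k f.

Lemma linear_tor_gen (x : gens) : linear_tor P (fun a => exists b, a = gen x * b).
Proof.
apply: (linear_tor_summand (M := irrelevant pi)
  (M2 := fun a => exists b : gens -> A, a = \sum_(y | y != x) gen y * b y)).
- exact: principal_right.
- exact: gens_right.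
- by move=> a [b ->]; rewrite /irrelevant (piMl gA _ _ (ra_gen raA x)).
- move=> a a0; have [c [b aE]] := ra_decomp raA a.
  have c0 : c%:A = 0 :> A.
    move: a0; rewrite /irrelevant aE (piD gA) (pi_id gA (gr_scalar gA c)) (pi_sum gA).
    by rewrite big1 ?addr0 // => y _; rewrite (piMl gA _ _ (ra_gen raA y)).
  exists (gen x * b x), (\sum_(y | y != x) gen y * b y); split.
  + by exists (b x).
  + by exists b.
  + by rewrite aE c0 add0r (bigD1 x).
- move=> a [b ->] [c E].
  have /(gen_indep hG raA)/(_ x) :
      \sum_y gen y * (if y == x then b else - c y) = 0.
    rewrite (bigD1 x) //= eqxx E -big_split big1 // => y /negPf->.
    by rewrite /= mulrN subrr.
  by rewrite eqxx.
- exact: (linear_tor_irrelevant gA ext_diagonal).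
Qed.

Lemma linear_tor_gen_sum x j : linear_tor P (level_ideal x j) ->
  linear_tor P (fun a => exists b, a = gen_sum x j * b).
Proof.
apply: (linear_tor_summand
  (M2 := fun a => exists b : gens ->
    A, a = \sum_(y : gens | val y \notin level x j) gen y * b y)).
- exact: principal_right.
- exact: gens_right.
- by move=> a [b ->]; apply: level_ideal_sum.
- move=> a [b [u ->]]; exists (gen_sum x j * u),
  (\sum_(y : gens | val y \notin level x j) gen y * b y).
  by split; [exists u|exists b|rewrite addrC].
- move=> a [u ->] [b E].
  have /(gen_indep hG raA) h : \sum_(y :
    gens) gen y * (if val y \in level x j then u else - b y) = 0.
    rewrite (bigID (fun y : gens => val y \in level x j)) /=.
    rewrite (eq_bigr (fun y => gen y * u)); last by move=> y ->.
    rewrite -mulr_suml -/(gen_sum x j) E -big_split big1 // => y /negPf->.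
    by rewrite /= mulrN subrr.
  rewrite mulr_suml big1 // => y yx; have := h y.
  by rewrite yx.
Qed.

(** Linearity for the multiples of [gen_sum x j.+1] passes to its annihilator, which is therefore
    generated in degree 1. Its degree 1 part lies in the level ideal, and the reverse inclusion is
    [gen_sum_level_ideal]. *)
Lemma linear_tor_annihilated x j : (j.+1 < rk x)%N ->
  linear_tor P (fun a => exists b, a = gen_sum x j.+1 * b) ->
  linear_tor P (level_ideal x j) /\
  forall a, gen_sum x j.+1 * a = 0 -> level_ideal x j a.
Proof.
move=> jx lin.
have irr a : gen_sum x j.+1 * a = 0 -> irrelevant pi a.
  move=> E; have [z zx] := level_inhabited hG jx; have [_ rz] := levelP _ _ _ zx.
  have z0 : z != \bot%O by rewrite -(rk_gt0 hG) rz.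
  have /(gen_sumM_eq0 hG raA)/(_ (Sub z z0) zx)/(gen_ann hG raA) := E.
  exact: level_ideal_irrelevant.
have lin' := linear_tor_annihilator gA (gr_gen_sum raA x j.+1) irr lin.
have ann a : gen_sum x j.+1 * a = 0 -> level_ideal x j a.
  move: a; apply: (generated_in_degree1 gA _ (level_ideal_right x j) irr _ lin').
  - split=> [|a b a0 b0|a b a0]; first by rewrite mulr0.
      by rewrite mulrDr a0 b0 addr0.
    by rewrite mulrA a0 mul0r.
  - move=> n a /(congr1 (pi n.+1)).
    by rewrite (pi0 gA) (piMl gA _ _ (gr_gen_sum raA x _)) /= subSS subn0.
  - by move=> a; apply: annihilator_degree1.
split=> //.
suff -> : level_ideal x j = fun a => gen_sum x j.+1 * a = 0 by [].
by apply: funext => a; apply: propext; split; [apply: gen_sum_level_ideal|apply: ann].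
Qed.

(** Descent from the annihilator of [gen x]: in each level ideal the multiples of [gen_sum] are a
    direct summand, whose generator has the next level ideal as annihilator. *)
Lemma linear_tor_level x j : (j < rk x)%N -> linear_tor P (level_ideal x j).
Proof.
move=> jx; have x0 : x != \bot%O by rewrite -(rk_gt0 hG); lia.
have base : linear_tor P (level_ideal x (rk x).-1).
  suff -> : level_ideal x (rk x).-1 = fun a => gen (Sub x x0) * a = 0.
    apply: (linear_tor_annihilator gA (ra_gen raA _)); last exact: linear_tor_gen.
    by move=> a /(gen_ann hG raA); apply: level_ideal_irrelevant.
  by apply: funext => a; apply: propext; split=> /(gen_ann hG raA (Sub x x0)).
suff main d : (d < rk x)%N -> linear_tor P (level_ideal x ((rk x).-1 - d)).
  by have := main ((rk x).-1 - j)%N; rewrite subKn; [apply; lia|lia].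
elim: d => [|d IH] dx; first by rewrite subn0.
have e : ((rk x).-1 - d)%N = ((rk x).-1 - d.+1).+1 by lia.
apply: (linear_tor_annihilated _ _).1; first lia.
by rewrite -e; apply: linear_tor_gen_sum; apply: IH; lia.
Qed.

End Koszul.

Lemma koszul_annihilators :
  uniform G -> koszul gr -> annihilators_are_level_ideals gen.
Proof.
move=> uG [P hP] x j a jx.
have ext_diagonal n k (f : P n -> F) : n != k -> ext_cocycle k f ->
  ext_coboundary k f.
  by move=> nk /hP/(generated_cocycle gA)[_]; apply.
apply: (proj2 (linear_tor_annihilated (P := P) uG jx _)).
exact: (linear_tor_gen_sum (linear_tor_level uG ext_diagonal jx)).
Qed.

End KoszulToAnnihilators.

(** * Linear resolutions from annihilators *)

(** [U] is only a predicate, so its basis is an independent family of maximal size in it. *)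
Lemma subspace_basis (F : fieldType) N (U : 'rV[F]_N -> Prop) :
  U 0 -> (forall c u v, U u -> U v -> U (c *: u + v)) ->
  exists m (B : 'M[F]_(m, N)), row_free B /\ forall v, U v <-> (v <= B)%MS.
Proof.
move=> U0 UD.
pose Q m := `[< exists B : 'M[F]_(m, N), row_free B /\ forall i, U (row i B) >].
have Q0 : exists m, Q m.
  exists 0%N; apply/asboolP; exists 0; split; last by case.
  by rewrite /row_free mxrank0.
have Qle m : Q m -> (m <= N)%N.
  by move=> /asboolP[B [fB _]]; rewrite -(eqP (fB : \rank B == m)) rank_leq_col.
case: (ex_maxnP Q0 Qle) => m /asboolP[B [fB UB]] mmax.
exists m, B; split=> // v; split=> [Uv|/submxP[c ->]]; last first.
  rewrite mulmx_sum_row; elim/big_rec: _ => [//|i u _ Uu]; exact: UD.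
apply: contrapT => vB; suff /mmax : Q (m + 1)%N by rewrite addn1 ltnn.
apply/asboolP; exists (col_mx B v); split; last first.
  move=> i; rewrite -[i]splitK; case: (split i) => j /=.
    by rewrite rowKu.
  by rewrite rowKd (_ : row j v = v) //; apply/rowP => k; rewrite mxE (ord1 j).
rewrite -kermx_eq0 -submx0; apply/rV_subP => w /sub_kermxP.
rewrite -[w]hsubmxK mul_row_col => E.
have r0 : rsubmx w = 0.
  apply: contrapT => c0; apply: vB.
  have {}c0 : rsubmx w 0 0 != 0.
    apply/eqP => e; apply: c0; apply/rowP => k; rewrite (ord1 k) e.
    by rewrite mxE.
  move: E; rewrite [rsubmx w]mx11_scalar mul_scalar_mx => /eqP.
  rewrite addrC addr_eq0 => /eqP /(congr1 (fun u => (rsubmx w 0 0)^-1 *: u)).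
  rewrite scalerA mulVf // scale1r => ->.
  by rewrite scalemx_sub // eqmx_opp submxMl.
have l0 : lsubmx w = 0.
  apply/eqP; move: E; rewrite r0 mul0mx addr0 => /eqP.
  by rewrite mulmx_free_eq0.
by rewrite l0 r0 row_mx0 sub0mx.
Qed.

Section MatrixResolution.
Context (F : fieldType) (A : algType F) (gr : nat -> A -> Prop) (pi : nat -> A -> A).
Hypothesis gA : connected_grading gr pi.
Implicit Types (a b t : A) (k m n : nat) (c : F).
Local Notation irrelevant := (irrelevant pi).

(** The sum of the right ideals [s i * A] is direct; each [s i] may still have an annihilator, or be
    0. *)
Definition independent (I : finType) (s : I -> A) : Prop :=
  forall b : I -> A, \sum_i s i * b i = 0 -> forall i, s i * b i = 0.

Context (q : nat) (r : 'I_q -> A) (T : A -> Prop).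
Hypothesis r_free : forall c (b : 'I_q -> A), c%:A + \sum_x r x * b x = 0 ->
  c = 0 /\ forall x, irrelevant (b x).
Hypothesis r_decomp : forall a, exists c (b : 'I_q -> A), a = c%:A + \sum_x r x * b x.
Hypothesis Tr : forall x, T (r x).
Hypothesis r_ind : independent r.
Hypothesis T_gr : forall t, T t -> gr 1%N t.
Hypothesis T_ann : forall t, T t -> t = 0 \/ exists (I : finType) (s : I -> A),
  [/\ forall i, T (s i), independent s, forall i, t * s i = 0 &
      forall a, t * a = 0 -> exists b : I -> A, a = \sum_i s i * b i].

Lemma r_gr x : gr 1%N (r x). Proof. exact: T_gr. Qed.

Lemma gr1_decomp a : gr 1%N a -> exists c : 'I_q -> F, a = \sum_x c x *: r x.
Proof.
move=> ga; have [c0 [b aE]] := r_decomp a.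
exists (fun x => aug gA (b x)); rewrite -[LHS](pi_id gA ga) aE (piD gA).
rewrite (pi_gr gA _ (gr_scalar gA c0)) add0r (pi_sum gA); apply: eq_bigr => x _.
by rewrite (piMl gA _ _ (r_gr x)) /= subnn (augE gA) mulr_algr.
Qed.

Lemma left_decomp a : irrelevant a -> exists b : 'I_q -> A, a = \sum_x r x * b x.
Proof.
move=> a0; have [c [b aE]] := r_decomp a; exists b; rewrite {1}aE.
have c0 : c%:A = 0 :> A.
  move: a0; rewrite /irrelevant aE (piD gA) (pi_id gA (gr_scalar gA c)) (pi_sum gA).
  by rewrite big1 ?addr0 // => y _; rewrite (piMl gA _ _ (r_gr y)).
by rewrite c0 add0r.
Qed.

(** [r_decomp] puts the generators on the left, but the first differential of a resolution by left
    modules needs them on the right; induction on the degree moves them across. *)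
Lemma right_decomp a : irrelevant a -> exists b : 'I_q -> A, a = \sum_x b x * r x.
Proof.
suff main n a' : gr n.+1 a' -> exists b : 'I_q -> A, a' = \sum_x b x * r x.
  move=> a0; have [N aN] := cg_sum gA a.
  have /choice[b bE] : forall n, exists b : 'I_q -> A, pi n.+1 a = \sum_x b x * r x.
    by move=> n; apply: main; apply: gr_pi gA _ _.
  exists (fun x => \sum_(n < N) b n x); rewrite {1}(aN N.+1) // big_ord_recl /=.
  rewrite a0 add0r; under [RHS]eq_bigr do rewrite mulr_suml.
  by rewrite exchange_big; apply: eq_bigr => n _; rewrite bE.
elim: n a' => [|n IH] a' ga.
  have [c ->] := gr1_decomp ga; exists (fun x => (c x)%:A).
  by apply: eq_bigr => x _; rewrite mulr_algl.
have [|b aE] := @left_decomp a'; first by rewrite /irrelevant (pi_gr gA _ ga).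
have /choice[d dE] : forall x, exists d : 'I_q -> A, pi n.+1 (b x) = \sum_y d y * r y.
  by move=> x; apply: IH; apply: gr_pi gA _ _.
exists (fun y => \sum_x r x * d x y).
under [RHS]eq_bigr do rewrite mulr_suml; rewrite exchange_big /=.
rewrite -[LHS](pi_id gA ga) aE (pi_sum gA); apply: eq_bigr => x _.
rewrite (piMl gA _ _ (r_gr x)) /= subSS subn0 dE mulr_sumr.
by apply: eq_bigr => y _; rewrite mulrA.
Qed.

Definition row_irr n (z : 'rV[A]_n) : Prop := forall i, irrelevant (z 0 i).
Definition row_pi n k (z : 'rV[A]_n) : 'rV[A]_n := \row_i pi k (z 0 i).
Definition linear_mx m n (D : 'M[A]_(m, n)) : Prop := forall i j, gr 1%N (D i j).

Lemma row_pi_id n k (z : 'rV[A]_n) : (forall i, gr k (z 0 i)) -> row_pi k z = z.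
Proof. by move=> h; apply/rowP => i; rewrite mxE (pi_id gA). Qed.

Lemma row_piM m n k (D : 'M[A]_(m, n)) (z : 'rV[A]_m) : linear_mx D ->
  row_pi k.+1 (z *m D) = row_pi k z *m D.
Proof.
move=> lD; apply/rowP => j; rewrite !mxE (pi_sum gA); apply: eq_bigr => i _.
by rewrite (piMr gA _ _ (lD i j)) /= subSS subn0 mxE.
Qed.

Lemma row_piZ n k t (z : 'rV[A]_n) : gr 1%N t ->
  row_pi k.+1 (t *: z) = t *: row_pi k z.
Proof.
by move=> gt; apply/rowP => j; rewrite !mxE (piMl gA _ _ gt) /= subSS subn0.
Qed.

Lemma row_decomp n (z : 'rV[A]_n) : exists N, z = \sum_(k < N) row_pi k z.
Proof.
suff [N zN] : exists N, forall N', (N <= N')%N -> forall i, i \in enum 'I_n ->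
    z 0 i = \sum_(k < N') pi k (z 0 i).
  exists N; apply/rowP => i; rewrite summxE [LHS](zN N) ?mem_enum //.
  by apply: eq_bigr => k _; rewrite mxE.
elim: (enum 'I_n) => [|i s [N1 IH]]; first by exists 0%N.
have [N2 h] := cg_sum gA (z 0 i); exists (maxn N1 N2) => N';
  rewrite geq_max => /andP[h1 h2] i'.
by rewrite inE => /orP[/eqP->|]; [apply: h|apply: IH].
Qed.

(* For D the last differential of a partial resolution P, the vanishing of the
   homology of the complexes t P in degrees above the diagonal. With t = r_x it
   shows that the kernel of D is generated in degree 1. *)
Definition tight m n (D : 'M[A]_(m, n)) : Prop := forall t (z : 'rV_m), T t ->
  row_irr z -> t *: (z *m D) = 0 -> exists2 y : 'rV_m, y *m D = 0 & t *: z = t *: y.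

Lemma tight_of_lifts m n (D : 'M[A]_(m, n)) : linear_mx D ->
  (forall (I : finType) (s : I -> A) (z_ : I -> 'rV_n) (z : 'rV_m),
     (forall i, T (s i)) -> independent s -> (forall i, row_irr (z_ i)) ->
     \sum_i s i *: z_ i = z *m D ->
     exists w_ : I -> 'rV_m, forall i, s i *: z_ i = s i *: (w_ i *m D)) ->
  tight D.
Proof.
move=> lD lifts t z Tt zirr tzD; have [->|[I [s [Ts s_ind ts ann]]]] := T_ann Tt.
  by exists 0; rewrite ?mul0mx ?scale0r.
have /choice[b bE] : forall j, exists b : I -> A, (z *m D) 0 j = \sum_i s i * b i.
  by move=> j; apply: ann; have /rowP/(_ j) := tzD; rewrite !mxE.
(* [z *m D] has no component of degree 1, so the constant terms of the coefficients contribute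
   nothing and can be removed. *)
have b0 j i : s i * pi 0 (b j i) = 0.
  move: i; apply: s_ind; have := congr1 (pi 1) (bE j).
  have -> : pi 1 ((z *m D) 0 j) = 0.
    rewrite mxE (pi_sum gA) big1 // => i _.
    by rewrite (piMr gA _ _ (lD i j)) /= subnn zirr mul0r.
  move=> /esym; rewrite (pi_sum gA) => E; rewrite -[RHS]E; apply: eq_bigr => i _.
  by rewrite (piMl gA _ _ (T_gr (Ts i))) /= subnn.
pose z_ i : 'rV[A]_n := \row_j (b j i - pi 0 (b j i)).
have zE : \sum_i s i *: z_ i = z *m D.
  apply/rowP => j; rewrite summxE bE; apply: eq_bigr => i _.
  by rewrite !mxE mulrBr b0 subr0.
have [|w_ wE] := lifts I s z_ z Ts s_ind _ zE.
  by move=> i j; rewrite mxE /irrelevant (piB gA) (cg_pi gA) subrr.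
exists (z - \sum_i s i *: w_ i); last first.
  rewrite scalerBr scaler_sumr big1 ?subr0 // => i _.
  by rewrite scalerA ts scale0r.
rewrite mulmxBl -zE mulmx_suml -sumrB big1 // => i _.
by rewrite -scalemxAl wE subrr.
Qed.

(** The pieces of a boundary are cycles after multiplication by [s i], by independence. Tightness of
    [D] replaces them by true cycles, which are boundaries by exactness. *)
Lemma tight_step l m n (D' : 'M[A]_(l, m)) (D : 'M[A]_(m, n)) : linear_mx D' ->
  (forall z : 'rV_m, z *m D = 0 <-> exists w, z = w *m D') ->
  tight D -> tight D'.
Proof.
move=> lD' ex tD; apply: tight_of_lifts => // I s z_ z Ts s_ind zirr zE.
have zD i : s i *: (z_ i *m D) = 0.
  apply/rowP => j; rewrite [LHS]mxE [RHS]mxE; move: i.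
  apply: (s_ind (fun i => (z_ i *m D) 0 j)).
  have : (\sum_i s i *: z_ i) *m D = 0 by apply/ex; exists z.
  rewrite mulmx_suml => /rowP/(_ j); rewrite summxE [in X in _ = X -> _]mxE => E.
  rewrite -[RHS]E; apply: eq_bigr => i _.
  by rewrite -scalemxAl [in RHS]mxE.
have /choice[w_ wE] : forall i, exists w, s i *: z_ i = s i *: (w *m D').
  move=> i; have [y yD ->] := tD _ _ (Ts i) (zirr i) (zD i).
  by have [w ->] := (ex y).1 yD; exists w.
by exists w_.
Qed.

Definition gen_col : 'M[A]_(q, 1) := \col_x r x.

Lemma gen_col_linear : linear_mx gen_col.
Proof. by move=> i j; rewrite mxE; apply: r_gr. Qed.

Lemma gen_col_image (z : 'rV[A]_1) : row_irr z <-> exists w, z = w *m gen_col.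
Proof.
split=> [z0|[w ->] i].
  have [b bE] := right_decomp (z0 0); exists (\row_x b x).
  apply/rowP => i; rewrite (ord1 i) bE mxE; apply: eq_bigr => x _.
  by rewrite !mxE.
rewrite /irrelevant mxE (pi_sum gA) big1 // => x _.
by rewrite (piMr gA _ _ (gen_col_linear x i)).
Qed.

Lemma gen_col_tight : tight gen_col.
Proof.
apply: tight_of_lifts gen_col_linear _ => I s z_ z Ts s_ind zirr _.
have /choice[w_ wE] : forall i, exists w, z_ i = w *m gen_col.
  by move=> i; apply/gen_col_image/zirr.
by exists w_ => i; rewrite -wE.
Qed.

Definition scalar_row n (v : 'rV[F]_n) : 'rV[A]_n := map_mx (GRing.in_alg A) v.
Definition injective0 m n (D : 'M[A]_(m, n)) : Prop :=
  forall v, scalar_row v *m D = 0 -> v = 0.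

Lemma r_sum_eq0 (c : 'I_q -> F) : \sum_x c x *: r x = 0 -> forall x, c x = 0.
Proof.
move=> E x; have [|_ /(_ x)] := @r_free 0 (fun x => (c x)%:A).
  rewrite scale0r add0r -[RHS]E; apply: eq_bigr => y _.
  by rewrite mulr_algr.
rewrite /irrelevant (pi_id gA (gr_scalar gA _)) => /eqP.
by rewrite scaler_eq0 oner_eq0 orbF => /eqP.
Qed.

Lemma gen_col_injective0 : injective0 gen_col.
Proof.
move=> v /rowP/(_ 0); rewrite !mxE => E; apply/rowP => x; rewrite mxE.
move: x; apply: r_sum_eq0; rewrite -[RHS]E; apply: eq_bigr => y _.
by rewrite !mxE mulr_algl.
Qed.

(** Rows with entries of degree 1, given by their coordinates in the basis [r] of that degree. *)
Definition gen_row n (c : 'M[F]_(n, q)) : 'rV[A]_n := \row_i \sum_x c i x *: r x.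

Lemma gen_row_linear n (a : F) (c d : 'M[F]_(n,
  q)) : gen_row (a *: c + d) = a%:A *: gen_row c + gen_row d.
Proof.
apply/rowP => i; rewrite !mxE mulr_algl scaler_sumr -big_split; apply: eq_bigr => x _.
by rewrite !mxE scalerDl scalerA.
Qed.

Lemma gen_rowD n (c d : 'M[F]_(n, q)) : gen_row (c + d) = gen_row c + gen_row d.
Proof. by rewrite -[c]scale1r gen_row_linear !scale1r. Qed.

Lemma gen_row0 n : gen_row (0 : 'M[F]_(n, q)) = 0.
Proof. by apply: (addIr (gen_row 0)); rewrite -gen_rowD !add0r. Qed.

Lemma gen_rowZ n (a : F) (c : 'M[F]_(n, q)) : gen_row (a *: c) = a%:A *: gen_row c.
Proof. by rewrite -[a *: c]addr0 gen_row_linear gen_row0 addr0. Qed.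

Lemma gen_row_eq0 n (c : 'M[F]_(n, q)) : gen_row c = 0 -> c = 0.
Proof.
move=> /rowP E; apply/matrixP => i x; rewrite [RHS]mxE; move: x; apply: r_sum_eq0.
by have := E i; rewrite !mxE.
Qed.

(** The rows of [D'] are an F-basis of the degree 1 part of the kernel of [D]. That they generate
    the kernel is shown by induction on the degree, the degree 0 part being excluded by
    [injective0]. *)
Lemma next_matrix m n (D : 'M[A]_(m, n)) : linear_mx D -> injective0 D -> tight D ->
  exists l (D' : 'M[A]_(l, m)), [/\ linear_mx D', injective0 D', tight D' &
    forall z : 'rV_m, z *m D = 0 <-> exists w, z = w *m D'].
Proof.
move=> lD iD tD.
pose U (v : 'rV[F]_(m * q)) := gen_row (vec_mx v) *m D = 0.
have [||l [B [fB UB]]] := @subspace_basis F (m * q) U.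
- by rewrite /U linear0 gen_row0 mul0mx.
- move=> c u v Uu Uv; rewrite /U linearP /= gen_row_linear mulmxDl -scalemxAl.
  by rewrite Uu Uv scaler0 addr0.
pose D' : 'M[A]_(l, m) := \matrix_(i, j) gen_row (vec_mx (row i B)) 0 j.
have D'row i : row i D' = gen_row (vec_mx (row i B)) by apply/rowP => j; rewrite !mxE.
have scD' (v : 'rV_l) : scalar_row v *m D' = gen_row (vec_mx (v *m B)).
  rewrite !mulmx_sum_row linear_sum /=.
  rewrite (big_morph (@gen_row m) (@gen_rowD m) (@gen_row0 m)); apply: eq_bigr => i _.
  by rewrite D'row mxE linearZ /= gen_rowZ.
have lD' : linear_mx D'.
  move=> i j; rewrite mxE mxE; apply: (gr_sum gA) => x _; apply: (grZ gA).
  exact: r_gr.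
have D'D (w : 'rV_l) : (w *m D') *m D = 0.
  rewrite (mulmx_sum_row w D') mulmx_suml big1 // => i _.
  rewrite -scalemxAl D'row (_ : gen_row _ *m D = 0) ?scaler0 //.
  by apply/UB; rewrite row_sub.
have hom k (z : 'rV[A]_m) : (forall i, gr k (z 0 i)) -> z *m D = 0 ->
    exists w, z = w *m D'.
  elim: k z => [|[|k] IH] z gz zD.
  - have /choice[v vE] : forall i, exists c, z 0 i = c%:A by move=> i;
    apply: cg0 gA _ (gz i).
    have zv : z = scalar_row (\row_i v i) by apply/rowP => i; rewrite !mxE vE.
    by move: zD; rewrite zv => /iD->; exists 0; rewrite mul0mx; apply/rowP => i;
      rewrite !mxE /= scale0r.
  - have /choice[c cE] : forall i, exists c : 'I_q -> F, z 0 i = \sum_x c x *: r x.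
      by move=> i; apply: gr1_decomp.
    have zc : z = gen_row (\matrix_(i, x) c i x).
      by apply/rowP => i; rewrite cE mxE; apply: eq_bigr => x _; rewrite mxE.
    have /UB/submxP[d dE] : U (mxvec (\matrix_(i, x) c i x)) by rewrite /U mxvecK -zc.
    by exists (scalar_row d); rewrite scD' -dE mxvecK.
  have /choice[b bE] : forall i, exists b : 'I_q -> A, z 0 i = \sum_x r x * b x.
    by move=> i; apply: left_decomp; rewrite /irrelevant (pi_gr gA _ (gz i)).
  pose z_ x : 'rV[A]_m := \row_i pi k.+1 (b i x).
  have zE : z = \sum_x r x *: z_ x.
    apply/rowP => i; rewrite summxE -[LHS](pi_id gA (gz i)) bE (pi_sum gA).
    by apply: eq_bigr => x _; rewrite !mxE (piMl gA _ _ (r_gr x)) /= subSS subn0.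
  have zxD x : r x *: (z_ x *m D) = 0.
    apply/rowP => j; rewrite [LHS]mxE [RHS]mxE; move: x.
    apply: (r_ind (b := fun x => (z_ x *m D) 0 j)).
    move: zD; rewrite zE mulmx_suml => /rowP/(_ j);
      rewrite summxE [in X in _ = X -> _]mxE => E.
    by rewrite -[RHS]E; apply: eq_bigr => x _; rewrite -scalemxAl [in RHS]mxE.
  (* Tightness with [t = r x] trades [z_ x] for a cycle; its component of degree [k.+1] is covered
     by the induction hypothesis. *)
  have /choice[w wE] : forall x, exists w, r x *: z_ x = r x *: (w *m D').
    move=> x; have zirr : row_irr (z_ x) by move=> i;
      rewrite mxE /irrelevant (cg_pi gA).
    have [y yD yE] := tD _ _ (Tr x) zirr (zxD x).
    have [w wE] : exists w, row_pi k.+1 y = w *m D'.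
      apply: IH => [i|]; first by rewrite mxE; apply: gr_pi gA _ _.
      rewrite -row_piM // yD; apply/rowP => j; rewrite !mxE; exact: (pi0 gA).
    exists w; rewrite -wE -(row_piZ _ _ (r_gr x)) -yE (row_piZ _ _ (r_gr x)).
    by rewrite row_pi_id // => i; rewrite mxE; apply: gr_pi gA _ _.
  exists (\sum_x r x *: w x); rewrite mulmx_suml zE; apply: eq_bigr => x _.
  by rewrite wE scalemxAl.
have ex (z : 'rV_m) : z *m D = 0 <-> exists w, z = w *m D'.
  split=> [zD|[w ->]]; last exact: D'D.
  have /choice[w wE] : forall k, exists w, row_pi k z = w *m D'.
    move=> k; apply: (hom k) => [i|]; first by rewrite mxE; apply: gr_pi gA _ _.
    by rewrite -row_piM // zD; apply/rowP => j; rewrite !mxE; exact: (pi0 gA).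
  have [N zN] := row_decomp z; exists (\sum_(k < N) w k).
  by rewrite mulmx_suml {1}zN; apply: eq_bigr => k _.
exists l, D'; split=> //; last exact: tight_step lD' ex tD.
move=> v; rewrite scD' => /gen_row_eq0 /(congr1 mxvec);
  rewrite vec_mxK linear0 => /eqP.
by rewrite mulmx_free_eq0 // => /eqP.
Qed.


Record stage := Stage {
  stage_cod : nat;
  stage_dom : nat;
  stage_mx : 'M[A]_(stage_dom, stage_cod);
  stageP : [/\ linear_mx stage_mx, injective0 stage_mx & tight stage_mx]
}.

Lemma next_stage_exists (s : stage) : exists D' : {l : nat & 'M[A]_(l, stage_dom s)},
  [/\ linear_mx (projT2 D'), injective0 (projT2 D'), tight (projT2 D') &
    forall z : 'rV_(stage_dom s), z *m stage_mx s = 0 <-> exists w,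
      z = w *m projT2 D'].
Proof.
have [lD iD tD] := stageP s; have [l [D' D'P]] := next_matrix lD iD tD.
by exists (existT _ l D').
Qed.

Definition next_mx s := projT1 (cid (next_stage_exists s)).

Lemma next_mxP s : [/\ linear_mx (projT2 (next_mx s)),
  injective0 (projT2 (next_mx s)),
    tight (projT2 (next_mx s)) &
    forall z : 'rV_(stage_dom s), z *m stage_mx s = 0 <->
      exists w, z = w *m projT2 (next_mx s)].
Proof. by rewrite /next_mx; case: cid. Qed.

Lemma next_mx_tight s : [/\ linear_mx (projT2 (next_mx s)),
  injective0 (projT2 (next_mx s)) & tight (projT2 (next_mx s))].
Proof. by have [] := next_mxP s. Qed.

Definition next_stage s := Stage (next_mx_tight s).
Definition first_stage := Stage (And3 gen_col_linear gen_col_injective0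
  gen_col_tight).
Definition stages k := iter k next_stage first_stage.

Section RowModule.
Context (n k : nat).

Lemma row_span (v : 'rV[A]_n) : exists (s : seq 'I_n) (c : 'I_n -> A),
  v = \sum_(i <- s) c i *: delta_mx 0 i.
Proof. by exists (enum 'I_n), (v 0); rewrite big_enum [LHS]row_sum_delta. Qed.

Lemma row_sum_entry (s : seq 'I_n) (c : 'I_n -> A) j : uniq s -> j \in s ->
  (\sum_(i <- s) c i *: delta_mx 0 i : 'rV_n) 0 j = c j.
Proof.
move=> us js; rewrite summxE (bigD1_seq j)
  //= !mxE !eqxx mulr1 big1 ?addr0 // => i ij.
by rewrite !mxE eqxx eq_sym (negPf ij) mulr0.
Qed.

Lemma row_free_basis (s : seq 'I_n) (c : 'I_n -> A) : uniq s ->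
  \sum_(i <- s) c i *: delta_mx 0 i = 0 :> 'rV_n -> {in s, forall i, c i = 0}.
Proof. by move=> us E i si; rewrite -(row_sum_entry c us si) E mxE. Qed.

Definition row_module : gfree_module A :=
  @GFreeModule F A 'rV[A]_n 'I_n (delta_mx 0) (fun=> k) row_span row_free_basis.

Lemma row_gcoord (v : row_module) (i : 'I_n) : gcoord v i = (v : 'rV_n) 0 i.
Proof.
move: i; apply: (@gcoord_unique _ _ row_module v (enum 'I_n) ((v :
  'rV_n) 0)) => [|i|].
- exact: enum_uniq.
- by rewrite mem_enum.
by rewrite big_enum [LHS]row_sum_delta.
Qed.

Lemma row_homog j (v : row_module) : homog gr j v <->
  forall i, (v : 'rV_n) 0 i = if (k <= j)%N then pi (j - k) ((v : 'rV_n) 0 i) else 0.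
Proof.
by split=> [/(homogP gA) h i|h]; [|apply/(homogP gA) => i];
  have := h i; rewrite /gcoord_comp row_gcoord.
Qed.

End RowModule.

Definition res_module k := row_module (stage_cod (stages k)) k.

Definition res_map k : {linear res_module k.+1 -> res_module k} :=
  mulmxr (stage_mx (stages k)).

Definition res_aug (v : res_module 0) : F := aug gA ((v : 'rV_1) 0 0).

Lemma res_map_homog n k (v : res_module n.+1) : homog gr k v ->
  homog gr k (res_map n v).
Proof.
move=> /row_homog hv; apply/row_homog => j; rewrite /res_map /=.
have [lD _ _] := stageP (stages n).
have [nk|kn] := leqP n.+1 k; last first.
  have -> : v = 0 by apply/rowP => i; rewrite hv leqNgt kn mxE.
  by rewrite mul0mx mxE; case: ifP; rewrite ?(pi0 gA).
rewrite (ltnW nk) mxE (pi_sum gA); apply: eq_bigr => i _.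
rewrite (piMr gA _ _ (lD i j)) subn_gt0 nk hv nk (cg_pi gA).
by rewrite -subnDA addn1 eqxx.
Qed.

Lemma res_aug_hom : hom_to_F gr 0 res_aug.
Proof.
rewrite /res_aug; split; first split=> [c u v|j a v j0 ga].
- by rewrite !mxE (augD gA) (aug_scale gA).
- by rewrite mxE aug_eq0 // (piMl gA _ _ ga) leqNgt j0.
move=> j v /row_homog hv j0; rewrite hv /= subn0 aug_eq0 //.
by rewrite (cg_pi gA) eq_sym (negPf j0).
Qed.

Lemma res_aug_surj c : exists v, res_aug v = c.
Proof. by exists (const_mx c%:A); rewrite /res_aug mxE (aug_scalar gA). Qed.

Lemma res_aug_exact v : res_aug v = 0 <-> exists u, v = res_map 0 u.
Proof.
rewrite /res_aug; split=> [v0|[u ->]].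
  by apply/gen_col_image => i; rewrite (ord1 i) /irrelevant (augE gA) v0 scale0r.
apply: aug_eq0; have /(_ 0) : row_irr (res_map 0 u) by apply/gen_col_image; exists u.
by [].
Qed.

Lemma res_map_exact n v : res_map n v = 0 <-> exists u, v = res_map n.+1 u.
Proof. by have [_ _ _ ex] := next_mxP (stages n); apply: ex. Qed.

Definition matrix_resolution : gfree_resolution gr :=
  GFreeResolution res_map_homog res_aug_hom res_aug_surj res_aug_exact res_map_exact.

Lemma linear_resolution : exists P : gfree_resolution gr,
  [/\ forall n (i : gf_idx (P n)), gf_deg i = n,
      forall n, exists s : seq (gf_idx (P n)), forall i, i \in s,
      exists i : gf_idx (P 0), res_eps (gf_bas i) = 1 &
      forall v : P 0, homog gr 0 v -> res_eps v = 0 -> v = 0].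
Proof.
exists matrix_resolution; split=> //.
- by move=> n; exists (enum 'I_(stage_cod (stages n))) => i; rewrite mem_enum.
- exists (0 : 'I_1); rewrite /= /res_aug mxE /= mulr1n.
  by rewrite -[1 in LHS]scale1r (aug_scalar gA).
- move=> v /row_homog hv v0; apply/rowP => i; rewrite (ord1 i) hv /= (augE gA).
  by rewrite -/(res_aug v) [res_aug v]v0 scale0r mxE.
Qed.

End MatrixResolution.

(** * Generation of the Yoneda algebra in degree one *)

(** The hypothesis says that the rows of the matrix [B] are independent; a right inverse then writes
    [f] as a combination of its columns. *)
Lemma solve_linear_system (F : fieldType) (I K : eqType) (s : seq I) (t : seq K)
    (B : I -> K -> F) (f : I -> F) : uniq s ->
  (forall c : I -> F, (forall k, k \in t -> \sum_(i <- s) c i * B i k = 0) ->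
     {in s, forall i, c i = 0}) ->
  exists g : seq (F * K), (forall p, p \in g -> p.2 \in t) /\
    {in s, forall i, f i = \sum_(p <- g) p.1 * B i p.2}.
Proof.
move=> us inj; pose S := in_tuple s; pose T := in_tuple t.
pose M : 'M[F]_(size s, size t) := \matrix_(i, j) B (tnth S i) (tnth T j).
have fM : row_free M.
  rewrite -kermx_eq0 -submx0; apply/rV_subP => w /sub_kermxP E.
  pose c i := if [pick j | tnth S j == i] is Some j then w 0 j else 0.
  have cE j : c (tnth S j) = w 0 j.
    rewrite /c; case: pickP => [j' /eqP|/(_ j)]; last by rewrite eqxx.
    by move=> /(tuple_uniqP S us) ->.
  have c0 : {in s, forall i, c i = 0}.
    apply: inj => k /seq_tnthP[j kE]; rewrite -[RHS](_ : (w *m M) 0 j = 0);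
      last by rewrite E mxE.
    rewrite mxE [LHS](big_tnth _ _ s); apply: eq_bigr => i _.
    by rewrite cE mxE kE.
  rewrite submx0; apply/eqP/rowP => j; rewrite -cE c0 ?mxE //.
  exact: mem_tnth.
have [N MN] := row_freeP fM.
pose y := N *m \col_i f (tnth S i).
exists [seq (y j 0, tnth T j) | j <- enum 'I_(size t)];
  split=> [p /mapP[j _ ->]|i /seq_tnthP[j iE]].
  exact: mem_tnth.
rewrite big_map big_enum /=; transitivity ((M *m y) j 0).
  by rewrite mulmxA MN mul1mx mxE /S -iE.
by rewrite mxE; apply: eq_bigr => k _; rewrite mxE mulrC /S -iE.
Qed.

Section Generation.
Context (F : fieldType) (A : algType F) (gr : nat -> A -> Prop) (pi : nat -> A -> A).
Hypothesis gA : connected_grading gr pi.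
Context (P : gfree_resolution gr).
Implicit Types (k l m n : nat).

Lemma chain_lift_exists n l (g : P n -> F) : ext_cocycle l g ->
  exists phi, @chain_lift _ _ _ P n l g phi.
Proof.
move=> [gh gd].
pose ok i (f : {linear P (i + n)%N -> P i}) :=
  shift gr l f /\ forall v, is_cycle (f (res_d P (i + n) v)).
have [f0 [s0 f0E]] := lift_to_P0 gA P gh.
have ok0 : ok 0%N f0 by split=> // v; rewrite /is_cycle f0E gd.
have next i (f : {linear P (i + n)%N -> P i}) : ok i f ->
  exists f' : {linear P (i.+1 + n)%N -> P i.+1},
    ok i.+1 f' /\ forall v, res_d P i (f' v) = f (res_d P (i + n) v).
  move=> [[s1 s2] fc]; pose h : {linear P (i.+1 + n)%N ->
    P i} := f \o res_d P (i + n).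
  have [||f' [sf' f'E]] := @res_lift _ _ _ _ gA P (P (i.+1 + n)%N) i l h.
  - split=> [j v hv|j v jl hv] /=; first by apply: s1; apply: res_d_homog.
    by apply: (s2 j) => //; apply: res_d_homog.
  - exact: fc.
  exists f'; split=> //; split=> // v; rewrite /is_cycle f'E /=.
  have -> : res_d P (i + n) (res_d P (i.+1 + n) v) = 0 by apply:
    (is_cycle_d (n := (i + n).+1)).
  exact: linear0.
pose step i (s : {f | ok i f}) : {f | ok i.+1 f} :=
  exist _ (projT1 (cid (next i _ (projT2 s))))
    (proj1 (projT2 (cid (next i _ (projT2 s))))).
pose phi := nat_rect (fun i => {f | ok i f}) (exist _ f0 ok0) step.
exists (fun i => projT1 (phi i)); split=> [v|i v|i j v|i j v].
- exact: f0E.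
- exact: (proj2 (projT2 (cid (next i _ (projT2 (phi i)))))).
- by have [[h _] _] := projT2 (phi i); apply: h.
- by have [[_ h] _] := projT2 (phi i); apply: h.
Qed.

Lemma generated0 n k : @generated_by_Ext11 _ _ _ P n k (fun=> 0).
Proof.
apply: gen_coboundary; case: n => [|n] //=.
by exists (fun=> 0) => //; apply: hom_to_F_0.
Qed.

Lemma generated_sum n k (I : Type) (s : seq I) (c : I -> F) (h : I -> P n -> F) f :
  (forall i, generated_by_Ext11 k (h i)) ->
    (forall v, f v = \sum_(i <- s) c i * h i v) ->
  generated_by_Ext11 k f.
Proof.
move=> hk; elim: s f => [|i s IH] f fE.
  apply: (gen_linear (c := 0) (generated0 n k) (generated0 n k)) => v.
  by rewrite fE big_nil mulr0 addr0.
apply: (gen_linear (hk i) (IH _ (fun v => erefl))) => v.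
by rewrite fE big_cons.
Qed.

Hypothesis Pdeg : forall n (i : gf_idx (P n)), gf_deg i = n.
Hypothesis Pfin : forall n, exists s : seq (gf_idx (P n)), forall i, i \in s.
Hypothesis Pone : exists i : gf_idx (P 0), res_eps (gf_bas i) = 1.
Hypothesis Pzero : forall v : P 0, homog gr 0 v -> res_eps v = 0 -> v = 0.

Lemma homog_small n k (v : P n) : (k < n)%N -> homog gr k v -> v = 0.
Proof.
move=> kn /(homogP gA) hv; apply: gcoord_inj => i.
by rewrite hv /gcoord_comp Pdeg leqNgt kn gcoord0.
Qed.

(** The basis of [P n.+1] has degree [n.+1], where [f] vanishes. *)
Lemma hom_is_cocycle n (f : P n -> F) : hom_to_F gr n f -> ext_cocycle n f.
Proof.
move=> fh; split=> // v; have [[f1 f2] f3] := fh.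
have -> : f (res_d P n v) = (fun=> 0) v; last by [].
apply: (linear_to_F_eq gA (f := fun v => f (res_d P n v))) => [||i].
- split=> [c u w|j a w j0 ga]; first by rewrite linearP f1.
  by rewrite linearZ (f2 j).
- by have [] := hom_to_F_0 gr (P n.+1) n.
apply: (f3 n.+1); last by rewrite neq_ltn leqnn orbT.
by apply: res_d_homog; have := homog_bas gA i; rewrite Pdeg.
Qed.

Lemma dual_basis n (i : gf_idx (P n)) : exists2 g : P n -> F, hom_to_F gr n g &
  forall j, g (gf_bas j) = (i == j)%:R.
Proof. by apply: (hom_to_F_build gA) => j _; apply: Pdeg. Qed.

Lemma homog_dual n (g : gf_idx (P n) -> P n -> F) (v : P n) :
  (forall i, hom_to_F gr n (g i)) -> (forall i j, g i (gf_bas j) = (i == j)%:R) ->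
  homog gr n v -> (forall i, g i v = 0) -> v = 0.
Proof.
move=> gh gE /(homogP gA) hv gv; apply: gcoord_inj => i; rewrite gcoord0.
have := gv i; rewrite (linear_to_F_coord gA v (proj1 (gh i))).
rewrite hv /gcoord_comp Pdeg leqnn subnn (augE gA).
case: (boolP (i \in supp v)) => [iv|/gcoord_out vi].
  rewrite (bigD1_seq i) ?supp_uniq //= gE eqxx mulr1 big1 ?addr0.
    by move=> ->; rewrite scale0r.
  by move=> j; rewrite gE eq_sym => /negPf->; rewrite mulr0.
by rewrite vi (aug_eq0 gA (pi0 gA 0)) scale0r.
Qed.

Lemma unit_torsion_free a (u : P 0) : homog gr 0 u -> res_eps u = 1 -> a *: u = 0 ->
  a = 0.
Proof.
move=> hu u1; have [i i1] := Pone.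
have hi : homog gr 0 (gf_bas i) by have := homog_bas gA i; rewrite Pdeg.
have -> : u = gf_bas i.
  apply/eqP; rewrite -subr_eq0; apply/eqP/Pzero.
    apply: (homogD gA hu); rewrite -scaleN1r.
    apply: (homogZ (j := 0%N) gA _ hi); rewrite -scaleN1r; exact: (gr_scalar gA).
  have el := eps_linear P.
  rewrite (linear_to_F_D el) -scaleN1r (linear_to_F_Z gA el) u1 i1 mulr1.
  by rewrite -scaleN1r (aug_scalar gA) subrr.
move=> /(congr1 (fun v => gcoord v i)).
by rewrite gcoordZ gcoord_bas eqxx mulr1 gcoord0.
Qed.

(** The products of the dual bases of [P 1] and [P n.+1] separate the elements of degree [n.+2] of
    [P n.+2]. By finite-dimensional duality they span the functionals in that degree. *)
Lemma diagonal_generated n (f : P n -> F) : hom_to_F gr n f -> generated_by_Ext11 n f.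
Proof.
elim: n f => [|[_|n IH]] f fh.
- have [i i1] := Pone; apply:
  (gen_linear (c := f (gf_bas i)) (gen_unit P) (generated0 0 0)) => v.
  rewrite addr0; apply: (linear_to_F_eq gA (proj1 fh) (g :=
    fun v => f (gf_bas i) * res_eps v)).
    have [e1 e2] := eps_linear P; split=> [c u w|j a w j0 ga].
      by rewrite e1 mulrDr mulrCA.
    by rewrite (e2 j) // mulr0.
  move=> j; have hj (j' : gf_idx (P 0)) : homog gr 0 (gf_bas j' :
    P 0) by have := homog_bas gA j'; rewrite Pdeg.
  have -> : gf_bas j = (res_eps (gf_bas j))%:A *: gf_bas i.
    apply/eqP; rewrite -subr_eq0; apply/eqP/Pzero.
      apply: (homogD gA (hj j)); rewrite -scaleNr -scaleNr.
      by apply: (homogZ (j := 0%N) gA _ (hj i)); apply: (gr_scalar gA).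
    have el := eps_linear P.
    rewrite (linear_to_F_D el) -scaleNr -scaleNr (linear_to_F_Z gA el) i1 mulr1.
    by rewrite (aug_scalar gA) subrr.
  rewrite (linear_to_F_Z gA (proj1 fh)) (linear_to_F_Z gA (eps_linear P)) i1 mulr1.
  by rewrite (aug_scalar gA) mulrC.
- exact/gen_Ext11/hom_is_cocycle.
have /choice[x xP] : forall i : gf_idx (P 1), exists g : P 1 -> F,
    hom_to_F gr 1 g /\ forall j, g (gf_bas j) = (i == j)%:R.
  by move=> i; have [g] := dual_basis i; exists g.
have /choice[y yP] : forall i : gf_idx (P n.+1), exists g : P n.+1 -> F,
    hom_to_F gr n.+1 g /\ forall j, g (gf_bas j) = (i == j)%:R.
  by move=> i; have [g] := dual_basis i; exists g.
have /choice[phi phiP] : forall j, exists phi,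
  @chain_lift _ _ _ P n.+1 n.+1 (y j) phi.
  by move=> j; apply/chain_lift_exists/hom_is_cocycle; case: (yP j).
pose h (p : gf_idx (P 1) * gf_idx (P n.+1)) (v : P n.+2) := x p.1 (phi p.2 1%N v).
have hgen p : generated_by_Ext11 n.+2 (h p).
  apply: (@gen_product _ _ _ P 1 1 n.+1 n.+1 (x p.1) (y p.2) (phi p.2)) => //.
  - exact/gen_Ext11/hom_is_cocycle/(xP p.1).1.
  - exact/IH/(yP p.2).1.
have [s1 s1P] := Pfin 1; have [sn snP] := Pfin n.+1; have [s sP] := Pfin n.+2.
have hlin p : linear_to_F gr (h p).
  have [[[x1 x2] _] _] := xP p.1.
  by split=> [c u v|j a v j0 ga]; rewrite /h ?linearP ?x1 // linearZ (x2 j).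
(* If all products vanish at [v], then [phi j 1 v = 0] for every [j], hence [phi j 0] kills [d v].
   It sends the basis element [j] to a unit of [P 0] and the others to 0, so [d v = 0]; and a
   boundary of degree [n.+2] in [P n.+2] is 0 because [P n.+3] starts one degree higher. *)
have inj v : homog gr n.+2 v -> (forall p, h p v = 0) -> v = 0.
  move=> hv hp.
  have phi1 j : phi j 1%N v = 0.
    apply: (homog_dual (g := x)) => [i|i||i].
    - by have [] := xP i.
    - by have [] := xP i.
    - by have [_ _ h3 _] := phiP j; exact: (h3 1%N 1%N v hv).
    - exact: (hp (i, j)).
  have phi0 j : phi j 0%N (res_d P n.+1 v) = 0.
    by have [_ h2 _ _] := phiP j; rewrite -(h2 0%N) phi1 linear0.
  have dv0 : res_d P n.+1 v = 0.
    apply: gcoord_inj => j; rewrite gcoord0.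
    have [e0 _ h3 _] := phiP j.
    apply: (@unit_torsion_free _ (phi j 0%N (gf_bas j))).
    - by apply: h3; have := homog_bas gA j; rewrite Pdeg.
    - by rewrite e0; have [_ ->] := yP j; rewrite eqxx.
    rewrite -(phi0 j) [RHS]linear_gcoord.
    case: (boolP (j \in supp (res_d P n.+1 v))) => [jv|/gcoord_out vj].
      rewrite (bigD1_seq j) ?supp_uniq //= big1 ?addr0 // => j' jj'.
      rewrite (_ : phi j 0%N (gf_bas j') = 0) ?scaler0 //; apply: Pzero.
        by apply: h3; have := homog_bas gA j'; rewrite Pdeg.
      by rewrite e0; have [_ ->] := yP j; rewrite eq_sym (negPf jj').
    rewrite vj scale0r big1_seq // => j' /andP[_ j'v].
    have [jj'|jj'] := eqVneq j' j; first by rewrite jj' vj scale0r.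
    rewrite (_ : phi j 0%N (gf_bas j') = 0) ?scaler0 //; apply: Pzero.
      by apply: h3; have := homog_bas gA j'; rewrite Pdeg.
    by rewrite e0; have [_ ->] := yP j; rewrite eq_sym (negPf jj').
  have [w wE] : exists w, v = res_d P n.+2 w by apply/(is_cycleP (n := n.+2)).
  rewrite -(hcomp_id gA hv) wE (d_hcomp gA).
  by rewrite (homog_small _ (hcomp_homog gA n.+2 w)) ?linear0.
have [||g [_ gE]] := @solve_linear_system F _ _ (undup s) [seq (a, b) | a <- s1,
  b <- sn]
  (fun i p => h p (gf_bas i)) (fun i => f (gf_bas i)).
- exact: undup_uniq.
- move=> c cP.
  pose v := \sum_(i <- undup s) (c i)%:A *: (gf_bas i : P n.+2).
  have v0 : v = 0.
    apply: inj => [|p].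
      apply: (homog_sum gA) => i _.
      apply: (homogZ (j := 0%N) gA (gr_scalar gA _)).
      by have := homog_bas gA i; rewrite Pdeg.
    rewrite /v (linear_to_F_sum (hlin p)) -[RHS](cP p); last first.
      by case: p => a b; apply: allpairs_f.
    by apply: eq_bigr => i _; rewrite (linear_to_F_Z gA (hlin p)) (aug_scalar gA).
  move=> i si; apply: (@scalar_inj _ A); rewrite scale0r.
  exact: (gf_free (undup_uniq s) v0 si).
apply: (generated_sum (s := g) (c := fun p => p.1) (h := fun p => h p.2)) => [p|v].
  exact: hgen.
apply: (linear_to_F_eq gA (proj1 fh) (g := fun v => \sum_(p <- g) p.1 * h p.2 v)).
  split=> [c u w|j a w j0 ga].
    rewrite mulr_sumr -big_split; apply: eq_bigr => p _.
    by have [-> _] := hlin p.2; rewrite mulrDr mulrCA.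
  by rewrite big1 // => p _; have [_ h2] := hlin p.2; rewrite (h2 j) // mulr0.
by move=> i; apply: gE; rewrite mem_undup.
Qed.

Lemma linear_resolution_koszul : koszul gr.
Proof.
exists P => n k f [fh _]; case: (eqVneq n k) fh => [<-|nk] fh;
  first exact: diagonal_generated.
apply: (gen_linear (c := 0) (generated0 n k) (generated0 n k)) => v.
rewrite mul0r addr0.
apply: (linear_to_F_eq gA (proj1 fh) (proj1 (hom_to_F_0 gr (P n) n))) => i.
by apply: (hom_to_F_bas gA fh); rewrite Pdeg.
Qed.

End Generation.

Section AnnihilatorsToKoszul.
Context (F : fieldType) {disp : Order.disp_t} (G : finBPOrderType disp).
Hypothesis hG : ranked G.
Context (A : algType F) (gen : gens G -> A) (gr : nat -> A -> Prop) (pi : nat -> A ->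
  A).
Hypothesis raA : ranked_algebra gen gr pi.
Let gA := ra_grading raA.
Local Notation gens := (gens G).
Implicit Types (a t : A) (j k : nat).
Local Notation level_ideal := (level_ideal gen).
Local Notation gen_sum := (gen_sum gen).

Lemma gen_sum0 x : gen_sum x 0 = 0.
Proof.
rewrite /gen_sum big_pred0 // => y; apply/negP => /levelP[_ /eqP].
by rewrite eqn0Ngt (rk_gt0 hG) (valP y).
Qed.

(** 0 belongs to the family because [gen_sum x 0] is 0 and because [level_gens] uses it as a
    placeholder. The bound on [j] is the one under which [ann] describes the annihilator. *)
Definition family t : Prop :=
  [\/ t = 0, exists y, t = gen y | exists x j, (j.+1 < rk x)%N /\ t = gen_sum x j.+1].

Lemma family_gen_sum x j : (j < rk x)%N -> family (gen_sum x j).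
Proof.
by case: j => [|j] jx; [rewrite gen_sum0; apply: Or31|apply: Or33; exists x, j].
Qed.

Lemma family_gr t : family t -> gr 1%N t.
Proof.
case=> [->|[y ->]|[x [j [_ ->]]]]; first exact: gr_zero gA _.
  exact: ra_gen raA _.
exact: gr_gen_sum raA _ _.
Qed.

(** Generators of the level itself are replaced by 0, which keeps the index type independent of [x]
    and [j]. *)
Definition level_gens x j (i : gens + 'I_1) : A :=
  if i is inl y then if val y \in level x j then 0 else gen y else gen_sum x j.

Lemma level_gens_family x j i : (j < rk x)%N -> family (level_gens x j i).
Proof.
case: i => [y|u] jx /=; last exact: family_gen_sum.
by case: ifP => _; [apply: Or31|apply: Or32; exists y].
Qed.

Lemma level_gens_sum x j (b : gens + 'I_1 -> A) : \sum_i level_gens x j i * b i =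
  \sum_(y : gens | val y \notin level x j) gen y * b (inl y)
    + gen_sum x j * b (inr ord0).
Proof.
rewrite big_sumType /= big_ord1 [in RHS]big_mkcond; congr (_ + _).
by apply: eq_bigr => y _; case: ifP; rewrite ?mul0r.
Qed.

Lemma level_gens_independent x j : independent (level_gens x j).
Proof.
move=> b; rewrite level_gens_sum => E.
have h y : gen y * (if val y \in level x j then b (inr ord0) else b (inl y)) = 0.
  move: y; apply: (gen_indep hG raA); rewrite -[RHS]E /gen_sum.
  rewrite mulr_suml [X in _ = X + _]big_mkcond [X in _ = _ + X]big_mkcond -big_split.
  by apply: eq_bigr => y _ /=; case: ifP => /= _; rewrite ?add0r ?addr0.
case=> [y|u] /=; first by have := h y; case: ifP; rewrite ?mul0r.
rewrite (ord1 u) mulr_suml big1 // => y yx; have := h y.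
by rewrite yx.
Qed.

Lemma level_ideal_gens x j a : level_ideal x j a <->
  exists b, a = \sum_i level_gens x j i * b i.
Proof.
split=> [[b [u ->]]|[b ->]].
  by exists (fun i => if i is inl y then b y else u); rewrite level_gens_sum.
by rewrite level_gens_sum; exists (fun y => b (inl y)), (b (inr ord0)).
Qed.

Lemma level_gens_ideal x j i : level_ideal x j (level_gens x j i).
Proof.
apply/level_ideal_gens; exists (fun i' => (i' == i)%:R).
by rewrite (bigD1 i) //= eqxx mulr1 big1 ?addr0 // => i' /negPf->; rewrite mulr0.
Qed.

Hypothesis ann : annihilators_are_level_ideals gen.

Lemma family_ann t : family t -> t = 0 \/ exists (I : finType) (s : I -> A),
  [/\ forall i, family (s i), independent s, forall i, t * s i = 0 &
      forall a, t * a = 0 -> exists b : I -> A, a = \sum_i s i * b i].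
Proof.
case=> [->|[y ->]|[x [j [jx ->]]]]; [by left|right|right].
  have ry : ((rk (val y)).-1 < rk (val y))%N by rewrite prednK // (rk_gt0 hG)
    (valP y).
  exists _, (level_gens (val y) (rk (val y)).-1); split.
  - by move=> i; apply: level_gens_family.
  - exact: level_gens_independent.
  - by move=> i; apply/(gen_ann hG raA)/level_gens_ideal.
  - by move=> a /(gen_ann hG raA)/level_ideal_gens.
exists _, (level_gens x j); split.
- by move=> i; apply: level_gens_family; apply: ltnW.
- exact: level_gens_independent.
- by move=> i; apply: (gen_sum_level_ideal hG raA); apply: level_gens_ideal.
- by move=> a /(ann jx)/level_ideal_gens.
Qed.

(** Generators are renumbered by ordinals to index the rows of matrices. *)
Let r (x : 'I_#|{: gens}|) : A := gen (enum_val x).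

Let r_sum (b : 'I_#|{: gens}| -> A) :
  \sum_x r x * b x = \sum_y gen y * b (enum_rank y).
Proof.
rewrite (reindex (@enum_rank _)); last by apply: onW_bij; apply: enum_rank_bij.
by apply: eq_bigr => y _; rewrite /r enum_rankK.
Qed.

Lemma annihilators_koszul : koszul gr.
Proof.
have [P [Pdeg Pfin Pone Pzero]] : exists P : gfree_resolution gr,
  [/\ forall n (i : gf_idx (P n)), gf_deg i = n,
      forall n, exists s : seq (gf_idx (P n)), forall i, i \in s,
      exists i : gf_idx (P 0), res_eps (gf_bas i) = 1 &
      forall v : P 0, homog gr 0 v -> res_eps v = 0 -> v = 0].
  apply: (linear_resolution gA (r := r) (T := family)) => [c b||x|b||].
  - rewrite r_sum => /(ra_free raA)[c0 h]; split=> // x.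
    have := h (enum_val x); rewrite enum_valK.
    exact: (level_ideal_irrelevant raA).
  - move=> a; have [c [b ->]] := ra_decomp raA a; exists c, (fun x => b (enum_val x)).
    by rewrite r_sum; congr (_ + _); apply: eq_bigr => y _; rewrite enum_rankK.
  - by apply: Or32; exists (enum_val x).
  - rewrite r_sum => /(gen_indep hG raA) h x.
    by have := h (enum_val x); rewrite enum_valK.
  - exact: family_gr.
  - exact: family_ann.
exact: (linear_resolution_koszul gA Pdeg Pfin Pone Pzero).
Qed.

End AnnihilatorsToKoszul.

Theorem theorem1p2 (F : fieldType) (disp : Order.disp_t)
    (G : finBPOrderType disp) (hG : ranked G) :
  uniform G /\ koszul (grade_R F G) <-> cohen_macaulay F G.
Proof.
have [pi raR] := splitting_ranked F hG.
rewrite (cohen_macaulay_detects F hG); split=> [[uG kG]|det].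
  apply/(annihilators_detect hG raR); exact: (koszul_annihilators hG raR uG kG).
split; first exact: (detects_uniform hG det).
by apply: (annihilators_koszul hG raR); apply/(annihilators_detect hG raR).
Qed.
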